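(* Let $D_{out}=\mathbb{R}^n$ and for $r>0$ define $D_r:=\{x\in\mathbb{R}^n:\mathrm{dist}(x,D_{in})\le r\}$. Suppose that for each $r>0$ the smooth MCND flow starting from $D_r$ exists globally in time and, as $t\to\infty$, converges in the Hausdorff distance to the optimal configuration of the elliptic problem. Then for any bounded set $E_0\subset\mathbb{R}^n$ that contains $D_{in}$ compactly, the flow of minimal barriers $\mathcal{M}(E_0)(t)$ starting from $E_0$ converges (in the Hausdorff distance, as $t\to\infty$) to the optimal configuration.
   Context: Fixed data: a smooth open set $D_{in}\subset\subset D_{out}=\mathbb{R}^n$ and a smooth positive function $\phi$ on $\overline{D_{in}}$. $A\subset\subset B$ (''$B$ contains $A$ compactly'') means that $\overline{A}$ is compact and contained in the interior of $B$. $\mathcal{P}(\mathbb{R}^n)$ is the collection of all subsets of $\mathbb{R}^n$. Elliptic problem: minimize $\int|\nabla u|^2dx+Per(\{u>0\})$ over functions $u$ coinciding with $\phi$ on $D_{in}$ and vanishing outside $D_{out}$ (no constraint when $D_{out}=\mathbb{R}^n$); the optimal configuration is the positivity set $\{u>0\}$ of the minimizer. Signed distance: $d_E(x)=\mathrm{dist}(x,E)-\mathrm{dist}(x,\mathbb{R}^n\setminus E)$. Smooth flow: a map $f:[a,b]\to\mathcal{P}(\mathbb{R}^n)$ ($a<b$ real) such that each $f(t)$ is closed and, writing $d(\cdot,t)=d_{f(t)}(\cdot)$, for each $t\in[a,b]$ there is an open set $A_t\supset\partial f(t)$ such that $d(\cdot,\cdot)$ is smooth in $\bigcup_{t\in[a,b]}A_t\times\{t\}$.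 Smooth MCND flow: a tuple $(u,f;[a,b])$ with $u:\mathbb{R}^n\times[a,b]\to\mathbb{R}$ and $f$ a smooth flow on $[a,b]$ such that (1) $D_{in}\subset\subset f(t)\subset\subset D_{out}$ for all $t\in[a,b]$; (2) for all $t\in[a,b]$, $u(x,t)=\phi(x)$ for $x\in\overline{D_{in}}$ and $u(x,t)=0$ for $x\notin f(t)$; (3) for all $t\in[a,b]$, $\Delta_x u(\cdot,t)=0$ in $\mathrm{Int}(f(t))\setminus\overline{D_{in}}$; (4) for $t\in[a,b]$ and $x\in\partial f(t)$, $\frac{\partial d}{\partial t}(x,t)=\Delta_x d(x,t)-u_\nu^2(x,t)$. Here $u_\nu(x,t)=\lim_{s\to0^-}\frac{u(x+s\nu(x),t)-u(x,t)}{s}$, $\nu$ being the outward unit normal to $\partial f(t)$. Conditions (1)-(3) mean that $u(\cdot,t)$ is the capacity potential of $(\phi,\overline{D_{in}})$ relative to $f(t)$, i.e. the minimizer of the Dirichlet energy among functions equal to $\phi$ on $\overline{D_{in}}$ and vanishing outside $f(t)$ (in particular $u=0$ on $\partial f(t)$); thus $u$ is determined by $f$, and $f$ itself is called the smooth MCND flow. It exists globally in time from $D_r$ if there is $f:[0,\infty)\to\mathcal{P}(\mathbb{R}^n)$ with $f(0)=D_r$ whose restriction to each $[0,T]$ is a smooth MCND flow. Barrier: a map $\psi:[c,d]\to\mathcal{P}(\mathbb{R}^n)$ such that (1) $D_{in}\subset\subset\psi(t)\subset\subset D_{out}$ for all $t$; (2) whenever $f:[a,b]\to\mathcal{P}(\mathbb{R}^n)$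 is a smooth MCND flow with $[a,b]\subset[c,d]$ and $f(a)\subset\psi(a)$, then $f(b)\subset\psi(b)$. The minimal barrier starting from $E_0$ on $[c,d]$ is $\mathcal{M}(E_0)(t)=\bigcap\{\psi(t):\psi \text{ a barrier on }[c,d],\ \psi(c)\supset E_0\}$; for the long-time statement the same definition is used with time interval $[0,\infty)$ in place of $[c,d]$.
   Formalization: A smooth flow is also required to have t ↦ d(x,t) continuous for every x and the union of A_t×{t} relatively open in R^n×[a,b]; otherwise new components could appear suddenly and no barrier would exist. The elliptic problem is taken over H^1 functions with {u>0} of finite volume. *)

(* Defs.v *)
From HB Require Import structures.
From mathcomp Require Import all_boot all_order all_algebra.
From mathcomp Require Import all_classical all_reals all_analysis.
Set Implicit Arguments.
Unset Strict Implicit.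
Unset Printing Implicit Defensive.
Import Order.TTheory GRing.Theory Num.Theory.
Import numFieldNormedType.Exports.
Local Open Scope classical_set_scope.
Local Open Scope ring_scope.

(* R^n is 'rV[R]_n. The norm `|x| of the library on 'rV[R]_n is the sup norm;
   it gives the Euclidean topology and the usual bounded sets, but all
   distances below are measured with the Euclidean norm enorm. *)

Section Euclidean.
Context {R : realType} {n : nat}.
Implicit Types (A B E : set 'rV[R]_n) (x : 'rV[R]_n).

Definition enorm x : R := Num.sqrt (\sum_(i < n) x ord0 i ^+ 2).

(* inf set0 = 0, so this is the distance only for nonempty A. *)
Definition dist x A : R := inf [set enorm (x - y) | y in A].

Definition sdist E x : R := dist x E - dist x (~` E).

Definition bnd A : set 'rV[R]_n := closure A `\` interior A.

Definition contained_compactly A B : Prop :=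
  compact (closure A) /\ closure A `<=` interior B.

Definition thicken A (e : R) : set 'rV[R]_n :=
  [set x | exists2 y, A y & enorm (x - y) <= e].

Definition hausdorff A B : \bar R :=
  ereal_inf [set e%:E | e in
    [set e : R | [/\ 0 <= e, A `<=` thicken B e & B `<=` thicken A e]]].

End Euclidean.

Section Smoothness.
Context {R : realType}.

Fixpoint Ck {V : normedModType R} (k : nat) (U : set V) (f : V -> R^o) : Prop :=
  (forall x, U x -> {for x, continuous f}) /\
  match k with
  | 0 => True
  | k'.+1 => forall v : V,
      (forall x, U x -> derivable f x v) /\ Ck k' U ('D_v f)
  end.

Definition Cinfty {V : normedModType R} (U : set V) (f : V -> R^o) : Prop :=
  forall k, Ck k U f.

(* Smoothness on a set that need not be open: local smooth extensions. On an
   open set this is Cinfty. *)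
Definition smooth_on {V : normedModType R} (S : set V) (f : V -> R^o) : Prop :=
  forall x, S x -> exists U : set V, exists g : V -> R^o,
    [/\ open U, U x, Cinfty U g & forall y, U y -> S y -> f y = g y].

Context {n : nat}.
Implicit Types (f : 'rV[R]_n -> R^o) (x : 'rV[R]_n).

Definition partial (i : 'I_n) f x : R^o := 'D_(delta_mx ord0 i) f x.

Definition grad f x : 'rV[R]_n := \row_(i < n) partial i f x.

Definition laplacian f x : R := \sum_(i < n) partial i (partial i f) x.

Definition harmonic_on (U : set 'rV[R]_n) f : Prop :=
  Ck 2 U f /\ forall x, U x -> laplacian f x = 0.

Definition smooth_open_set (D : set 'rV[R]_n) : Prop :=
  open D /\ forall p, bnd D p -> exists U : set 'rV[R]_n, exists g,
    [/\ open U, U p, Cinfty U g, grad g p != 0 &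
        forall x, U x -> (D x <-> g x < 0)].

End Smoothness.

(* Lebesgue measure on R^n, on the product sigma-algebra of n.-tuple R: the
   n-fold product of the one-dimensional Lebesgue measure. *)
Section LebesgueMeasure.
Context {R : realType}.

Section Step.
Context {n : nat} (m : {sigma_finite_measure set (n.-tuple R) -> \bar R}).

Definition tcons (p : R * n.-tuple R) : n.+1.-tuple R := [tuple of p.1 :: p.2].

Lemma measurable_tcons : measurable_fun setT tcons.
Proof. exact: (measurable_cons measurable_fst measurable_snd). Qed.

Definition lebesgue_step : set (n.+1.-tuple R) -> \bar R :=
  pushforward (product_measure1 (@lebesgue_measure R) m) tcons.

Let tcons_preimage A : measurable A -> measurable (tcons @^-1` A).
Proof.
by move=> mA; rewrite -[X in measurable X]setTI; exact: measurable_tcons.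
Qed.

Let step0 : lebesgue_step set0 = 0%E.
Proof. by rewrite /lebesgue_step /pushforward preimage_set0 measure0. Qed.

Let step_ge0 A : (0 <= lebesgue_step A)%E.
Proof. by rewrite /lebesgue_step /pushforward; apply: measure_ge0. Qed.

Let step_sigma_additive : semi_sigma_additive lebesgue_step.
Proof.
move=> F mF tF mUF; rewrite /lebesgue_step /pushforward preimage_bigcup.
apply: measure_semi_sigma_additive.
- by move=> k; exact: tcons_preimage.
- apply/trivIsetP => /= i j _ _ ij; rewrite -preimage_setI.
  by move/trivIsetP : tF => /(_ _ _ _ _ ij) ->//; rewrite preimage_set0.
- by rewrite -preimage_bigcup; exact: tcons_preimage.
Qed.

HB.instance Definition _ := isMeasure.Build _ _ _ lebesgue_step
  step0 step_ge0 step_sigma_additive.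

Let step_sigma_finite : sigma_finite setT lebesgue_step.
Proof.
have /sigma_finiteP[F [FT Fnd Foo]] := sigma_finiteT (@lebesgue_measure R).
have /sigma_finiteP[G [GT Gnd Goo]] := sigma_finiteT m.
pose g (t : n.+1.-tuple R) : R * n.-tuple R := (thead t, [tuple of behead t]).
have mg : measurable_fun setT g.
  apply/measurable_fun_pair; first exact: measurable_tnth.
  exact: measurable_behead.
have gK : g \o tcons = id.
  by apply/funext => -[x t]; congr pair => //=; exact/val_inj.
exists (fun i => g @^-1` (F i `*` G i)).
  rewrite -preimage_bigcup (_ : \bigcup_i _ = setT) ?preimage_setT//.
  apply/seteqP; split => // -[x y] _.
  have [i _ Fx] : (\bigcup_i F i) x by rewrite -FT.
  have [j _ Gy] : (\bigcup_i G i) y by rewrite -GT.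
  exists (maxn i j) => //; split => /=.
    by move: x Fx; exact/subsetPset/Fnd/leq_maxl.
  by move: y Gy; exact/subsetPset/Gnd/leq_maxr.
move=> i; have [mF Fi] := Foo i; have [mG Gi] := Goo i; split.
  by rewrite -[X in measurable X]setTI; apply: mg => //; exact: measurableX.
rewrite /lebesgue_step /pushforward -comp_preimage gK preimage_id.
by rewrite product_measure1E// lte_mul_pinfty// ge0_fin_numE.
Qed.

HB.instance Definition _ := Measure_isSigmaFinite.Build _ _ _ lebesgue_step
  step_sigma_finite.

End Step.

Fixpoint lebesgue (n : nat) :
    {sigma_finite_measure set (n.-tuple R) -> \bar R} :=
  match n with
  | 0 => @dirac _ (0.-tuple R) [tuple] R
  | n'.+1 => lebesgue_step (lebesgue n')
  end.

End LebesgueMeasure.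

Section Variational.
Context {R : realType} {n : nat}.
Implicit Types (u v : 'rV[R]_n -> R) (g T : 'rV[R]_n -> 'rV[R]_n).
Implicit Types (E : set 'rV[R]_n).

Definition vec (t : n.-tuple R) : 'rV[R]_n := \row_(i < n) tnth t i.

Definition integral_Rn (F : 'rV[R]_n -> \bar R) : \bar R :=
  (\int[lebesgue n]_t F (vec t))%E.

Definition volume E : \bar R := lebesgue n (vec @^-1` E).

Definition borel_fun u : Prop := measurable_fun setT (u \o vec).

Definition test_fun (f : 'rV[R]_n -> R^o) : Prop :=
  Cinfty setT f /\ compact (closure [set x | f x != 0]).

Definition weak_gradient u g : Prop :=
  [/\ forall i, borel_fun (fun x => g x ord0 i),
      (integral_Rn (fun x => (enorm (g x) ^+ 2)%:E) < +oo)%E &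
      forall f i, test_fun f ->
        integral_Rn (fun x => (u x * partial i f x)%:E) =
        (- integral_Rn (fun x => (g x ord0 i * f x)%:E))%E].

(* +oo when u has no square integrable weak gradient; otherwise the weak
   gradient is unique almost everywhere and the infimum is over one value. *)
Definition dirichlet_energy u : \bar R :=
  ereal_inf [set integral_Rn (fun x => (enorm (g x) ^+ 2)%:E)
            | g in weak_gradient u].

Definition in_H1 u : Prop :=
  [/\ borel_fun u, (integral_Rn (fun x => (u x ^+ 2)%:E) < +oo)%E &
      exists g, weak_gradient u g].

Definition divergence T (x : 'rV[R]_n) : R :=
  \sum_(i < n) partial i (fun y => T y ord0 i) x.

(* De Giorgi perimeter in R^n *)
Definition perimeter E : \bar R :=
  ereal_sup [set integral_Rn (fun x => (\1_E x * divergence T x)%:E) | T in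
    [set T : 'rV[R]_n -> 'rV[R]_n |
      (forall i, test_fun (fun y => T y ord0 i)) /\
      (forall x, enorm (T x) <= 1)]].

Context (Din Dout : set 'rV[R]_n) (phi : 'rV[R]_n -> R).

Definition positivity_set u : set 'rV[R]_n := [set x | 0 < u x].

(* The positivity set is required to have finite volume. This is automatic for
   bounded Dout; for Dout = R^n it excludes functions with {u > 0} = R^n, whose
   perimeter term would be Per(R^n) = 0. *)
Definition elliptic_admissible u : Prop :=
  [/\ in_H1 u, forall x, Din x -> u x = phi x,
      forall x, ~ Dout x -> u x = 0 &
      (volume (positivity_set u) < +oo)%E].

Definition elliptic_energy u : \bar R :=
  (dirichlet_energy u + perimeter (positivity_set u))%E.

Definition elliptic_minimizer u : Prop :=
  elliptic_admissible u /\
  forall v, elliptic_admissible v -> (elliptic_energy u <= elliptic_energy v)%E.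

Definition optimal_configuration (Omega : set 'rV[R]_n) : Prop :=
  exists2 u, elliptic_minimizer u & Omega = positivity_set u.

Definition potential_competitor E u : Prop :=
  [/\ in_H1 u, forall x, closure Din x -> u x = phi x &
      forall x, ~ E x -> u x = 0].

(* The continuous representative of the minimizer; for closed E it vanishes on
   the boundary of E. *)
Definition capacity_potential E u : Prop :=
  [/\ continuous u, potential_competitor E u &
      forall v, potential_competitor E v ->
        (dirichlet_energy u <= dirichlet_energy v)%E].

End Variational.

Section Flow.
Context {R : realType} {n : nat}.
Implicit Types (f psi : R -> set 'rV[R]_n) (u : R -> 'rV[R]_n -> R).

(* S below is the union of the A_t x {t}. It is relatively open in
   R^n x [a, b], so that d is smooth in a space-time neighbourhood of the moving
   boundary, and d is continuous in time, so that no component of f(t) appears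
   or disappears abruptly. *)
Definition smooth_flow (a b : R) f : Prop :=
  [/\ a < b,
      forall t, a <= t <= b -> closed (f t),
      forall x, {within `[a, b], continuous (fun t => sdist (f t) x)} &
      exists A : R -> set 'rV[R]_n,
        let strip := [set p : 'rV[R]_n * R^o | a <= p.2 <= b] in
        let S := [set p | strip p /\ A p.2 p.1] in
        [/\ forall t, a <= t <= b -> open (A t) /\ bnd (f t) `<=` A t,
            exists2 O, open O & S = O `&` strip &
            smooth_on S (fun p => sdist (f p.2) p.1)]].

(* Outward, of unit length where d is smooth near the boundary. *)
Definition outward_normal (E : set 'rV[R]_n) (x : 'rV[R]_n) : 'rV[R]_n :=
  grad (sdist E) x.

Definition is_normal_derivative (E : set 'rV[R]_n) (v : 'rV[R]_n -> R)
    (x : 'rV[R]_n) (q : R) : Prop :=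
  (v (x + s *: outward_normal E x) - v x) / s @[s --> (0 : R)^'-] --> q.

(* One-sided at the endpoints of [a, b]. *)
Definition is_time_derivative (a b : R) (h : R -> R) (t l : R) : Prop :=
  (h s - h t) / (s - t) @[s --> within `[a, b] t^'] --> l.

Context (Din Dout : set 'rV[R]_n) (phi : 'rV[R]_n -> R).

Record smooth_MCND_flow (a b : R) u f : Prop := {
  mcnd_smooth : smooth_flow a b f;
  mcnd_between : forall t, a <= t <= b ->
    contained_compactly Din (f t) /\ contained_compactly (f t) Dout;
  mcnd_in : forall t, a <= t <= b ->
    forall x, closure Din x -> u t x = phi x;
  mcnd_out : forall t, a <= t <= b -> forall x, ~ f t x -> u t x = 0;
  mcnd_harmonic : forall t, a <= t <= b ->
    harmonic_on (interior (f t) `\` closure Din) (u t);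
  mcnd_potential : forall t, a <= t <= b ->
    capacity_potential Din phi (f t) (u t);
  mcnd_velocity : forall t, a <= t <= b -> forall x, bnd (f t) x ->
    exists2 q, is_normal_derivative (f t) (u t) x q &
      is_time_derivative a b (fun s => sdist (f s) x) t
        (laplacian (sdist (f t)) x - q ^+ 2)
}.

Definition is_MCND_flow (a b : R) f : Prop :=
  exists u, smooth_MCND_flow a b u f.

Definition global_MCND_flow f (E : set 'rV[R]_n) : Prop :=
  f 0 = E /\ forall T, 0 < T -> is_MCND_flow 0 T f.

(* I is the time interval, [c, d] or [c, +oo[. *)
Definition barrier (I : set R) psi : Prop :=
  (forall t, I t ->
     contained_compactly Din (psi t) /\ contained_compactly (psi t) Dout) /\
  forall a b f, `[a, b]%classic `<=` I -> is_MCND_flow a b f ->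
    f a `<=` psi a -> f b `<=` psi b.

(* c is the initial time of I. *)
Definition minimal_barrier (I : set R) (c : R) (E0 : set 'rV[R]_n) (t : R) :
    set 'rV[R]_n :=
  [set x | forall psi, barrier I psi -> E0 `<=` psi c -> psi t x].

End Flow.

(* Main.v *)
Require Import Defs.
From mathcomp Require Import all_boot all_order all_algebra.
From mathcomp Require Import all_classical all_reals all_analysis.
From mathcomp Require Import ring lra.

(** The minimal barrier is squeezed between two of the given global flows.  Choose
    r so small that D_r lies in E0 and s so large that E0 lies in the interior of
    D_s.  Every barrier that contains E0 at time 0 contains D_r, hence contains the
    flow from D_r at all later times: this flow lies in the minimal barrier.
    Conversely the interiors of the flow from D_s form a barrier
    (interior_global_flow_barrier), so the minimal barrier lies in that flow.  Both
    flows converge to the optimal configuration, and the Hausdorff distance of a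
    set between them is controlled by theirs.

    That the interiors of a global flow form a barrier is the strict comparison
    principle (strict_comparison): if f and g are smooth flows and g(a) lies in the
    interior of f(a), then g(b) lies in the interior of f(b).  One shows that g(t)
    stays in the inner parallel set of f(t) of depth delta(t), which decays
    exponentially.  At a first contact the two boundaries touch after a translation
    of length delta(t): the curvatures are ordered, so the decay of the depth must
    be compensated by the normal derivatives of the potentials (no_first_contact).
    But the translated potential of g is at most 1 + C delta times the one of f
    (shifted_potential_le).  This follows from the maximum principle away from Din,
    from the interior Lipschitz estimate for harmonic functions, proved by a
    reflection argument (reflect_diff_le), and from a positive lower bound for the
    potential of f near Din (harmonic_lower_bound), both uniform in time.  The
    normal derivatives of the potential of f are bounded because, by the velocity
    law, their squares are the Laplacian minus the time derivative of a signed
    distance that is smooth near the moving boundary (flow_normal_bound).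

    A first contact exists only if the flow g does not leave the region of strict
    inclusion through infinity.  The definition of a smooth flow does not exclude
    this a priori; it follows from the velocity law by comparison with shrinking
    exterior balls (flow_right_bounded) and with growing enclosing balls
    (flow_bounded).

    Signed distances are compared through their 1-Lipschitz property only: a set
    inclusion at depth r is an inequality between signed distances on the whole
    space (sdist_deep), so that their difference has an extremum at each contact
    point. *)

Set Implicit Arguments.
Unset Strict Implicit.
Unset Printing Implicit Defensive.
Import Order.TTheory GRing.Theory Num.Theory.
Import numFieldNormedType.Exports.
Local Open Scope classical_set_scope.
Local Open Scope ring_scope.

(** * Uniform constants on compact sets *)

(** All constants below that are uniform in space-time come from this form of
    compactness: a property that holds near each point for all small enough
    parameters holds on the whole compact set for one parameter. *)
Lemma compact_uniform {R : realType} (T : topologicalType) (K : set T)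
    (P : R -> T -> Prop) : compact K ->
  (forall x, K x -> exists2 d : R, 0 < d &
     nbhs x [set y | forall e, 0 < e -> e <= d -> P e y]) ->
  exists2 e : R, 0 < e & forall x, K x -> P e x.
Proof.
move=> /compact_near_coveringP cK KP.
have nearK : \forall e \near (0 : R)^'+, K `<=` P e.
  apply: (cK R ((0 : R)^'+) P) => x Kx; have [d d0 dP] := KP x Kx.
  exists ([set y | forall e, 0 < e -> e <= d -> P e y], [set e | 0 < e /\ e <= d]) => /=.
    split => //; apply: filterI; first exact: nbhs_right_gt.
    exact: nbhs_right_le.
  by move=> [y e] /= [yP [e0 ed]]; exact: yP.
near ((0 : R)^'+) => e; exists e; first by near: e; exact: nbhs_right_gt.
by near: e; exact: nearK.
Unshelve. all: by end_near.
Qed.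

(** * The Euclidean norm on row vectors *)

Section EuclideanNorm.
Context {R : realType} {n : nat}.
Implicit Types (x y z v : 'rV[R]_n) (a r : R).

Definition dotp x y : R := \sum_(i < n) x ord0 i * y ord0 i.

Lemma dotpC x y : dotp x y = dotp y x.
Proof. by apply: eq_bigr => i _; rewrite mulrC. Qed.

Lemma dotpDl x y z : dotp (x + y) z = dotp x z + dotp y z.
Proof. by rewrite -big_split; apply: eq_bigr => i _; rewrite mxE mulrDl. Qed.

Lemma dotpZl a x y : dotp (a *: x) y = a * dotp x y.
Proof. by rewrite mulr_sumr; apply: eq_bigr => i _; rewrite mxE mulrA. Qed.

Lemma dotpNl x y : dotp (- x) y = - dotp x y.
Proof. by rewrite -scaleN1r dotpZl mulN1r. Qed.

Lemma dotpDr x y z : dotp z (x + y) = dotp z x + dotp z y.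
Proof. by rewrite dotpC dotpDl !(dotpC z). Qed.

Lemma dotpZr a x y : dotp y (a *: x) = a * dotp y x.
Proof. by rewrite dotpC dotpZl dotpC. Qed.

Lemma dotpNr x y : dotp x (- y) = - dotp x y.
Proof. by rewrite dotpC dotpNl dotpC. Qed.

Lemma dotp_ge0 x : 0 <= dotp x x.
Proof. by apply: sumr_ge0 => i _; rewrite -expr2 sqr_ge0. Qed.

Lemma sqr_enorm x : enorm x ^+ 2 = dotp x x.
Proof.
rewrite /enorm sqr_sqrtr; last by apply: sumr_ge0 => i _; exact: sqr_ge0.
by apply: eq_bigr => i _; rewrite expr2.
Qed.

Lemma enorm_ge0 x : 0 <= enorm x.
Proof. exact: sqrtr_ge0. Qed.
Hint Resolve enorm_ge0 : core.

Lemma enormZ a x : enorm (a *: x) = `|a| * enorm x.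
Proof.
rewrite /enorm -sqrtr_sqr -sqrtrM ?sqr_ge0// mulr_sumr.
by congr Num.sqrt; apply: eq_bigr => i _; rewrite mxE exprMn.
Qed.

Lemma enormN x : enorm (- x) = enorm x.
Proof. by rewrite -scaleN1r enormZ normrN1 mul1r. Qed.

Lemma enorm0 : enorm (0 : 'rV[R]_n) = 0.
Proof. by rewrite -(scale0r (0 : 'rV[R]_n)) enormZ normr0 mul0r. Qed.

Lemma enormB x y : enorm (x - y) = enorm (y - x).
Proof. by rewrite -enormN opprB. Qed.

Lemma dotp_le_enorm x y : dotp x y <= enorm x * enorm y.
Proof.
have [x0|x0] := eqVneq (enorm x) 0.
  have : dotp x x = 0 by rewrite -sqr_enorm x0 expr0n.
  move=> /eqP; rewrite psumr_eq0; last first.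
    by move=> i _; rewrite -expr2 sqr_ge0.
  move=> /allP x_eq0; rewrite x0 mul0r /dotp big1// => i _.
  move: (x_eq0 i (mem_index_enum _)) => /=.
  by rewrite mulf_eq0 orbb => /eqP ->; rewrite mul0r.
have xgt0 : 0 < enorm x by rewrite lt_def x0 enorm_ge0.
pose v := enorm y *: x - enorm x *: y.
have : 0 <= dotp v v by exact: dotp_ge0.
rewrite /v !(dotpDl, dotpDr, dotpNl, dotpNr, dotpZl, dotpZr) (dotpC y x).
rewrite -!sqr_enorm => vge0.
have [y0|y0] := eqVneq (enorm y) 0.
  have : dotp y y = 0 by rewrite -sqr_enorm y0 expr0n.
  move=> /eqP; rewrite psumr_eq0; last first.
    by move=> i _; rewrite -expr2 sqr_ge0.
  move=> /allP y_eq0; rewrite y0 mulr0 /dotp big1// => i _.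
  move: (y_eq0 i (mem_index_enum _)) => /=.
  by rewrite mulf_eq0 orbb => /eqP ->; rewrite mulr0.
have ygt0 : 0 < enorm y by rewrite lt_def y0 enorm_ge0.
move: vge0; set a := enorm x; set b := enorm y; set c := dotp x y => vge0.
suff : 0 <= 2 * (a * b) * (a * b - c).
  by rewrite pmulr_rge0 ?subr_ge0// !mulr_gt0.
by move: vge0; congr (0 <= _); ring.
Qed.

Lemma enormD x y : enorm (x + y) <= enorm x + enorm y.
Proof.
rewrite -(@ler_pXn2r _ 2)// ?nnegrE ?addr_ge0//.
rewrite sqrrD !sqr_enorm dotpDl !dotpDr (dotpC y x).
by have := dotp_le_enorm x y; lra.
Qed.

Lemma enorm_triangle x y z : enorm (x - z) <= enorm (x - y) + enorm (y - z).
Proof. by rewrite -[x - z](subrKA y) enormD. Qed.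

Lemma coord_le_enorm x (i : 'I_n) : `|x ord0 i| <= enorm x.
Proof.
rewrite -sqrtr_sqr ler_wsqrtr// (bigD1 i)//= lerDl.
by apply: sumr_ge0 => j _; exact: sqr_ge0.
Qed.

Lemma coord_le_norm x (i : 'I_n) : `|x ord0 i| <= `|x|.
Proof.
rewrite [leRHS]mx_normrE (bigD1 (ord0, i))//= le_max; apply/orP; left.
exact: lexx.
Qed.

Lemma norm_le_coord x r : 0 <= r -> (forall i, `|x ord0 i| <= r) -> `|x| <= r.
Proof.
move=> r0 xr; rewrite [leLHS]mx_normrE; apply: bigmax_le => // -[i j] _ /=.
by rewrite (ord1 i).
Qed.

Lemma norm_le_enorm x : `|x| <= enorm x.
Proof. by apply: norm_le_coord => // i; exact: coord_le_enorm. Qed.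

Lemma enorm_le_sum x : enorm x <= \sum_(i < n) `|x ord0 i|.
Proof.
rewrite -(@ler_pXn2r _ 2)// ?nnegrE ?sumr_ge0//.
rewrite sqr_enorm expr2 mulr_suml; apply: ler_sum => i _.
rewrite (le_trans (ler_norm _))// normrM ler_wpM2l//.
by rewrite (bigD1 i)//= lerDl sumr_ge0.
Qed.

Lemma enorm_le_norm x : enorm x <= n%:R * `|x|.
Proof.
apply: (le_trans (enorm_le_sum x)).
have -> : n%:R * `|x| = \sum_(i < n) `|x|.
  by rewrite sumr_const card_ord mulr_natl.
by apply: ler_sum => i _; exact: coord_le_norm.
Qed.

Lemma nbhs_enormP x (A : set 'rV[R]_n) :
  nbhs x A <-> exists2 e, 0 < e & forall y, enorm (x - y) < e -> A y.
Proof.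
split.
  rewrite -(@nbhs_ballE _ 'rV[R]_n) => -[e /= e0 eA].
  exists e => // y xy; apply: eA; rewrite -ball_normE /=.
  by rewrite (le_lt_trans _ xy)// norm_le_enorm.
case=> e e0 eA; rewrite -(@nbhs_ballE _ 'rV[R]_n).
have n1 : 0 < n%:R + 1 :> R by rewrite ltr_wpDl.
exists (e / (n%:R + 1)) => /=; first by rewrite divr_gt0.
move=> y; rewrite -ball_normE /= => xy; apply: eA.
rewrite (le_lt_trans (enorm_le_norm _))//.
move: xy; rewrite ltr_pdivlMr// mulrC; apply: le_lt_trans.
by rewrite mulrDl mul1r lerDl.
Qed.

Lemma nbhs_space_time x (t : R) (A : set ('rV[R]_n * R^o)) :
  nbhs (x, t : R^o) A <-> exists2 r : R, 0 < r &
    forall y s, enorm (x - y) < r -> `|t - s| < r -> A (y, s).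
Proof.
split=> [[[B C] /= [/nbhs_enormP[r1 r10 r1B]]]|[r r0 rA]].
  move=> /(@nbhs_ballP R R^o)[r2 /= r20 r2C] BC.
  exists (Num.min r1 r2); first by rewrite lt_min r10.
  move=> y s; rewrite !lt_min => /andP[xy _] /andP[_ ts]; apply: BC; split => /=.
    exact: r1B.
  by apply: r2C; rewrite -ball_normE.
exists ([set y | enorm (x - y) < r], [set s : R^o | `|t - s| < r]).
  split; first by apply/nbhs_enormP; exists r.
  by apply/(@nbhs_ballP R R^o); exists r => // s /=; rewrite -ball_normE.
by move=> [y s] [/= xy ts]; exact: rA.
Qed.

Lemma lipschitz1_continuous (f : 'rV[R]_n -> R) :
  (forall x y, f x <= f y + enorm (x - y)) -> continuous f.
Proof.
move=> flip x; apply/(@cvgrPdist_lt _ _ _ (nbhs x)) => e e0; apply/nbhs_enormP.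
exists e => // y xy; rewrite ltr_norml.
have := flip x y; have := flip y x; rewrite (enormB y x); lra.
Qed.

Lemma enorm_lip x y : enorm x <= enorm y + enorm (x - y).
Proof. by rewrite -{1}(subrK y x) addrC; exact: enormD. Qed.

Lemma enorm_continuous : continuous (@enorm R n).
Proof. by apply: lipschitz1_continuous => x y; exact: enorm_lip. Qed.

Lemma closed_enorm_ball r : closed [set x : 'rV[R]_n | enorm x <= r].
Proof.
have -> : [set x : 'rV[R]_n | enorm x <= r] = enorm @^-1` [set y | y <= r] by [].
apply: closed_comp; last exact: closed_le.
by move=> x _; exact: enorm_continuous.
Qed.

Lemma bounded_enorm (A : set 'rV[R]_n) r :
  (forall x, A x -> enorm x <= r) -> bounded_set A.
Proof.
move=> Ar; exists r; split; first exact: num_real.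
move=> M rM x /Ar xr /=; apply: le_trans (norm_le_enorm x) _.
exact: (le_trans xr (ltW rM)).
Qed.

Lemma compact_enorm (A : set 'rV[R]_n) r :
  closed A -> (forall x, A x -> enorm x <= r) -> compact A.
Proof. by move=> cA Ar; apply: bounded_closed_compact (bounded_enorm Ar) cA. Qed.

Lemma bounded_enormP (A : set 'rV[R]_n) :
  bounded_set A -> exists2 r, 0 < r & forall x, A x -> enorm x <= r.
Proof.
case=> M [_ MA]; pose L := Num.max M 0 + 1.
have ML : M < L by rewrite ltr_pwDr// le_max lexx.
have L0 : 0 < L by rewrite ltr_pwDr// le_max lexx orbT.
exists ((n%:R + 1) * L); first by rewrite mulr_gt0// ltr_wpDl.
move=> x /(MA _ ML) /= xL; apply: (le_trans (enorm_le_norm x)).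
by rewrite ler_pM// lerDl.
Qed.

Lemma closureP (A : set 'rV[R]_n) x :
  closure A x <-> forall e, 0 < e -> exists2 y, A y & enorm (x - y) < e.
Proof.
split=> [cA e e0|H B /nbhs_enormP[e e0 eB]].
  have /cA[y [Ay /= xy]] : nbhs x [set y | enorm (x - y) < e].
    by apply/nbhs_enormP; exists e.
  by exists y.
by have [y Ay xy] := H e e0; exists y; split => //; exact: eB.
Qed.

Lemma interiorP (A : set 'rV[R]_n) x :
  interior A x <-> exists2 e, 0 < e & forall y, enorm (x - y) < e -> A y.
Proof. exact: nbhs_enormP. Qed.

Lemma closure_setCP (A : set 'rV[R]_n) x : closure (~` A) x <-> ~ interior A x.
Proof.
split=> [/closureP cA /interiorP[e e0 eA]|IA].
  by have [y Ay /eA] := cA e e0.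
apply/closureP => e e0; apply: contrapT => H; apply: IA; apply/interiorP.
by exists e => // y xy; apply: contrapT => Ay; apply: H; exists y.
Qed.

End EuclideanNorm.
#[global] Hint Extern 0 (is_true (0 <= enorm _)) => solve [apply: enorm_ge0] : core.

(** * Distance and signed distance *)

Section Distance.
Context {R : realType} {n : nat}.
Implicit Types (A B E F : set 'rV[R]_n) (x y z : 'rV[R]_n) (r : R).

Let dist_has_inf A x : A !=set0 -> has_inf [set enorm (x - y) | y in A].
Proof.
case=> y Ay; split; first by exists (enorm (x - y)); exists y.
by exists 0 => _ [z _ <-].
Qed.

Lemma dist_le A x y : A y -> dist x A <= enorm (x - y).
Proof.
move=> Ay; apply: ge_inf; last by exists y.
by exists 0 => _ [z _ <-].
Qed.

Lemma dist_lb A x r :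
  A !=set0 -> (forall y, A y -> r <= enorm (x - y)) -> r <= dist x A.
Proof.
case=> y Ay Ar; apply: lb_le_inf; first by exists (enorm (x - y)); exists y.
by move=> _ [z Az <-]; exact: Ar.
Qed.

Lemma dist_lt A x r :
  A !=set0 -> dist x A < r -> exists2 y, A y & enorm (x - y) < r.
Proof.
move=> A0 xr; have r0 : 0 < r - dist x A by rewrite subr_gt0.
have [_ [y Ay <-] xy] := inf_adherent r0 (dist_has_inf x A0).
by exists y => //; move: xy; rewrite -/(dist x A); lra.
Qed.

Lemma dist_ge0 A x : 0 <= dist x A.
Proof.
have [->|/set0P A0] := eqVneq A set0; first by rewrite /dist image_set0 inf0.
by apply: dist_lb.
Qed.

Lemma dist_lip A x y : dist x A <= dist y A + enorm (x - y).
Proof.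
have [->|/set0P A0] := eqVneq A set0; first by rewrite /dist !image_set0 inf0 add0r.
rewrite -lerBlDr; apply: dist_lb => // z Az; rewrite lerBlDr addrC.
by apply: le_trans (dist_le _ Az) _; exact: enorm_triangle.
Qed.

Lemma dist_eq0 A x : A x -> dist x A = 0.
Proof.
move=> Ax; apply/eqP; rewrite eq_le dist_ge0 andbT.
by rewrite (le_trans (dist_le x Ax))// subrr enorm0.
Qed.

Lemma dist_le_closure A x : A !=set0 -> closure A x <-> dist x A <= 0.
Proof.
move=> A0; split=> [/closureP cA|xA].
  apply/ler_addgt0Pr => e e0; rewrite add0r.
  by have [y /(dist_le x) xy /ltW] := cA e e0; apply: le_trans.
by apply/closureP => e e0; apply: dist_lt => //; exact: le_lt_trans e0.
Qed.

Lemma sdist_in E x : E x -> sdist E x = - dist x (~` E).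
Proof. by move=> Ex; rewrite /sdist dist_eq0// sub0r. Qed.

Lemma sdist_out E x : ~ E x -> sdist E x = dist x E.
Proof. by move=> Ex; rewrite /sdist (@dist_eq0 (~` E))// subr0. Qed.

Lemma sdist_in_le0 E x : E x -> sdist E x <= 0.
Proof. by move=> Ex; rewrite sdist_in// oppr_le0 dist_ge0. Qed.

Lemma sdist_out_ge0 E x : ~ E x -> 0 <= sdist E x.
Proof. by move=> Ex; rewrite sdist_out// dist_ge0. Qed.

Lemma sdist_lt0 E x : sdist E x < 0 -> E x.
Proof. by move=> xE; apply: contrapT => /sdist_out_ge0; rewrite leNgt xE. Qed.

Lemma sdist_gt0 E x : closed E -> E !=set0 -> ~ E x -> 0 < sdist E x.
Proof.
move=> cE E0 Ex; rewrite ltNge; apply/negP; rewrite sdist_out// => xE; apply: Ex.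
by apply: cE; apply/(dist_le_closure _ E0).
Qed.

Lemma sdist_closed E x : closed E -> E !=set0 -> sdist E x <= 0 -> E x.
Proof.
by move=> cE E0 xE; apply: contrapT => /(sdist_gt0 cE E0); rewrite ltNge xE.
Qed.

(** Points of E and of its complement accumulate at the parameter that is the
    supremum of those whose points on the segment lie in E; the two distances
    are bounded by the two pieces of the segment. *)
Let segment_crossing E x y : E x -> ~ E y ->
  dist x (~` E) + dist y E <= enorm (x - y).
Proof.
move=> Ex Ey; pose p a := x + a *: (y - x).
have p0 : p 0 = x by rewrite /p scale0r addr0.
have p1 : p 1 = y by rewrite /p scale1r addrC subrK.
have pB a b : enorm (p a - p b) = `|a - b| * enorm (x - y).
  have -> : p a - p b = (a - b) *: (y - x).
    by rewrite /p scalerBl opprD addrACA subrr add0r.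
  by rewrite enormZ (enormB x y).
pose S := [set a : R | 0 <= a <= 1 /\ E (p a)].
have S0 : S 0 by split; rewrite ?lexx ?ler01// p0.
have hS : has_sup S by split; [exists 0|exists 1 => a [/andP[]]].
have supge0 : 0 <= sup S by apply: (ub_le_sup (proj2 hS)).
have suple1 : sup S <= 1 by apply: ge_sup; [exists 0|move=> a [/andP[]]].
apply/ler_addgt0Pr => e e0; pose L := enorm (x - y) + 1.
have L0 : 0 < L by rewrite ltr_wpDl.
pose d := e / 2 / L; have d0 : 0 < d by rewrite !divr_gt0.
have [a [/andP[a0 a1] Ea] da] := sup_adherent d0 hS.
have [b [b1 Eb]] : exists b, [/\ 0 <= b <= 1, b < sup S + d & ~ E (p b)].
  have [c1|c1] := leP 1 (sup S + d / 2).
    by exists 1; rewrite p1 ler01 lexx; split => //; lra.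
  exists (sup S + d / 2); split => //; [lra|lra|].
  move=> Ec; have : sup S + d / 2 <= sup S.
    by apply: (ub_le_sup (proj2 hS)); split => //; apply/andP; split; lra.
  by lra.
move=> Epb.
have H1 : dist x (~` E) <= b * enorm (x - y).
  apply: (le_trans (dist_le x Epb)).
  by rewrite -{1}p0 pB sub0r normrN ger0_norm//; case/andP: b1.
have H2 : dist y E <= (1 - a) * enorm (x - y).
  apply: (le_trans (dist_le y Ea)).
  by rewrite -{1}p1 pB ger0_norm// subr_ge0.
apply: (le_trans (lerD H1 H2)).
have -> : b * enorm (x - y) + (1 - a) * enorm (x - y) =
  enorm (x - y) + (b - a) * enorm (x - y) by ring.
rewrite lerD2l.
have [ba|ba] := leP (b - a) 0.
  by rewrite (@le_trans _ _ 0) ?(ltW e0)// mulr_le0_ge0.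
have : (b - a) * enorm (x - y) <= (d + d) * L.
  by apply: ler_pM => //; [lra|lra|rewrite lerDl].
by rewrite /d -mulrDl -splitr divfK ?gt_eqF.
Qed.

(** Each of the two distances is 1-Lipschitz, and a segment across the boundary
    is cut there in two pieces. *)
Lemma sdist_lip E x y : E !=set0 -> (~` E) !=set0 ->
  sdist E x <= sdist E y + enorm (x - y).
Proof.
move=> E0 C0; have [Ex|Ex] := pselect (E x); have [Ey|Ey] := pselect (E y).
- rewrite !sdist_in//; have := dist_lip (~` E) y x; rewrite enormB; lra.
- by rewrite sdist_in// sdist_out//; have := dist_ge0 (~` E) x;
    have := dist_ge0 E y; have := enorm_ge0 (x - y); lra.
- rewrite sdist_out// sdist_in//; have := segment_crossing Ey Ex.
  by rewrite enormB; lra.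
- by rewrite !sdist_out//; exact: dist_lip.
Qed.

Lemma sdist_continuous E : E !=set0 -> (~` E) !=set0 -> continuous (sdist E).
Proof. by move=> E0 C0; apply: lipschitz1_continuous => x y; exact: sdist_lip. Qed.

Lemma bndP E x : bnd E x <-> closure E x /\ closure (~` E) x.
Proof.
by rewrite /bnd; split=> -[Ex /closure_setCP Ix].
Qed.

Lemma bnd_sdist0 E x : closed E -> E !=set0 -> (~` E) !=set0 ->
  bnd E x <-> sdist E x = 0.
Proof.
move=> cE E0 C0; split=> [/bndP[Ex /(dist_le_closure _ C0) Cx]|xE0].
  rewrite sdist_in; last exact: cE.
  by apply/eqP; rewrite oppr_eq0 eq_le Cx dist_ge0.
have Ex : E x by apply: sdist_closed => //; rewrite xE0.
apply/bndP; split; first exact: subset_closure.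
apply/(dist_le_closure _ C0).
by move/eqP: xE0; rewrite sdist_in// oppr_eq0 => /eqP ->.
Qed.

Lemma sdist_interior E x : (~` E) !=set0 ->
  interior E x <-> sdist E x < 0.
Proof.
move=> C0; split=> [xI|xE].
  have Ex := interior_subset xI.
  have : ~ closure (~` E) x by move/closure_setCP; apply.
  move=> /(contra_not (proj2 (dist_le_closure x C0))) /negP.
  by rewrite -ltNge sdist_in// oppr_lt0.
apply/interiorP; exists (- sdist E x); first by rewrite oppr_gt0.
move=> y; rewrite (sdist_in (sdist_lt0 xE)) opprK => xy.
by apply: contrapT => /(@dist_le (~` E) x); rewrite leNgt xy.
Qed.

(** An inclusion at depth r becomes an inequality between functions on the
    whole space, which can be differentiated at contact points.  At a point x
    of E, one moves from x towards a point w outside F: the segment remains in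
    E up to the distance of x to the complement of E, and from there it still
    has length at least r. *)
Lemma sdist_deep E F r x : E !=set0 -> (~` F) !=set0 -> 0 < r ->
  (forall z, E z -> sdist F z <= - r) -> sdist F x <= sdist E x - r.
Proof.
move=> E0 CF0 r0 EF.
have F0 : F !=set0.
  case: E0 => z Ez; exists z; apply: sdist_lt0.
  by apply: le_lt_trans (EF _ Ez) _; rewrite oppr_lt0.
have EFlip z w : E z -> sdist F w <= - r + enorm (w - z).
  move=> Ez; apply: le_trans (sdist_lip w z F0 CF0) _.
  by rewrite lerD2r; exact: EF.
have [Ex|Ex] := pselect (E x); last first.
  rewrite (sdist_out Ex); apply/ler_addgt0Pr => e e0.
  have [z Ez xz] : exists2 z, E z & enorm (x - z) < dist x E + e.
    by apply: dist_lt => //; rewrite ltrDl.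
  by have := EFlip z x Ez; lra.
rewrite (sdist_in Ex) sdist_in; last first.
  by apply: sdist_lt0; apply: le_lt_trans (EF _ Ex) _; rewrite oppr_lt0.
rewrite -opprD lerN2; apply: dist_lb => // w Fw.
have w0 := sdist_out_ge0 Fw.
have Lr : r <= enorm (x - w) by have := EFlip x w Ex; rewrite (enormB w x); lra.
rewrite leNgt; apply/negP => Lm.
pose L := enorm (x - w); pose m := dist x (~` E).
pose t := (L - r + m) / 2.
have L0 : 0 < L by exact: lt_le_trans Lr.
have Lw : L < m + r by [].
have rL : r <= L by [].
have m0 : 0 <= m by exact: dist_ge0.
have t0 : 0 <= t by rewrite /t; lra.
pose p := x + (t / L) *: (w - x).
have Ep : E p.
  apply: contrapT => /(@dist_le (~` E) x); apply/negP; rewrite -ltNge.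
  have -> : x - p = (t / L) *: (x - w).
    by rewrite /p opprD addrA subrr add0r -scalerN opprB.
  rewrite enormZ ger0_norm; last by rewrite divr_ge0// ltW.
  by rewrite -/L -/m divfK ?gt_eqF// /t; lra.
have := EFlip p w Ep.
have -> : w - p = (1 - t / L) *: (w - x).
  by rewrite /p scalerBl scale1r opprD addrA.
have mL : m <= L by apply: dist_le => Ew; have := EF _ Ew; lra.
have tL1 : 0 <= 1 - t / L by rewrite subr_ge0 ler_pdivrMr// mul1r /t; lra.
rewrite enormZ ger0_norm// (enormB w x) -/L mulrBl mul1r divfK ?gt_eqF// /t.
by lra.
Qed.

End Distance.
(** * Continuity of real functions on row vectors *)

Section Continuity.
Context {R : realType} {n : nat}.
Implicit Types (f g : 'rV[R]_n -> R) (a : R) (m : nat).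

Lemma rV_continuousD f g :
  continuous f -> continuous g -> continuous (fun z => f z + g z).
Proof. by move=> cf cg z; exact (@continuousD R _ _ f g z (cf z) (cg z)). Qed.

Lemma rV_continuousM f g :
  continuous f -> continuous g -> continuous (fun z => f z * g z).
Proof. by move=> cf cg z; exact (@continuousM R _ f g z (cf z) (cg z)). Qed.

Lemma rV_continuous_eps f x (e : R) : continuous f -> 0 < e ->
  exists2 d : R, 0 < d & forall y, enorm (x - y) < d -> `|f x - f y| < e.
Proof.
move=> cf e0; apply/nbhs_enormP; move: e e0.
by have /(@cvgrPdist_lt _ _ _ (nbhs x)) := cf x.
Qed.

Lemma rV_continuous_cst a : continuous (fun z : 'rV[R]_n => a).
Proof. by move=> z; exact (@cst_continuous 'rV[R]_n R a z). Qed.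

Lemma rV_continuousN f : continuous f -> continuous (fun z => - f z).
Proof. by move=> cf z; exact (@continuousN R _ _ f z (cf z)). Qed.

Lemma rV_continuousB f g :
  continuous f -> continuous g -> continuous (fun z => f z - g z).
Proof. by move=> cf /rV_continuousN; exact: rV_continuousD. Qed.

Lemma rV_continuousX f m : continuous f -> continuous (fun z => f z ^+ m).
Proof.
move=> cf; elim: m => [|m IH]; first exact: rV_continuous_cst.
have -> : (fun z => f z ^+ m.+1) = (fun z => f z * f z ^+ m).
  by apply/funext => z; rewrite exprS.
exact: rV_continuousM.
Qed.

Lemma rV_continuous_isometry (h : 'rV[R]_n -> 'rV[R]_n) f :
  (forall x y, enorm (h x - h y) = enorm (x - y)) ->
  continuous f -> continuous (fun z => f (h z)).
Proof.
move=> hE cf z A /(cf (h z)) /nbhs_enormP[e e0 eA]; apply/nbhs_enormP.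
by exists e => // y zy; apply: eA; rewrite hE.
Qed.

Lemma rV_continuous_shift f (y : 'rV[R]_n) :
  continuous f -> continuous (fun z : 'rV[R]_n => f (z + y)).
Proof.
by apply: rV_continuous_isometry => x z; rewrite opprD addrACA subrr addr0.
Qed.

Lemma rV_continuous_coord (i : 'I_n) : continuous (fun z : 'rV[R]_n => z ord0 i).
Proof. by move=> z; exact (@coord_continuous R 1 n ord0 i z). Qed.

Lemma rV_continuous_radial a p m :
  continuous (fun z : 'rV[R]_n => (a - enorm (z - p) ^+ 2) ^+ m).
Proof.
apply: rV_continuousX; apply: rV_continuousB; first exact: rV_continuous_cst.
by apply: rV_continuousX; apply: rV_continuous_shift; exact: enorm_continuous.
Qed.

Lemma nearest_point (A : set 'rV[R]_n) (x : 'rV[R]_n) : A !=set0 ->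
  exists2 y, closure A y & enorm (x - y) = dist x A.
Proof.
move=> A0; pose B := closure A `&` [set y | enorm y <= enorm x + dist x A + 1].
have cB : compact B.
  apply: (@compact_enorm _ _ _ (enorm x + dist x A + 1)); last by move=> y [].
  by apply: closedI; [exact: closed_closure|exact: closed_enorm_ball].
have AB y : A y -> enorm (x - y) < dist x A + 1 -> B y.
  move=> Ay xy; split; first exact: subset_closure.
  by rewrite /=; have := enorm_lip y x; rewrite (enormB y x); lra.
have [y0 Ay0 xy0] : exists2 y, A y & enorm (x - y) < dist x A + 1.
  by apply: dist_lt => //; rewrite ltrDl.
have B0 : B !=set0 by exists y0; exact: AB.
have cd : continuous (fun y : 'rV[R]_n => enorm (x - y)).
  apply: lipschitz1_continuous => y z.
  by have := enorm_triangle x z y; rewrite (enormB z y) addrC.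
have [y /set_mem [cy yx] ymin] := compact_EVT_min B0 cB (continuous_subspaceT cd).
exists y => //; apply/eqP; rewrite eq_le; apply/andP; split.
  apply: dist_lb => // z Az; have [xz|xz] := ltP (enorm (x - z)) (dist x A + 1).
    by apply: ymin; apply/mem_set; exact: AB.
  apply: le_trans xz; apply: le_trans (ltW xy0).
  by apply: ymin; apply/mem_set; exact: AB.
have /(dist_le_closure y A0) yA := cy.
by have := dist_lip A x y; lra.
Qed.

End Continuity.

(** * Second derivatives and the maximum principle *)

Section SecondDerivative.
Context {R : realType}.
Implicit Types (h k : R -> R) (l s e x d a : R).

Lemma near0P (P : R -> Prop) : (\forall s \near (0 : R), P s) <->
  exists2 r : R, 0 < r & forall s, `|s| < r -> P s.
Proof.
split=> [/(@nbhs_ballP R R)[r /= r0 rP]|[r r0 rP]].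
  by exists r => // s sr; apply: rP; rewrite -ball_normE /= sub0r normrN.
apply/(@nbhs_ballP R R); exists r => //= s; rewrite -ball_normE /= sub0r normrN.
exact: rP.
Qed.

Definition second_deriv h l := exists2 h1 : R -> R,
  (\forall s \near (0 : R), is_derive (s : R) 1 h (h1 s)) & is_derive (0 : R) 1 h1 l.

Lemma is_derive_eps h x d : is_derive x 1 h d -> forall e, 0 < e ->
  exists2 r : R, 0 < r & forall s, `|s| < r -> `|h (x + s) - h x - d * s| <= e * `|s|.
Proof.
move=> [hd <-] e e0; apply/near0P; move/cvg_ex : (hd) => [l /= hl].
have dl : 'D_1 h x = l by exact: cvg_lim hl.
move/(@cvgrPdist_le _ _ _ (0 : R)^') : hl => /(_ e e0).
rewrite near_withinE; apply: filterS => s sP.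
have [->|s0] := eqVneq s 0; first by rewrite addr0 subrr mulr0 subr0 normr0 mulr0.
have := sP s0; rewrite dl /= => H.
have -> : h (x + s) - h x - l * s = - ((l - s^-1 *: (h (s *: 1 + x) - h x)) * s).
  rewrite /GRing.scale /= mulr1 (addrC s x) mulrBl mulrAC mulVf// mul1r.
  by ring.
by rewrite normrN normrM ler_wpM2r.
Qed.

Lemma local_max_deriv h d : is_derive (0 : R) 1 h d ->
  (\forall s \near (0 : R), h s <= h 0) -> d = 0.
Proof.
move=> hd /near0P[r r0 hmax].
apply/eqP; apply/negPn/negP => d0.
have dgt : 0 < `|d| / 2 by rewrite divr_gt0// normr_gt0.
have [r' r'0 H] := is_derive_eps hd dgt.
pose t := Num.min r r' / 2.
have m0 : 0 < Num.min r r' by rewrite lt_min r0 r'0.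
have t0 : 0 < t by rewrite divr_gt0.
have tm : t < Num.min r r' by rewrite /t; lra.
have /andP[tr tr'] : (t < r) && (t < r') by rewrite -lt_min.
have nsg : `|Num.sg d * t| = t.
  by rewrite normrM normr_sg d0 mul1r gtr0_norm.
have dsg : d * (Num.sg d * t) = `|d| * t.
  by rewrite (normrEsg d); ring.
have := H (Num.sg d * t); rewrite nsg add0r => /(_ tr').
have := hmax (Num.sg d * t); rewrite nsg => /(_ tr).
rewrite dsg => h1; rewrite ler_norml => /andP[h2 _].
have : 0 < `|d| / 2 * t by rewrite mulr_gt0.
lra.
Qed.

(** If the second derivative at a critical point were positive, the first
    derivative would be positive just after it and the mean value theorem would
    give a larger value of h. *)
Lemma local_max_second_deriv h l : second_deriv h l ->
  (\forall s \near (0 : R), h s <= h 0) -> l <= 0.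
Proof.
move=> [h1 h1P h2P] hmax; rewrite leNgt; apply/negP => l0.
have h10 : h1 0 = 0.
  by apply: (local_max_deriv _ hmax); exact: nbhs_singleton h1P.
have [r r0 H] := is_derive_eps h2P (divr_gt0 l0 (ltr0Sn R 1)).
move: hmax h1P => /near0P[r1 r10 rmax] /near0P[r2 r20 rder].
pose m := Num.min r (Num.min r1 r2).
have m0 : 0 < m by rewrite !lt_min r0 r10.
pose t := m / 2; have t0 : 0 < t by rewrite divr_gt0.
have tm : t < m by rewrite /t; lra.
move: (tm); rewrite !lt_min => /and3P[tr tr1 tr2].
have in0 s a : 0 <= s -> s <= t -> t < a -> `|s| < a.
  by move=> s0 st ta; rewrite ger0_norm// (le_lt_trans st).
have hder s : s \in `[0, t] -> is_derive s 1 h (h1 s).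
  by rewrite in_itv /= => /andP[s0 st]; apply: rder; exact: in0 tr2.
have hc : {within `[0, t], continuous h}.
  apply: derivable_within_continuous => s st.
  by case: (hder s st).
have [c ct hE] := MVT t0 (fun s st => hder s (subset_itv_oo_cc st)) hc.
move: ct; rewrite in_itv /= => /andP[c0 ct].
have := H c (in0 _ _ (ltW c0) (ltW ct) tr).
rewrite add0r h10 subr0 ler_norml (gtr0_norm c0) => /andP[h1c _].
have h1c0 : 0 < h1 c by have := mulr_gt0 l0 c0; lra.
have : h t <= h 0.
  by apply: rmax; exact: in0 (ltW t0) (lexx _) tr1.
have := mulr_gt0 h1c0 t0; rewrite subr0 in hE; lra.
Qed.

Lemma second_derivD h k l l' : second_deriv h l -> second_deriv k l' ->
  second_deriv (fun s => h s + k s) (l + l').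
Proof.
move=> [h1 h1P h2P] [k1 k1P k2P]; exists (fun s => h1 s + k1 s).
  by apply: filterS2 h1P k1P => s hs ks; exact: is_deriveD.
exact: is_deriveD.
Qed.

Lemma second_derivZ h l a : second_deriv h l ->
  second_deriv (fun s => a * h s) (a * l).
Proof.
move=> [h1 h1P h2P]; exists (fun s => a * h1 s).
  by apply: filterS h1P => s hs; exact: is_deriveZ.
exact: is_deriveZ.
Qed.

Lemma second_derivN h l : second_deriv h l -> second_deriv (fun s => h (- s)) l.
Proof.
have derN k x d : is_derive (- x : R) 1 k d -> is_derive (x : R) 1 (fun s => k (- s)) (- d).
  move=> kd; have -> : - d = d * (-1) by rewrite mulrN1.
  by apply: (@is_derive1_comp _ k -%R).
move=> [h1 h1P h2P]; exists (fun s => - h1 (- s)).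
  have : \forall s \near (0 : R), is_derive (- s : R) 1 h (h1 (- s)).
    have /(_ _ h1P) : (fun s : R => - s) @ (0 : R) --> (0 : R).
      by rewrite -[X in _ --> X]oppr0; apply: cvgN; exact: cvg_id.
    exact.
  by apply: filterS => s; exact: derN.
rewrite -[l]opprK; apply: is_deriveN; apply: derN.
by rewrite oppr0.
Qed.

Lemma second_deriv_ext h k l : (\forall s \near (0 : R), h s = k s) ->
  second_deriv h l -> second_deriv k l.
Proof.
move=> /nbhs_interior hk [h1 h1P h2P]; exists h1 => //.
apply: filterS2 hk h1P => s hk hs.
exact: (near_eq_is_derive hk hs).
Qed.

Lemma is_derive_affine (a b : R) s : is_derive (s : R) 1 (fun s => a + b * s) b.
Proof.
have := is_deriveD (is_derive_cst a (s : R) 1) (is_deriveZ b (is_derive_id (s : R) 1)).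
by rewrite add0r /GRing.scale /= mulr1.
Qed.

Lemma is_derive_quad (a b c : R) s :
  is_derive (s : R) 1 (fun s => a + b * s + c * s ^+ 2) (b + 2 * c * s).
Proof.
have := is_deriveD (is_derive_affine a b s)
  (is_deriveZ c (is_deriveX 2 (is_derive_id (s : R) 1))).
by rewrite /GRing.scale /= mulr1 expr1 mulrA (mulrC c).
Qed.

Lemma second_deriv_quadX (a b c : R) m :
  second_deriv (fun s => (a + b * s + c * s ^+ 2) ^+ m)
    (m%:R * a ^+ m.-1 * (2 * c) + m%:R * (m.-1)%:R * a ^+ m.-2 * b ^+ 2).
Proof.
pose p s := a + b * s + c * s ^+ 2.
have pD s : is_derive (s : R) 1 p (b + 2 * c * s) by exact: is_derive_quad.
have pX s (j : nat) : is_derive (s : R) 1 (fun s => p s ^+ j)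
    (j%:R * p s ^+ j.-1 * (b + 2 * c * s)).
  by have := is_deriveX j (pD s); rewrite exprfctE.
exists (fun s => m%:R * p s ^+ m.-1 * (b + 2 * c * s)).
  by apply/near0P; exists 1 => // s _; exact: pX.
have H := is_deriveM (is_deriveZ m%:R (pX 0 m.-1)) (is_derive_affine b (2 * c) 0).
have p0 : p 0 = a by rewrite /p mulr0 expr0n /= mulr0 !addr0.
apply: (is_derive_eq H); rewrite p0 mulr0 addr0.
have -> : (m%:R \*: (fun s => p s ^+ m.-1)) 0 = m%:R * a ^+ m.-1 by rewrite -p0.
by rewrite /GRing.scale /=; ring.
Qed.

End SecondDerivative.

Section Lines.
Context {R : realType} {V : normedModType R}.
Implicit Types (f : V -> R^o) (x v : V).

Lemma line_is_derive f x v (s : R) : derivable f (x + s *: v) v ->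
  is_derive (s : R) 1 (fun u : R => f (x + u *: v)) ('D_v f (x + s *: v)).
Proof.
have E : (fun h : R => h^-1 *: (((fun u : R => f (x + u *: v)) \o shift s) (h *: 1)
    - f (x + s *: v))) =
  (fun h => h^-1 *: ((f \o shift (x + s *: v)) (h *: v) - f (x + s *: v))).
  apply/funext => h /=; do 3 f_equal.
  by rewrite (_ : h *: 1 = h) ?scalerDl ?(addrCA x)//; exact: mulr1.
by move=> fd; split; rewrite /derivable /derive E.
Qed.

Lemma line_derive f x v (s : R) d :
  is_derive (s : R) 1 (fun u : R => f (x + u *: v)) d ->
  derivable f (x + s *: v) v /\ 'D_v f (x + s *: v) = d.
Proof.
have E : (fun h : R => h^-1 *: (((fun u : R => f (x + u *: v)) \o shift s) (h *: 1)
    - f (x + s *: v))) =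
  (fun h => h^-1 *: ((f \o shift (x + s *: v)) (h *: v) - f (x + s *: v))).
  apply/funext => h /=; do 3 f_equal.
  by rewrite (_ : h *: 1 = h) ?scalerDl ?(addrCA x)//; exact: mulr1.
by case; rewrite /derivable /derive E.
Qed.

Lemma near_line_open (U : set V) x v : open U -> U x ->
  \forall s \near (0 : R), U (x + s *: v).
Proof.
move=> oU Ux; have xs : (fun s : R => x + s *: v) @ (0 : R) --> x.
  have x0 : x + (0 : R) *: v = x by rewrite scale0r addr0.
  rewrite -[X in _ --> X]x0; apply: cvgD; first exact: cvg_cst.
  by apply: cvgZ; [exact: cvg_id|exact: cvg_cst].
exact: (xs _ (open_nbhs_nbhs (conj oU Ux))).
Qed.

Lemma second_deriv_line (U : set V) f x v : open U -> Ck 2 U f -> U x ->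
  second_deriv (fun s : R => f (x + s *: v)) ('D_v ('D_v f) x).
Proof.
move=> oU [_ fU] Ux; have [df [_ ddf]] := fU v.
have [/(_ _ Ux) ddfx _] := ddf v.
have x0 : x + (0 : R) *: v = x by rewrite scale0r addr0.
exists (fun s => 'D_v f (x + s *: v)); last first.
  by have := @line_is_derive ('D_v f) x v 0; rewrite x0 => /(_ ddfx).
by apply: filterS (near_line_open v oU Ux) => s Us; apply: line_is_derive; exact: df.
Qed.

End Lines.

Section Laplacian.
Context {R : realType} {n : nat}.
Implicit Types (w f : 'rV[R]_n -> R) (x y z p v : 'rV[R]_n) (L a r : R).

Local Notation e_ i := (delta_mx ord0 i : 'rV[R]_n).

(** The Laplacian is read off the n one-variable functions s |-> w (x + s e_i).
    Sums, shifts and reflections then act on one-variable functions, and the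
    maximum principle involves no mixed derivatives. *)
Definition lap_at w x L := exists2 l : 'I_n -> R,
  (forall i, second_deriv (fun s => w (x + s *: e_ i)) (l i)) & L = \sum_i l i.

Lemma near_line (A : set 'rV[R]_n) x v : nbhs x A ->
  \forall s \near (0 : R), A (x + s *: v).
Proof.
move=> /nbhs_enormP[r r0 rA]; apply/near0P.
have v1 : 0 < enorm v + 1 by rewrite ltr_wpDl.
exists (r / (enorm v + 1)); first by rewrite divr_gt0.
move=> s sr; apply: rA; rewrite opprD addrA subrr add0r enormN enormZ.
rewrite ltr_pdivlMr// in sr; apply: le_lt_trans sr.
by rewrite ler_wpM2l// lerDl.
Qed.

Lemma lap_at_laplacian w x L : lap_at w x L -> laplacian w x = L.
Proof.
move=> [l wl ->]; apply: eq_bigr => i _; have [h1 h1P h2P] := wl i.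
rewrite /partial -[x in LHS](addr0 x) -(scale0r (e_ i)).
apply: (proj2 (line_derive _)).
apply: near_eq_is_derive h2P.
by apply: filterS h1P => s /line_derive[_ ->].
Qed.

Lemma Ck2_lap_at (U : set 'rV[R]_n) w x : open U -> Ck 2 U w -> U x ->
  lap_at w x (laplacian w x).
Proof.
move=> oU wU Ux; exists (fun i => partial i (partial i w) x) => // i.
exact: second_deriv_line wU Ux.
Qed.

Lemma lap_atD w f x L L' : lap_at w x L -> lap_at f x L' ->
  lap_at (fun z => w z + f z) x (L + L').
Proof.
move=> [l wl ->] [k fk ->]; exists (fun i => l i + k i); last by rewrite big_split.
by move=> i; exact: second_derivD.
Qed.

Lemma lap_atZ w x L a : lap_at w x L -> lap_at (fun z => a * w z) x (a * L).
Proof.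
move=> [l wl ->]; exists (fun i => a * l i); last by rewrite mulr_sumr.
by move=> i; exact: second_derivZ.
Qed.

Lemma lap_atN w x L : lap_at w x L -> lap_at (fun z => - w z) x (- L).
Proof.
move=> /(lap_atZ (-1)); rewrite mulN1r.
by have -> : (fun z => -1 * w z) = (fun z => - w z) by apply/funext => z; rewrite mulN1r.
Qed.

Lemma lap_atB w f x L L' : lap_at w x L -> lap_at f x L' ->
  lap_at (fun z => w z - f z) x (L - L').
Proof. by move=> wL /lap_atN; exact: lap_atD. Qed.

Lemma lap_at_ext w f x L : (\forall z \near x, w z = f z) ->
  lap_at w x L -> lap_at f x L.
Proof.
move=> wf [l wl ->]; exists l => // i; apply: second_deriv_ext (wl i).
exact: near_line wf.
Qed.

Lemma lap_at_shift w x y L : lap_at w (x + y) L -> lap_at (fun z => w (z + y)) x L.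
Proof.
move=> [l wl ->]; exists l => // i.
have -> : (fun s : R => w (x + s *: e_ i + y)) = (fun s => w (x + y + s *: e_ i)).
  by apply/funext => s; rewrite addrAC.
exact: wl.
Qed.

Lemma grad_shift w x y : grad (fun z => w (z + y)) x = grad w (x + y).
Proof.
apply/rowP => i; rewrite !mxE /partial /derive.
rewrite (_ : (fun h => _) = fun h : R =>
  h^-1 *: ((w \o shift (x + y)) (h *: delta_mx ord0 i) - w (x + y)))//.
by apply/funext => h /=; rewrite addrA.
Qed.

(** Reflection in the hyperplane on which the i-th coordinate vanishes. *)
Definition reflect_coord (i : 'I_n) x : 'rV[R]_n := x - (2 * x ord0 i) *: e_ i.

Lemma lap_at_reflect w i x L : lap_at w (reflect_coord i x) L ->
  lap_at (fun z => w (reflect_coord i z)) x L.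
Proof.
move=> [l wl ->]; exists l => // j.
have [->|ji] := eqVneq j i.
  have -> : (fun s : R => w (reflect_coord i (x + s *: e_ i))) =
            (fun s => w (reflect_coord i x + (- s) *: e_ i)).
    apply/funext => s; congr w; rewrite /reflect_coord !mxE !eqxx mulr1 /=.
    by rewrite mulrDr scalerDl; apply/rowP => k; rewrite !mxE; ring.
  exact: second_derivN (wl i).
have -> : (fun s : R => w (reflect_coord i (x + s *: e_ j))) =
          (fun s => w (reflect_coord i x + s *: e_ j)).
  apply/funext => s; congr w; rewrite /reflect_coord !mxE eqxx /= eq_sym (negPf ji).
  by rewrite mulr0 addr0; apply/rowP => k; rewrite !mxE; ring.
exact: wl.
Qed.

Lemma dotp_delta x i : dotp x (e_ i) = x ord0 i.
Proof.
rewrite /dotp (bigD1 i)//= mxE !eqxx mulr1 big1 ?addr0// => j ji.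
by rewrite mxE eqxx (negPf ji) mulr0.
Qed.

Lemma lap_at_radial a p m x :
  lap_at (fun z => (a - enorm (z - p) ^+ 2) ^+ m) x
    (4 * m%:R * (m.-1)%:R * (a - enorm (x - p) ^+ 2) ^+ m.-2 * enorm (x - p) ^+ 2
     - 2 * n%:R * m%:R * (a - enorm (x - p) ^+ 2) ^+ m.-1).
Proof.
pose b := a - enorm (x - p) ^+ 2.
exists (fun i => m%:R * b ^+ m.-1 * (2 * (- 1))
   + m%:R * (m.-1)%:R * b ^+ m.-2 * (- 2 * (x - p) ord0 i) ^+ 2).
  move=> i; have := second_deriv_quadX b (- 2 * (x - p) ord0 i) (-1) m.
  apply: second_deriv_ext; apply: filterE => s; congr (_ ^+ _).
  rewrite /b !sqr_enorm -[x + _ - p]addrAC.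
  rewrite !(dotpDl (x - p)) !(dotpDr (x - p)) !(dotpZl, dotpZr).
  have De : e_ i ord0 i = 1 by rewrite mxE !eqxx.
  by rewrite (dotpC (e_ i) (x - p)) !dotp_delta De; ring.
rewrite big_split /= sumr_const card_ord.
under eq_bigr do rewrite exprMn.
rewrite -!mulr_sumr (_ : \sum_(i < n) _ = enorm (x - p) ^+ 2); last first.
  by rewrite sqr_enorm; apply: eq_bigr => i _; rewrite expr2.
by rewrite -mulr_natl /b; ring.
Qed.

Lemma lap_at_local_max w x L : lap_at w x L -> (\forall z \near x, w z <= w x) ->
  L <= 0.
Proof.
move=> [l wl ->] wmax; apply: sumr_le0 => i _.
apply: local_max_second_deriv (wl i) _.
by rewrite scale0r addr0; exact: near_line wmax.
Qed.

Lemma lap_at_partial w x L i : lap_at w x L ->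
  is_derive (0 : R) 1 (fun s : R => w (x + s *: e_ i)) (partial i w x).
Proof.
move=> [l wl _]; have [h1 /nbhs_singleton h1P _] := wl i.
have [_] := line_derive h1P; rewrite scale0r addr0 => D.
by rewrite /partial D.
Qed.

(** At a contact point f - w has a local maximum; this lemma and the next one
    extract from it the curvature and the normal at contact points of moving
    boundaries. *)
Lemma touching_laplacian w f x L L' : lap_at w x L -> lap_at f x L' ->
  (\forall z \near x, f z - f x <= w z - w x) -> L' <= L.
Proof.
move=> wL fL fw; rewrite -subr_le0; apply: (lap_at_local_max (lap_atB fL wL)).
by apply: filterS fw => z; lra.
Qed.

Lemma touching_grad w f x L L' : lap_at w x L -> lap_at f x L' ->
  (\forall z \near x, f z - f x <= w z - w x) -> grad f x = grad w x.
Proof.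
move=> wL fL fw; apply/rowP => i; rewrite !mxE; apply/eqP; rewrite -subr_eq0.
apply/eqP; apply: (local_max_deriv
  (is_deriveB (lap_at_partial i fL) (lap_at_partial i wL))).
apply: filterS (near_line (e_ i) fw) => s /=.
by rewrite !fctE scale0r addr0; lra.
Qed.

(** Weak maximum principle: adding a small multiple of the square of the norm
    makes w strictly subharmonic, so that its maximum over the closure of U is
    not attained inside. *)
Lemma max_principle (U : set 'rV[R]_n) w : (0 < n)%N -> open U -> bounded_set U ->
  continuous w -> (forall x, U x -> exists2 L, 0 <= L & lap_at w x L) ->
  (forall x, closure U x -> ~ U x -> w x <= 0) -> forall x, U x -> w x <= 0.
Proof.
move=> n0 oU bU cw wU wb x Ux; rewrite leNgt; apply/negP => wx.
have [r r0 Ur] := bounded_enormP bU.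
have cUr : closure U `<=` [set y | enorm y <= r].
  by move=> y cy; apply: (@closed_enorm_ball R n r); exact: closureS cy.
(* small enough for the term e |y|^2 not to compensate the positive value w x *)
pose e := w x / (2 * r ^+ 2).
have r2 : 0 < 2 * r ^+ 2 by rewrite mulr_gt0// exprn_gt0.
have e0 : 0 < e by rewrite divr_gt0.
pose f z := w z + e * enorm z ^+ 2.
have cf : continuous f.
  apply: rV_continuousD => //; apply: rV_continuousM; first exact: rV_continuous_cst.
  by apply: rV_continuousX; exact: enorm_continuous.
have [y /set_mem cy ymax] : exists2 y,
    y \in closure U & forall z, z \in closure U -> f z <= f y.
  apply: compact_EVT_max; first by exists x; exact: subset_closure.
    apply: (@compact_enorm _ _ _ r) => //; exact: closed_closure.
  exact: continuous_subspaceT.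
have fxy : f x <= f y by apply: ymax; apply/mem_set; exact: subset_closure.
have [Uy|Uy] := pselect (U y); last first.
  have wy := wb _ cy Uy.
  have : f y <= w x / 2.
    have yr : enorm y ^+ 2 <= r ^+ 2.
      by rewrite ler_pXn2r ?nnegrE ?(ltW r0)//; exact: cUr.
    have : e * enorm y ^+ 2 <= e * r ^+ 2 by rewrite ler_pM2l.
    have -> : e * r ^+ 2 = w x / 2.
      by rewrite /e; field; rewrite gt_eqF.
    by rewrite /f; lra.
  have : 0 <= e * enorm x ^+ 2 by rewrite mulr_ge0 ?sqr_ge0// ltW.
  by move: fxy; rewrite {1}/f; lra.
have [L L0 wL] := wU y Uy.
have fL : lap_at f y (L + e * (2 * n%:R)).
  apply: lap_atD => //; apply: lap_atZ.
  have := lap_atN (lap_at_radial 0 0 1 y).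
  rewrite /= !mulr0 !mul0r sub0r opprK expr0 !mulr1.
  by apply: lap_at_ext; apply: filterE => z; rewrite subr0 sub0r expr1 opprK.
have : L + e * (2 * n%:R) <= 0.
  apply: (lap_at_local_max fL).
  have := open_nbhs_nbhs (conj oU Uy); apply: filterS => z Uz.
  by apply: ymax; apply/mem_set; exact: subset_closure.
have : 0 < e * (2 * n%:R) by rewrite mulr_gt0// mulr_gt0// ltr0n.
lra.
Qed.

End Laplacian.

(** * Interior estimates for harmonic functions *)

Section HarmonicEstimates.
Context {R : realType} {n : nat}.
Hypothesis n_gt0 : (0 < n)%N.
Implicit Types (u v w : 'rV[R]_n -> R) (x y z p h : 'rV[R]_n).
Implicit Types (M d r s t c : R) (i j : 'I_n).

Local Notation e_ i := (delta_mx ord0 i : 'rV[R]_n).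

Lemma coordD_delta x s i j : (x + s *: e_ i) ord0 j = x ord0 j + s * (j == i)%:R.
Proof. by rewrite !mxE eqxx. Qed.

Lemma lap_at_coord_quad d i x :
  lap_at (fun z => z ord0 i * (d - z ord0 i)) x (- 2).
Proof.
exists (fun j => if j == i then - 2 else 0); last first.
  by rewrite -big_mkcond /= big_pred1_eq.
move=> j; case: eqVneq => [->|ji].
  have := second_deriv_quadX (x ord0 i * (d - x ord0 i)) (d - 2 * x ord0 i) (-1) 1.
  set l := (X in second_deriv _ X); have -> : l = - 2 by rewrite /l /=; ring.
  apply: second_deriv_ext; apply: filterE => s.
  by rewrite coordD_delta eqxx mulr1 expr1; ring.
have := second_deriv_quadX (x ord0 i * (d - x ord0 i)) 0 0 1.
set l := (X in second_deriv _ X); have -> : l = 0 by rewrite /l /=; ring.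
apply: second_deriv_ext; apply: filterE => s.
by rewrite coordD_delta eq_sym (negPf ji) mulr0 expr1; ring.
Qed.

Lemma enorm_delta i : enorm (e_ i) = 1.
Proof.
apply/eqP; rewrite -(@eqrXn2 _ 2)// sqr_enorm dotp_delta mxE !eqxx.
by rewrite expr1n.
Qed.

Lemma reflect_coordE i x j :
  reflect_coord i x ord0 j = if j == i then - x ord0 i else x ord0 j.
Proof.
rewrite /reflect_coord !mxE eqxx /=; case: eqP => [->|_]; first by rewrite mulr1; ring.
by rewrite mulr0 subr0.
Qed.

Lemma reflect_coord_line i s :
  reflect_coord i (s *: e_ i) = (- s) *: e_ i.
Proof.
apply/rowP => j; rewrite reflect_coordE !mxE !eqxx /=.
by case: (eqVneq j i) => [_|_]; rewrite /= ?mulr1 ?mulr0.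
Qed.

Lemma reflect_coord_norm i x : `|reflect_coord i x| <= `|x|.
Proof.
apply: norm_le_coord => // j; rewrite reflect_coordE.
by case: eqP => _; rewrite ?normrN; exact: coord_le_norm.
Qed.

Lemma reflect_coord_isometry i x y :
  enorm (reflect_coord i x - reflect_coord i y) = enorm (x - y).
Proof.
rewrite /enorm; congr Num.sqrt; apply: eq_bigr => j _.
have B p q : (p - q) ord0 j = p ord0 j - q ord0 j by rewrite !mxE.
move: (reflect_coordE i x j) (reflect_coordE i y j).
move: (reflect_coord i x) (reflect_coord i y) => x' y' Ex Ey.
by rewrite (B x' y') (B x y) Ex Ey; case: eqP => [->|//]; ring.
Qed.

(** Interior gradient bound without derivatives (Brandt).  On the half cube
    x_i > 0 the harmonic function u(x) - u(reflection of x) vanishes on the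
    face x_i = 0, so it lies below the harmonic quadratic polynomial
    (M/d^2) (|x|^2 + n x_i (d - x_i)), which is at least M on the other faces. *)
Lemma reflect_diff_le u i M d t :
  continuous u -> 0 < d -> 0 <= M ->
  (forall x, 0 <= u x <= M) -> (forall x, `|x| < d -> lap_at u x 0) ->
  0 <= t < d -> u (t *: e_ i) - u ((- t) *: e_ i) <= n%:R * M / d * t.
Proof.
move=> cu d0 M0 uM uh /andP[t0 td].
have [->|tn0] := eqVneq t 0; first by rewrite oppr0 subrr mulr0.
have {t0}t0 : 0 < t by rewrite lt_def tn0.
pose b x := M / d ^+ 2 * (enorm x ^+ 2 + n%:R * (x ord0 i * (d - x ord0 i))).
pose w x := u x - u (reflect_coord i x) - b x.
pose U := [set x : 'rV[R]_n | `|x| < d /\ 0 < x ord0 i].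
have Md0 : 0 <= M / d ^+ 2 by rewrite divr_ge0// exprn_ge0// ltW.
have n1 : 1 <= n%:R :> R by rewrite ler1n.
have wU : forall x, U x -> w x <= 0.
  apply: max_principle => //.
  - rewrite openE => x [xd xi]; apply/interiorP.
    exists (Num.min (d - `|x|) (x ord0 i)); first by rewrite lt_min subr_gt0 xd xi.
    move=> y; rewrite lt_min => /andP[xy1 xy2]; split.
      have := norm_le_enorm (x - y); have := ler_normB x (x - y).
      by rewrite subKr; lra.
    have := coord_le_enorm (x - y) i; rewrite !mxE => H.
    by have := ler_norm (x ord0 i - y ord0 i); lra.
  - apply: (@bounded_enorm _ _ _ (n%:R * d)) => x [xd _].
    by rewrite (le_trans (enorm_le_norm x))// ler_wpM2l// ltW.
  - apply: rV_continuousB; first apply: rV_continuousB => //.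
      by apply: rV_continuous_isometry => //; exact: reflect_coord_isometry.
    apply: rV_continuousM; first exact: rV_continuous_cst.
    apply: rV_continuousD; first by apply: rV_continuousX; exact: enorm_continuous.
    apply: rV_continuousM; first exact: rV_continuous_cst.
    apply: rV_continuousM; first exact: rV_continuous_coord.
    apply: rV_continuousB; [exact: rV_continuous_cst|exact: rV_continuous_coord].
  - move=> x [xd xi]; exists (0 - 0 - M / d ^+ 2 * (2 * n%:R + n%:R * (- 2))).
      by rewrite le_eqVlt; apply/orP; left; apply/eqP; ring.
    apply: lap_atB.
      apply: lap_atB; first exact: uh.
      by apply: lap_at_reflect; apply: uh; exact: le_lt_trans (reflect_coord_norm i x) xd.
    apply: lap_atZ; apply: lap_atD; last by apply: lap_atZ; exact: lap_at_coord_quad.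
    have := lap_atN (lap_at_radial 0 0 1 x).
    rewrite /= !mulr0 !mul0r sub0r opprK expr0 !mulr1.
    by apply: lap_at_ext; apply: filterE => z; rewrite subr0 sub0r expr1 opprK.
  - move=> x /closureP cx nUx.
    have xd : `|x| <= d.
      apply/ler_addgt0Pr => e e0; have [y [yd _] xy] := cx e e0.
      have := norm_le_enorm (x - y); have := ler_normD (x - y) y.
      by rewrite subrK; lra.
    have xi : 0 <= x ord0 i.
      apply/ler_addgt0Pr => e e0; have [y [_ yi] xy] := cx e e0.
      have := coord_le_enorm (x - y) i; rewrite !mxE ler_norml => /andP[H _].
      by rewrite (le_trans (ltW yi))//; lra.
    have xid : x ord0 i <= d.
      by apply: le_trans xd; apply: le_trans (coord_le_norm x i); exact: ler_norm.
    have b2 : 0 <= n%:R * (x ord0 i * (d - x ord0 i)).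
      by rewrite !mulr_ge0// subr_ge0.
    have [xi0|xi0] := leP (x ord0 i) 0.
      have x0 : x ord0 i = 0 by apply/eqP; rewrite eq_le xi0.
      have -> : w x = - b x.
        rewrite /w; have -> : reflect_coord i x = x; last by rewrite subrr sub0r.
        by rewrite /reflect_coord x0 mulr0 scale0r subr0.
      by rewrite oppr_le0 mulr_ge0// addr_ge0// sqr_ge0.
    have dx : d <= enorm x.
      apply: le_trans (norm_le_enorm x); rewrite leNgt; apply/negP => xd'.
      exact: nUx.
    have : M <= b x.
      have -> : M = M / d ^+ 2 * d ^+ 2 by rewrite divfK// gt_eqF// exprn_gt0.
      rewrite /b ler_wpM2l// -[leLHS]addr0 lerD// ler_pXn2r ?nnegrE//.
      exact: ltW.
    by rewrite /w; have := uM x; have := uM (reflect_coord i x); lra.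
have Ut : U (t *: e_ i).
  split; last by rewrite !mxE !eqxx mulr1.
  by rewrite (le_lt_trans (norm_le_enorm _))// enormZ enorm_delta mulr1 gtr0_norm.
have := wU _ Ut; rewrite /w reflect_coord_line// subr_le0 => /le_trans; apply.
rewrite /b enormZ enorm_delta mulr1 gtr0_norm// !mxE !eqxx mulr1.
have -> : n%:R * M / d * t = M / d ^+ 2 * (n%:R * t * d).
  by field; rewrite gt_eqF.
rewrite ler_wpM2l//.
have : t ^+ 2 * 1 <= t ^+ 2 * n%:R by rewrite ler_wpM2l// sqr_ge0.
lra.
Qed.

(** The previous bound on the cube centred at the midpoint of a step along a
    coordinate axis; for a negative step one reflects u first. *)
Lemma step_diff_le u i M d z t :
  continuous u -> 0 < d -> 0 <= M ->
  (forall x, 0 <= u x <= M) ->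
  (forall x, `|x - (z + t *: e_ i)| < d -> lap_at u x 0) ->
  `|t| < d -> u (z + (2 * t) *: e_ i) - u z <= n%:R * M / d * `|t|.
Proof.
move=> cu d0 M0 uM uh td; pose c := z + t *: e_ i.
have shiftE a : (fun x => u (x + c)) (a *: e_ i) = u (z + (t + a) *: e_ i).
  by rewrite /c /=; congr u; rewrite addrCA -scalerDl (addrC a).
have uc : continuous (fun x : 'rV[R]_n => u (x + c)) by exact: rV_continuous_shift.
have uch x : `|x| < d -> lap_at (fun x => u (x + c)) x 0.
  by move=> xd; apply: lap_at_shift; apply: uh; rewrite -/c addrK.
have tt : t + t = 2 * t by ring.
have [t0|t0] := leP 0 t.
  have := @reflect_diff_le _ i M d t uc d0 M0 (fun x => uM (x + c)) uch.
  rewrite !shiftE subrr scale0r addr0 tt t0 (ger0_norm t0); apply.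
  by move: td; rewrite ger0_norm.
have vc : continuous (fun x : 'rV[R]_n => u (reflect_coord i x + c)).
  exact: (rV_continuous_isometry (@reflect_coord_isometry i) uc).
have vh x : `|x| < d -> lap_at (fun x => u (reflect_coord i x + c)) x 0.
  move=> xd; apply: (@lap_at_reflect _ _ (fun x => u (x + c))); apply: uch.
  exact: le_lt_trans (reflect_coord_norm i x) xd.
have := @reflect_diff_le _ i M d (- t) vc d0 M0 (fun x => uM (reflect_coord i x + c)) vh.
rewrite /= !reflect_coord_line// !opprK (shiftE t) (shiftE (- t)) subrr scale0r addr0.
rewrite tt (ltr0_norm t0); apply.
by move: td; rewrite ltr0_norm// => ->; rewrite oppr_ge0 ltW.
Qed.

(** One walks from z to z + h along the coordinate axes, one coordinate at a
    time. *)
Lemma harmonic_diff_le u M d z h :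
  continuous u -> 0 < d -> 0 <= M ->
  (forall x, 0 <= u x <= M) -> (forall x, `|x - z| < 2 * d -> lap_at u x 0) ->
  `|h| < d -> u (z + h) - u z <= n%:R ^+ 2 * M / d * `|h|.
Proof.
move=> cu d0 M0 uM uh hd.
pose q k : 'rV[R]_n := \row_j (if (j < k)%N then h ord0 j else 0).
have C0 : 0 <= n%:R * M / d by rewrite divr_ge0// ?mulr_ge0// ltW.
have step k : (k <= n)%N -> u (z + q k) - u z <= k%:R * (n%:R * M / d * `|h|).
  elim: k => [_|k IH kn].
    by rewrite (_ : q 0 = 0) ?addr0 ?subrr ?mul0r//; apply/rowP => j; rewrite !mxE.
  pose i := Ordinal kn; pose t := h ord0 i / 2.
  have tE : 2 * t = h ord0 i by rewrite /t mulrC divfK.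
  have hi := coord_le_norm h i.
  have th : `|t| <= `|h|.
    rewrite /t normrM (ger0_norm (_ : 0 <= 2^-1))//.
    by have := normr_ge0 (h ord0 i); lra.
  have qE : q k.+1 = q k + (2 * t) *: e_ i.
    apply/rowP => j; rewrite !mxE eqxx /= tE ltnS leq_eqVlt.
    have -> : (j == i) = (val j == k) by [].
    case: (eqVneq (val j) k) => jk /=.
      by rewrite jk ltnn add0r mulr1; congr (h ord0 _); exact: val_inj.
    by rewrite mulr0 addr0.
  have : u (z + q k + (2 * t) *: e_ i) - u (z + q k) <= n%:R * M / d * `|t|.
    apply: step_diff_le => //; last exact: le_lt_trans th hd.
    move=> x xd; apply: uh.
    have -> : x - z = (x - (z + q k + t *: e_ i)) + (q k + t *: e_ i).
      by rewrite -(addrA z) opprD (addrA x) subrK.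
    apply: le_lt_trans (ler_normD _ _) _.
    suff : `|q k + t *: e_ i| <= `|h| by lra.
    apply: norm_le_coord => // j; rewrite !mxE eqxx /=.
    case: (eqVneq j i) => [->|ji]; first by rewrite /= ltnn add0r mulr1.
    by rewrite mulr0 addr0; case: ifP => _; rewrite ?normr0//; exact: coord_le_norm.
  have -> : z + q k.+1 = z + q k + (2 * t) *: e_ i by rewrite qE addrA.
  have : n%:R * M / d * `|t| <= n%:R * M / d * `|h| by rewrite ler_wpM2l.
  have := IH (ltnW kn).
  have -> : (k.+1)%:R = k%:R + 1 :> R by rewrite natr1.
  rewrite (mulrDl k%:R) mul1r.
  by lra.
have := step n (leqnn n).
rewrite (_ : q n = h); last by apply/rowP => j; rewrite !mxE ltn_ord.
by move=> /le_trans; apply; rewrite le_eqVlt; apply/orP; left; apply/eqP; ring.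
Qed.

(** The barrier A (r^2 - |x - p|^2)^m vanishes on the sphere of radius r and is
    at most c0 inside; it is subharmonic at distance at least rho from p as
    soon as m is large, hence it lies below u where u is harmonic.  The bound c
    depends on the radii and on c0 only, which makes it uniform in time when u
    runs over the potentials of a flow. *)
Lemma harmonic_lower_bound (rho r c0 : R) : 0 < rho -> 0 < r -> 0 < c0 ->
  exists2 c, 0 < c & forall u (K : set 'rV[R]_n) p, continuous u -> closed K ->
    (forall x, 0 <= u x) -> (forall x, K x -> c0 <= u x) ->
    (forall x, enorm (x - p) <= rho -> K x) ->
    (forall x, enorm (x - p) < r -> ~ K x -> lap_at u x 0) ->
    forall x, enorm (x - p) <= r / 2 -> c <= u x.
Proof.
move=> rho0 r0 c00.
(* the subharmonicity of the barrier amounts to n r^2 <= 2 (m - 1) rho^2 *)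
pose k := Num.truncn (n%:R * r ^+ 2 / (2 * rho ^+ 2)).
have rho2 : 0 < 2 * rho ^+ 2 by rewrite mulr_gt0// exprn_gt0.
have kP : n%:R * r ^+ 2 <= (k.+1)%:R * (2 * rho ^+ 2).
  by rewrite -ler_pdivrMr//; apply: ltW; exact: truncnS_gt.
pose m := k.+2; pose A := c0 / (r ^+ 2) ^+ m.
have r2 : 0 < r ^+ 2 by rewrite exprn_gt0.
have A0 : 0 < A by rewrite divr_gt0// exprn_gt0.
exists (A * (3 / 4 * r ^+ 2) ^+ m).
  by rewrite mulr_gt0// exprn_gt0// mulr_gt0//; lra.
move=> u K p cu cK u0 uK pK uh x xp.
pose b x := r ^+ 2 - enorm (x - p) ^+ 2.
have bK y : enorm (y - p) <= r -> K y -> A * b y ^+ m <= u y.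
  move=> yr Ky; apply: le_trans (uK _ Ky).
  have -> : c0 = A * (r ^+ 2) ^+ m by rewrite /A divfK// gt_eqF// exprn_gt0.
  rewrite ler_pM2l// ler_pXn2r ?nnegrE//.
  - by rewrite /b gerBl sqr_ge0.
  - by rewrite subr_ge0 ler_pXn2r ?nnegrE// ltW.
  - exact: ltW.
have bR y : enorm (y - p) = r -> A * b y ^+ m <= u y.
  by move=> yr; rewrite /b yr subrr expr0n mulr0.
pose U := [set z : 'rV[R]_n | enorm (z - p) < r /\ ~ K z].
have bU y : U y -> A * b y ^+ m - u y <= 0.
  apply: (@max_principle _ _ U (fun z => A * b z ^+ m - u z)) => //.
  - rewrite openE => z [zr Kz].
    have [e e0 eK] : exists2 e : R, 0 < e & forall y, enorm (z - y) < e -> (~` K) y.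
      by apply/nbhs_enormP; apply: open_nbhs_nbhs; split => //; exact: closed_openC.
    apply/interiorP; exists (Num.min e (r - enorm (z - p))).
      by rewrite lt_min e0 subr_gt0.
    move=> q; rewrite lt_min => /andP[zq1 zq2]; split; last exact: eK.
    by have := enorm_triangle q z p; rewrite (enormB q z); lra.
  - apply: (@bounded_enorm _ _ _ (r + enorm p)) => z [zr _].
    by have := enormD (z - p) p; rewrite subrK; lra.
  - apply: rV_continuousB => //; apply: rV_continuousM; first exact: rV_continuous_cst.
    exact: rV_continuous_radial.
  - move=> z [zr Kz]; eexists; last first.
      apply: lap_atB; last exact: uh.
      by apply: lap_atZ; exact: lap_at_radial.
    rewrite subr0 mulr_ge0 ?(ltW A0)// -/(b z) /m /=.
    have bz : 0 < b z by rewrite subr_gt0 ltr_pXn2r ?nnegrE// ltW.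
    have rz : rho ^+ 2 <= enorm (z - p) ^+ 2.
      rewrite ler_pXn2r ?nnegrE ?(ltW rho0)// leNgt; apply/negP => zrho.
      by apply: Kz; apply: pK; exact: ltW.
    have -> : 4 * k.+2%:R * k.+1%:R * b z ^+ k * enorm (z - p) ^+ 2 -
      2 * n%:R * k.+2%:R * b z ^+ k.+1 =
      2 * k.+2%:R * b z ^+ k * (k.+1%:R * (2 * enorm (z - p) ^+ 2) - n%:R * b z).
      by rewrite (exprS (b z) k); ring.
    rewrite mulr_ge0//; first by rewrite !mulr_ge0// exprn_ge0// ltW.
    rewrite subr_ge0; apply: (@le_trans _ _ (n%:R * r ^+ 2)).
      by rewrite ler_wpM2l// /b gerBl sqr_ge0.
    by apply: (le_trans kP); rewrite ler_wpM2l// ler_wpM2l.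
  - move=> z /closureP cz nUz.
    have zr : enorm (z - p) <= r.
      apply/ler_addgt0Pr => e e0; have [q [qr _] zq] := cz e e0.
      by have := enorm_triangle z q p; lra.
    rewrite subr_le0; have [Kz|Kz] := pselect (K z); first exact: bK.
    apply: bR; apply/eqP; rewrite eq_le zr leNgt; apply/negP => zr'.
    by apply: nUz; split.
have xr : enorm (x - p) < r by lra.
apply: (@le_trans _ _ (A * b x ^+ m)).
  rewrite ler_pM2l// ler_pXn2r ?nnegrE//.
  - have : enorm (x - p) ^+ 2 <= (r / 2) ^+ 2 by rewrite ler_pXn2r ?nnegrE// ltW// divr_gt0.
    by rewrite /b exprMn; lra.
  - by rewrite mulr_ge0 ?ltW//; lra.
  - by rewrite subr_ge0 ler_pXn2r ?nnegrE// ltW.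
have [Kx|Kx] := pselect (K x); first by apply: bK => //; exact: ltW.
by rewrite -subr_le0; apply: bU.
Qed.

End HarmonicEstimates.

(** * Capacity potentials *)

Section Potential.
Context {R : realType} {n : nat}.
Hypothesis n_gt0 : (0 < n)%N.
Context (Din : set 'rV[R]_n) (phi : 'rV[R]_n -> R).
Hypothesis phi_gt0 : forall x, closure Din x -> 0 < phi x.
Implicit Types (E F U : set 'rV[R]_n) (u v : 'rV[R]_n -> R) (x y : 'rV[R]_n).

(** The comparison arguments use only these properties of capacity potentials. *)
Record potential E u : Prop := {
  pot_closed : closed E;
  pot_bounded : bounded_set E;
  pot_Din : closure Din `<=` interior E;
  pot_continuous : continuous u;
  pot_in : forall x, closure Din x -> u x = phi x;
  pot_out : forall x, ~ E x -> u x = 0;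
  pot_harmonic : forall x, interior E x -> ~ closure Din x -> lap_at u x 0 }.

(** The potential vanishes outside E and is continuous, hence it vanishes on
    the boundary of E too. *)
Lemma pot_out_interior E u x : potential E u -> ~ interior E x -> u x = 0.
Proof.
move=> P /closure_setCP /closureP Ex; apply/eqP; rewrite -normr_le0.
apply/ler_addgt0Pr => e e0; rewrite add0r.
have [d d0 H] := rV_continuous_eps x (pot_continuous P) e0.
by have [y /(pot_out P) uy /H /=] := Ex d d0; rewrite uy subr0 => /ltW.
Qed.

Lemma open_closureC : open (~` closure Din).
Proof. by apply: closed_openC; exact: closed_closure. Qed.

(** The maximum principle on the intersection of U with the interior of E: as u
    vanishes off the interior of E, only the boundary of U carries a condition
    that involves u. *)
Lemma pot_le_super E U u v :
  potential E u -> open U -> (forall x, U x -> ~ closure Din x) ->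
  continuous v ->
  (forall x, interior E x -> U x -> exists2 L, L <= 0 & lap_at v x L) ->
  (forall x, closure U x -> ~ U x -> u x <= v x) ->
  (forall x, 0 <= v x) ->
  forall x, U x -> u x <= v x.
Proof.
move=> P oU UDin cv vU ub v0 x Ux.
have [Ex|Ex] := pselect (interior E x); last by rewrite (pot_out_interior P Ex).
rewrite -subr_le0.
apply: (@max_principle _ _ (interior E `&` U) (fun z => u z - v z)) => //.
- by apply: openI => //; exact: open_interior.
- have [r _ Er] := bounded_enormP (pot_bounded P).
  by apply: (@bounded_enorm _ _ _ r) => y [/interior_subset /Er].
- by apply: rV_continuousB => //; exact: pot_continuous P.
- move=> y [Ey Uy]; have [L L0 vL] := vU _ Ey Uy.
  exists (0 - L); first by rewrite sub0r oppr_ge0.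
  by apply: lap_atB => //; apply: (pot_harmonic P) => //; exact: UDin.
- move=> y cy nEUy; rewrite subr_le0.
  have [Ey|Ey] := pselect (interior E y); last by rewrite (pot_out_interior P Ey).
  apply: ub; first by apply: closureS cy => z [].
  by move=> Uy; apply: nEUy.
Qed.

Lemma pot_ge0 E u x : potential E u -> 0 <= u x.
Proof.
move=> P; have [Dx|Dx] := pselect (closure Din x).
  by rewrite (pot_in P Dx) ltW// phi_gt0.
have [Ex|Ex] := pselect (interior E x); last by rewrite (pot_out_interior P Ex).
rewrite -oppr_le0.
apply: (@max_principle _ _ (interior E `&` ~` closure Din) (fun z => - u z)) => //.
- by apply: openI; [exact: open_interior|exact: open_closureC].
- have [r _ Er] := bounded_enormP (pot_bounded P).
  by apply: (@bounded_enorm _ _ _ r) => y [/interior_subset /Er].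
- by apply: rV_continuousN; exact: pot_continuous P.
- move=> y [Ey Dy]; exists (- 0); first by rewrite oppr0.
  by apply: lap_atN; exact: pot_harmonic P _ Ey Dy.
- move=> y _ nEDy; rewrite oppr_le0.
  have [Dy|Dy] := pselect (closure Din y).
    by rewrite (pot_in P Dy) ltW// phi_gt0.
  rewrite (pot_out_interior P)// => Ey; exact: nEDy.
Qed.

Lemma pot_le_out E u v : potential E u -> continuous v ->
  (forall x, interior E x -> ~ closure Din x -> exists2 L, L <= 0 & lap_at v x L) ->
  (forall x, closure Din x -> u x <= v x) ->
  (forall x, E x -> ~ interior E x -> 0 <= v x) ->
  forall x, E x -> u x <= v x.
Proof.
move=> P cv vh uv v0 x Ex0.
have [Dx|Dx] := pselect (closure Din x); first exact: uv.
have [Ex|Ex] := pselect (interior E x); last first.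
  by rewrite (pot_out_interior P Ex) v0.
rewrite -subr_le0.
apply: (@max_principle _ _ (interior E `&` ~` closure Din) (fun z => u z - v z)) => //.
- by apply: openI; [exact: open_interior|exact: open_closureC].
- have [r _ Er] := bounded_enormP (pot_bounded P).
  by apply: (@bounded_enorm _ _ _ r) => y [/interior_subset /Er].
- by apply: rV_continuousB => //; exact: pot_continuous P.
- move=> y [Ey Dy]; have [L L0 vL] := vh _ Ey Dy.
  exists (0 - L); first by rewrite sub0r oppr_ge0.
  by apply: lap_atB => //; exact: (pot_harmonic P).
- move=> y cy nEDy; rewrite subr_le0.
  have [Dy|Dy] := pselect (closure Din y); first exact: uv.
  have Ey : ~ interior E y by move=> Ey; apply: nEDy.
  rewrite (pot_out_interior P Ey) v0//; apply: (pot_closed P).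
  by apply: closureS cy => z [/interior_subset].
Qed.

Lemma pot_le_cst E u M x : potential E u -> 0 <= M ->
  (forall y, closure Din y -> phi y <= M) -> u x <= M.
Proof.
move=> P M0 phiM; have [Ex|/(pot_out P) ->//] := pselect (E x).
apply: (@pot_le_out E u (fun=> M)) => //.
- exact: rV_continuous_cst.
- move=> y _ _; exists 0 => //; exists (fun=> 0); last by rewrite big1.
  move=> i; have := second_deriv_quadX M 0 0 1.
  set l := (X in second_deriv _ X); have -> : l = 0 by rewrite /l /=; ring.
  by apply: second_deriv_ext; apply: filterE => s; rewrite expr1; ring.
- by move=> y Dy; rewrite (pot_in P Dy) phiM.
Qed.

Lemma pot_mono E F u v x : potential E u -> potential F v -> E `<=` F -> u x <= v x.
Proof.
move=> PE PF EF; have [Ex|/(pot_out PE) ->] := pselect (E x); last exact: pot_ge0 PF.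
apply: (pot_le_out PE) => //.
- exact: pot_continuous PF.
- move=> y Ey Dy; exists 0 => //; apply: (pot_harmonic PF) => //.
  exact: interiorS Ey.
- by move=> y Dy; rewrite (pot_in PE Dy) (pot_in PF Dy).
- by move=> y _ _; exact: pot_ge0 PF.
Qed.

End Potential.

(** * One-sided derivatives *)

Section OneSidedDerivatives.
Context {R : realType} {n : nat}.

Lemma time_derivative_left (a b : R) (h : R -> R) t l : a < t -> t <= b ->
  is_time_derivative a b h t l -> forall e, 0 < e -> exists2 r : R, 0 < r &
  forall s, a <= s -> t - r < s -> s < t -> `|h s - h t - l * (s - t)| <= e * (t - s).
Proof.
move=> ta tb /(@cvgrPdist_le _ _ _ (within `[a, b] t^')) hl e e0.
have := hl e e0; rewrite /within /= => /(@nbhs_ballP R R)[r /= r0 H].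
exists r => // s sa sr st.
have := H s; rewrite /= -ball_normE /= => H1.
have st0 : t - s != 0 by rewrite gt_eqF// subr_gt0.
have : `|l - (h s - h t) / (s - t)| <= e.
  apply: H1.
  - by rewrite gtr0_norm ?subr_gt0//; lra.
  - by rewrite lt_eqF.
  - by rewrite in_itv /= sa ltW// (lt_le_trans st).
move=> H2; have -> : h s - h t - l * (s - t) = (l - (h s - h t) / (s - t)) * (t - s).
  by field; rewrite -oppr_eq0 opprB.
by rewrite normrM (gtr0_norm (_ : 0 < t - s)) ?subr_gt0// ler_wpM2r// subr_ge0 ltW.
Qed.

Lemma time_derivative_le (a b a' b' : R) (h k : R -> R) t l l' (K r : R) :
  a < t -> t <= b -> a' < t -> t <= b' -> 0 < r ->
  is_time_derivative a b h t l -> is_time_derivative a' b' k t l' ->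
  (forall s, a <= s -> a' <= s -> t - r < s -> s < t ->
     k s - k t + K * (t - s) <= h s - h t) -> l <= l' - K.
Proof.
move=> ta tb ta' tb' r0 hl kl kh; apply/ler_addgt0Pr => e e0.
have e2 : 0 < e / 2 by rewrite divr_gt0.
have [r1 r10 H1] := time_derivative_left ta tb hl e2.
have [r2 r20 H2] := time_derivative_left ta' tb' kl e2.
pose m := Num.min (t - a) (Num.min (t - a') (Num.min r (Num.min r1 r2))).
have m0 : 0 < m by rewrite !lt_min !subr_gt0 ta ta' r0 r10 r20.
pose d := m / 2; have d0 : 0 < d by rewrite divr_gt0.
have : d < m by rewrite /d; lra.
rewrite !lt_min => /and5P[da da' dr d1 d2].
have := H1 (t - d) ltac:(lra) ltac:(lra) ltac:(lra).
have := H2 (t - d) ltac:(lra) ltac:(lra) ltac:(lra).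
have := kh (t - d) ltac:(lra) ltac:(lra) ltac:(lra) ltac:(lra).
have -> : t - d - t = - d by ring.
have -> : t - (t - d) = d by ring.
rewrite !ler_norml => A1 /andP[A2 _] /andP[_ A3].
by rewrite -(ler_pM2r d0); lra.
Qed.

(** The limit from the left defining the normal derivative follows the inward
    normal, so that q is minus the slope of v in that direction. *)
Lemma normal_derivative_in (E : set 'rV[R]_n) v x q :
  is_normal_derivative E v x q -> forall e, 0 < e -> exists2 r : R, 0 < r &
  forall s, 0 < s -> s < r -> `|v (x - s *: outward_normal E x) - v x + q * s| <= e * s.
Proof.
move=> /(@cvgrPdist_le _ _ _ (0 : R)^'-) vq e e0.
have := vq e e0; rewrite /at_left /within /= => /(@nbhs_ballP R R)[r /= r0 H].
exists r => // s s0 sr.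
have := H (- s); rewrite /= -ball_normE /= sub0r opprK oppr_lt0 => H1.
have : `|q - (v (x + (- s) *: outward_normal E x) - v x) / (- s)| <= e.
  by apply: H1 => //; rewrite gtr0_norm.
rewrite scaleNr => H2.
set w := v (x - s *: outward_normal E x) in H2 *.
have -> : w - v x + q * s = (q - (w - v x) / (- s)) * s.
  by field; rewrite gt_eqF.
by rewrite normrM (gtr0_norm s0) ler_wpM2r// ltW.
Qed.

End OneSidedDerivatives.

(** * Regularity of a smooth flow *)

Section Flow.
Context {R : realType} {n : nat}.
Hypothesis n_gt0 : (0 < n)%N.
Context (Din : set 'rV[R]_n) (phi : 'rV[R]_n -> R).
Hypothesis phi_gt0 : forall x, closure Din x -> 0 < phi x.
Hypothesis Din_neq0 : Din !=set0.

Lemma bounded_setC_neq0 (E : set 'rV[R]_n) : bounded_set E -> (~` E) !=set0.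
Proof.
move=> /bounded_enormP[r r0 Er]; exists ((r + 1) *: delta_mx ord0 (Ordinal n_gt0)).
by move=> /= /Er; rewrite enormZ enorm_delta mulr1 ger0_norm ?addr_ge0 ?(ltW r0)//; lra.
Qed.

Section OneFlow.
Context (a b : R) (u : R -> 'rV[R]_n -> R) (g : R -> set 'rV[R]_n).
Hypothesis G : smooth_MCND_flow Din setT phi a b u g.
Implicit Types (s t e : R) (x y z : 'rV[R]_n).

Lemma flow_lt : a < b.
Proof. by case: (mcnd_smooth G). Qed.

Lemma flow_potential t : a <= t <= b -> potential Din phi (g t) (u t).
Proof.
move=> tab; have [_ cg _ _] := mcnd_smooth G.
have [[_ Dg] [cpt _]] := mcnd_between G tab.
have [uc [_ uin _] _] := mcnd_potential G tab.
split => //.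
- exact: cg.
- have [r _ gr] := bounded_enormP (compact_bounded cpt).
  by apply: (@bounded_enorm _ _ _ r) => x /subset_closure /gr.
- exact: (mcnd_out G tab).
- move=> x gx Dx; have [C2 L0] := mcnd_harmonic G tab.
  have Ux : (interior (g t) `\` closure Din) x by split.
  rewrite -(L0 _ Ux); apply: Ck2_lap_at C2 Ux.
  by apply: openI; [exact: open_interior|exact: open_closureC].
Qed.

Lemma flow_closed t : a <= t <= b -> closed (g t).
Proof. by move=> /flow_potential[]. Qed.

Lemma flow_neq0 t : a <= t <= b -> g t !=set0.
Proof.
move=> /flow_potential P; have [x Dx] := Din_neq0; exists x.
by apply: interior_subset; apply: (pot_Din P); exact: subset_closure.
Qed.

Lemma flow_setC_neq0 t : a <= t <= b -> (~` g t) !=set0.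
Proof. by move=> /flow_potential P; apply: bounded_setC_neq0; case: P. Qed.

Lemma flow_sdist_lip t x y : a <= t <= b ->
  sdist (g t) x <= sdist (g t) y + enorm (x - y).
Proof. by move=> tab; apply: sdist_lip; [exact: flow_neq0|exact: flow_setC_neq0]. Qed.

Lemma flow_sdist_le0 t x : a <= t <= b -> g t x <-> sdist (g t) x <= 0.
Proof.
move=> tab; split; first exact: sdist_in_le0.
by apply: sdist_closed; [exact: flow_closed|exact: flow_neq0].
Qed.

Lemma flow_sdist_lt0 t x : a <= t <= b -> interior (g t) x <-> sdist (g t) x < 0.
Proof. by move=> tab; apply: sdist_interior; exact: flow_setC_neq0. Qed.

Lemma flow_phi_bounds : exists c M : R, [/\ 0 < c, 0 < M &
  forall x, closure Din x -> c <= phi x <= M].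
Proof.
have aab : a <= a <= b by rewrite lexx ltW// flow_lt.
have P := flow_potential aab.
have cu : {within closure Din, continuous (u a)}.
  exact: continuous_subspaceT (pot_continuous P).
have D0 : closure Din !=set0 by have [x Dx] := Din_neq0; exists x; exact: subset_closure.
have [[cD _] _] := mcnd_between G aab.
have [x /set_mem Dx xmin] := compact_EVT_min D0 cD cu.
have [y /set_mem Dy ymax] := compact_EVT_max D0 cD cu.
exists (u a x), (u a y); rewrite (pot_in P Dx) (pot_in P Dy).
split; [exact: phi_gt0|exact: phi_gt0|move=> z Dz].
rewrite -(pot_in P Dx) -(pot_in P Dy) -(pot_in P Dz).
by rewrite xmin ?ymax//; exact/mem_set.
Qed.

Lemma flow_bnd t x : a <= t <= b -> bnd (g t) x <-> sdist (g t) x = 0.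
Proof.
move=> tab; apply: bnd_sdist0; first exact: flow_closed.
  exact: flow_neq0.
exact: flow_setC_neq0.
Qed.

(** The signed distance is continuous in time at fixed x and 1-Lipschitz in x,
    uniformly in time, hence it is jointly continuous. *)
Lemma flow_sdist_near t x e : a <= t <= b -> 0 < e -> exists2 r : R, 0 < r &
  forall s y, a <= s <= b -> `|t - s| < r -> enorm (x - y) < r ->
    `|sdist (g t) x - sdist (g s) y| < e.
Proof.
move=> tab e0; have [_ _ /(_ x) cd _] := mcnd_smooth G.
have e2 : 0 < e / 2 by rewrite divr_gt0.
have tI : `[a, b]%classic t by rewrite /= in_itv.
have := iffLR (subspace_continuousP _ _) cd t tI.
move=> /(@cvgrPdist_lt _ _ _ (within `[a, b] (nbhs t))) /(_ _ e2).
rewrite /within /= => /(@nbhs_ballP R R)[r /= r0 H].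
exists (Num.min r (e / 2)); first by rewrite lt_min r0.
move=> s y sab; rewrite !lt_min => /andP[tsr _] /andP[_ xye].
have : `|sdist (g t) x - sdist (g s) x| < e / 2.
  by apply: H => //; rewrite ?in_itv//= -ball_normE.
have := flow_sdist_lip x y sab; have := flow_sdist_lip y x sab.
by rewrite (enormB y x) !ltr_norml; lra.
Qed.

(** The strip on which d is smooth is relatively open in space-time, so that the
    local smooth extension F agrees with d at all admissible times near t, and
    space and time derivatives of d at the boundary are derivatives of F. *)
Lemma flow_local_extension t x : a <= t <= b -> bnd (g t) x ->
  exists U : set ('rV[R]_n * R^o), exists F : 'rV[R]_n * R^o -> R^o,
    [/\ open U, U (x, t), Cinfty U F &
        forall y s, U (y, s) -> a <= s <= b -> sdist (g s) y = F (y, s)].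
Proof.
move=> tab xb; have [_ _ _ [A [Ab [W oW SW] Ssm]]] := mcnd_smooth G.
have [oA bA] := Ab t tab.
have Sxt : [set p : 'rV[R]_n * R^o |
    [set q : 'rV[R]_n * R^o | a <= q.2 <= b] p /\ A p.2 p.1] (x, t).
  by split => //; exact: bA.
have [U [F' [oU Ux CF SF]]] := Ssm _ Sxt.
exists (U `&` W), F'; split.
- exact: openI.
- by split => //; move: Sxt; rewrite SW => -[].
- move=> k; have := CF k; clear; elim: k F' => [|k IH] F /=.
    by move=> [cF _]; split => // y [Uy _]; exact: cF.
  move=> [cF dF]; split=> [y [Uy _]|v]; first exact: cF.
  by have [dv Cv] := dF v; split=> [y [Uy _]|]; [exact: dv|exact: IH].
- move=> y s [Uy Wy] sab; have := SF (y, s) Uy; apply.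
  by rewrite SW; split.
Qed.

Let space_dir (i : 'I_n) : 'rV[R]_n * R^o := (delta_mx ord0 i, 0).
Let time_dir : 'rV[R]_n * R^o := (0, 1).

Section Extension.
Context (U : set ('rV[R]_n * R^o)) (F : 'rV[R]_n * R^o -> R^o).
Hypothesis oU : open U.
Hypothesis CF : Cinfty U F.
Hypothesis FE : forall y s, U (y, s) -> a <= s <= b -> sdist (g s) y = F (y, s).

Definition lapF (p : 'rV[R]_n * R^o) : R := \sum_i 'D_(space_dir i) ('D_(space_dir i) F) p.

Lemma extension_lap_at t x : U (x, t) -> a <= t <= b ->
  lap_at (sdist (g t)) x (lapF (x, t)).
Proof.
move=> Ux tab; exists (fun i => 'D_(space_dir i) ('D_(space_dir i) F) (x, t)) => // i.
have lineE s : (x, t) + s *: space_dir i = (x + s *: delta_mx ord0 i, t).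
  by rewrite /space_dir; congr pair; rewrite /= scaler0 addr0.
apply: second_deriv_ext (second_deriv_line (space_dir i) oU (CF 2) Ux).
apply: filterS (near_line_open (space_dir i) oU Ux) => s.
by rewrite lineE => Us; rewrite FE.
Qed.

Lemma extension_time t x l : U (x, t) -> a < t -> t <= b ->
  is_time_derivative a b (fun s => sdist (g s) x) t l -> l = 'D_time_dir F (x, t).
Proof.
move=> Ux ta tb hl.
have tab : a <= t <= b by rewrite ltW.
have lineE s : (x, t) + s *: time_dir = (x, t + s).
  rewrite /time_dir; congr pair; first by rewrite /= scaler0 addr0.
  by congr (_ + _); exact: mulr1.
have [_ /(_ time_dir)[dF _]] := CF 1.
have := @line_is_derive _ _ F (x, t) time_dir 0.
have -> : (x, t) + (0 : R) *: time_dir = (x, t) by rewrite scale0r addr0.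
move=> /(_ (dF _ Ux)) hF.
apply/eqP; rewrite -subr_eq0 -normr_le0; apply/ler_addgt0Pr => e e0; rewrite add0r.
have e2 : 0 < e / 2 by rewrite divr_gt0.
have [r1 r10 H1] := time_derivative_left ta tb hl e2.
have [r2 r20 H2] := is_derive_eps hF e2.
have /near0P[r3 r30 H3] := near_line_open time_dir oU Ux.
pose m := Num.min (t - a) (Num.min r1 (Num.min r2 r3)).
have m0 : 0 < m by rewrite !lt_min subr_gt0 ta r10 r20.
pose k := m / 2; have k0 : 0 < k by rewrite divr_gt0.
have km : k < m by rewrite /k; lra.
move: (km); rewrite !lt_min => /and4P[kta k1 k2 k3].
have tkab : a <= t - k <= b by apply/andP; split; lra.
have nk : `|- k| = k by rewrite normrN gtr0_norm.
have Utk : U (x, t - k) by have := H3 (- k); rewrite lineE nk; apply.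
pose A : R := F (x, t - k) - F (x, t); pose D : R := 'D_time_dir F (x, t).
have A2 : `|A - D * - k| <= e / 2 * k.
  by have /= := H2 (- k); rewrite nk add0r scale0r addr0 lineE => /(_ k2).
have A1 : `|A - l * - k| <= e / 2 * k.
  have := H1 (t - k); rewrite FE// FE//.
  have -> : t - k - t = - k by ring.
  have -> : t - (t - k) = k by ring.
  by case/andP: tkab => tka tkb; apply => //; lra.
have : `|(l - D) * k| <= e * k.
  have -> : (l - D) * k = (A - l * - k) - (A - D * - k) by ring.
  by apply: le_trans (ler_normB _ _) _; lra.
by rewrite normrM (gtr0_norm k0) ler_pM2r.
Qed.

Lemma extension_continuous (p : 'rV[R]_n * R^o) : U p ->
  {for p, continuous (fun q => lapF q - 'D_time_dir F q)}.
Proof.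
move=> Up; have [_ dF] := CF 3.
have cD v : {for p, continuous ('D_v F)} by have [_ [cF _]] := dF v; exact: cF.
have cDD v : {for p, continuous ('D_v ('D_v F))}.
  by have [_ [_ /(_ v)[_ [cF _]]]] := dF v; exact: cF.
apply: continuousB; last exact: cD.
have -> : lapF = \sum_i 'D_(space_dir i) ('D_(space_dir i) F).
  by apply/funext => q; rewrite /lapF fct_sumE.
elim/big_ind: _ => [|f1 f2 cf1 cf2|i _]; last exact: cDD.
- exact: cst_continuous.
- exact: continuousD.
Qed.

End Extension.

Lemma flow_lap_at t x : a <= t <= b -> bnd (g t) x ->
  lap_at (sdist (g t)) x (laplacian (sdist (g t)) x).
Proof.
move=> tab xb; have [U [F [oU Ux CF FE]]] := flow_local_extension tab xb.
have L := extension_lap_at oU CF FE Ux tab.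
by rewrite (lap_at_laplacian L).
Qed.

(** The velocity law gives q^2 = Laplacian of d minus the time derivative of d,
    which is continuous in space-time near the moving boundary; compactness
    turns this into a bound for the normal derivatives of the potentials. *)
Lemma flow_normal_bound (m : R) : exists2 Q : R, 0 < Q & forall t x q,
  a < t -> t <= b -> bnd (g t) x -> enorm x <= m ->
  is_time_derivative a b (fun s => sdist (g s) x) t
    (laplacian (sdist (g t)) x - q ^+ 2) -> q ^+ 2 <= Q.
Proof.
pose P (e : R) (p : 'rV[R]_n * R^o) := forall q, a < p.2 -> p.2 <= b ->
  bnd (g p.2) p.1 ->
  is_time_derivative a b (fun s => sdist (g s) p.1) p.2
    (laplacian (sdist (g p.2)) p.1 - q ^+ 2) -> q ^+ 2 <= e^-1.
pose K := [set x : 'rV[R]_n | enorm x <= m] `*` (`[a, b]%classic : set R^o).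
have cK : compact K.
  apply: compact_setX; last exact: segment_compact.
  by apply: (@compact_enorm _ _ _ m) => //; exact: closed_enorm_ball.
have [e e0 HQ] : exists2 e : R, 0 < e & forall p, K p -> P e p.
  apply: (compact_uniform cK) => -[x0 t0] [/= _]; rewrite in_itv /= => t0ab.
  have [xb|xb] := pselect (bnd (g t0) x0); last first.
    have d0 : 0 < `|sdist (g t0) x0|.
      by rewrite normr_gt0; apply/negP => /eqP /(flow_bnd _ t0ab).
    have [r r0 H] := flow_sdist_near x0 t0ab d0.
    exists 1 => //; apply/nbhs_space_time; exists r => // y s xy ts e _ _ q /= sa sb yb _.
    have sab : a <= s <= b by rewrite ltW.
    have := H s y sab ts xy.
    by move/(flow_bnd _ sab) : yb => ->; rewrite subr0 ltxx.
  have [U [F [oU Ux CF FE]]] := flow_local_extension t0ab xb.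
  pose H (p : 'rV[R]_n * R^o) : R := lapF F p - 'D_time_dir F p.
  have cH := @extension_continuous U F CF (x0, t0) Ux.
  have Hnear : nbhs (x0, t0 : R^o) [set p | `|H (x0, t0) - H p| < 1].
    by move/(@cvgrPdist_lt _ _ _ (nbhs (x0, t0 : R^o))) : cH => /(_ 1 ltr01).
  have : nbhs (x0, t0 : R^o) ([set p | `|H (x0, t0) - H p| < 1] `&` U).
    by apply: filterI => //; exact: open_nbhs_nbhs.
  move=> /nbhs_space_time[r r0 rH].
  have H1 : 0 < `|H (x0, t0)| + 1 by rewrite ltr_wpDl.
  exists (`|H (x0, t0)| + 1)^-1; first by rewrite invr_gt0.
  apply/nbhs_space_time; exists r => // y s xy ts e e0 ed q /= sa sb yb hq.
  have [/= Hys Uys] := rH y s xy ts.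
  have sab : a <= s <= b by rewrite ltW.
  have := extension_time oU CF FE Uys sa sb hq.
  rewrite (lap_at_laplacian (extension_lap_at oU CF FE Uys sab)) => E.
  have -> : q ^+ 2 = H (y, s) by rewrite /H -E; ring.
  apply: (@le_trans _ _ (`|H (x0, t0)| + 1)).
    by move: Hys; rewrite ltr_norml => /andP[]; have := ler_norm (H (x0, t0)); lra.
  by rewrite -[leLHS]invrK lef_pV2 ?posrE ?invr_gt0.
exists e^-1; first by rewrite invr_gt0.
move=> t x q ta tb xb xm hq; apply: (HQ (x, t)) => //.
by split => //=; rewrite in_itv /= ltW.
Qed.

End OneFlow.
End Flow.

(** * Uniform boundedness of a smooth flow *)

Section Bounded.
Context {R : realType} {n : nat}.
Hypothesis n_gt0 : (0 < n)%N.
Context (Din : set 'rV[R]_n) (phi : 'rV[R]_n -> R).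
Hypothesis phi_gt0 : forall x, closure Din x -> 0 < phi x.
Hypothesis Din_neq0 : Din !=set0.
Context (a b : R) (u : R -> 'rV[R]_n -> R) (g : R -> set 'rV[R]_n).
Hypothesis G : smooth_MCND_flow Din setT phi a b u g.
Implicit Types (s t e : R) (x y z p : 'rV[R]_n).

Let gpot t : a <= t <= b -> potential Din phi (g t) (u t).
Proof. exact: flow_potential. Qed.

Let glip t x y : a <= t <= b -> sdist (g t) x <= sdist (g t) y + enorm (x - y).
Proof. exact: (flow_sdist_lip n_gt0 Din_neq0 G). Qed.

(** Just before t the exterior ball centred at p is larger by K (t - s), so that
    the signed distance to g(s) at x is at least K (t - s); at time t it lies
    above the radial function (r^2 - |z - p|^2) / (2 r), with equality at x and
    Laplacian - n / r.  The velocity law compares the two. *)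
Lemma touching_ball t x p (r K r' q : R) : a < t -> t <= b -> 0 < r -> 0 <= K -> 0 < r' ->
  bnd (g t) x -> enorm (x - p) = r ->
  (forall s, a <= s -> t - r' < s -> s <= t ->
     forall z, g s z -> r + K * (t - s) <= enorm (p - z)) ->
  is_time_derivative a b (fun s => sdist (g s) x) t
    (laplacian (sdist (g t)) x - q ^+ 2) ->
  outward_normal (g t) x = r^-1 *: (p - x) /\ K <= n%:R / r + q ^+ 2.
Proof.
move=> ta tb r0 K0 r'0 xb xp gp ht.
have tab : a <= t <= b by rewrite ltW.
have x0 : sdist (g t) x = 0 by apply/(flow_bnd n_gt0 Din_neq0 G).
have pdist s : a <= s -> t - r' < s -> s <= t -> r + K * (t - s) <= sdist (g s) p.
  move=> sa sr st; have sab : a <= s <= b by rewrite sa (le_trans st).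
  have rK : r <= r + K * (t - s) by rewrite lerDl mulr_ge0// subr_ge0.
  rewrite sdist_out; last first.
    by move=> /(gp s sa sr st); rewrite subrr enorm0; lra.
  apply: dist_lb; first exact: (flow_neq0 Din_neq0 G).
  by move=> z gz; exact: gp.
have gL := flow_lap_at G tab xb.
pose w z := (2 * r)^-1 * (r ^+ 2 - enorm (z - p) ^+ 2) ^+ 1.
have wL : lap_at w x (- (n%:R / r)).
  have := lap_atZ (2 * r)^-1 (lap_at_radial (r ^+ 2) p 1 x).
  set l := (X in lap_at _ _ X); have -> : l = - (n%:R / r); last by [].
  by rewrite /l /=; field; rewrite gt_eqF.
have w0 : w x = 0 by rewrite /w xp subrr expr1 mulr0.
have wg : \forall z \near x, w z - w x <= sdist (g t) z - sdist (g t) x.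
  apply: filterE => z; rewrite x0 w0 !subr0 /w expr1.
  have H1 : r <= sdist (g t) p.
    have := pdist t (ltW ta) _ (lexx t); rewrite subrr mulr0 addr0; apply.
    by rewrite ltrBlDr ltrDl.
  have H2 := glip p z tab.
  apply: (@le_trans _ _ (r - enorm (p - z))); last by lra.
  rewrite (enormB p z) mulrC ler_pdivrMr ?mulr_gt0//.
  have := sqr_ge0 (r - enorm (z - p)); rewrite sqrrB.
  by lra.
split.
  rewrite /outward_normal -(touching_grad gL wL wg); apply/rowP => i.
  rewrite mxE.
  have := lap_at_partial i wL => -[_ <-].
  have [_] : is_derive (0 : R) 1 (fun s : R => w (x + s *: delta_mx ord0 i))
      (r^-1 * (p - x) ord0 i).
    have -> : (fun s : R => w (x + s *: delta_mx ord0 i)) =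
       (fun s => 0 + (r^-1 * (p - x) ord0 i) * s + (- (2 * r)^-1) * s ^+ 2).
      apply/funext => s; rewrite /w expr1.
      have -> : x + s *: delta_mx ord0 i - p = (x - p) + s *: delta_mx ord0 i.
        by rewrite addrAC.
      have -> : (p - x) ord0 i = - (x - p) ord0 i by rewrite -opprB mxE.
      move: xp; move: (x - p) => v vr.
      rewrite sqr_enorm !dotpDl !dotpDr -(sqr_enorm v) vr.
      rewrite !dotpZl !dotpZr (dotpC (delta_mx ord0 i) v) !dotp_delta.
      have -> : (delta_mx ord0 i : 'rV[R]_n) ord0 i = 1 by rewrite mxE !eqxx.
      by field; rewrite gt_eqF.
    have := is_derive_quad 0 (r^-1 * (p - x) ord0 i) (- (2 * r)^-1) 0.
    by rewrite mulr0 addr0.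
  by move=> ->; rewrite !mxE.
have Lgw := touching_laplacian gL wL wg.
have H0 : is_time_derivative a b (fun=> 0 : R) t 0.
  by rewrite /is_time_derivative subrr; under eq_fun do rewrite mul0r; exact: cvg_cst.
suff : forall s, a <= s -> a <= s -> t - r' < s -> s < t ->
    0 - 0 + K * (t - s) <= sdist (g s) x - sdist (g t) x.
  by move=> /(time_derivative_le ta tb ta tb r'0 ht H0); lra.
move=> s sa _ sr st; rewrite x0 !subr0 add0r.
have sab : a <= s <= b by rewrite sa (le_trans (ltW st)).
have := pdist s sa sr (ltW st); have := glip p x sab.
by rewrite (enormB p x) xp; lra.
Qed.


Lemma flow_touch_data t x : a <= t <= b -> bnd (g t) x -> exists2 q,
  is_normal_derivative (g t) (u t) x q & is_time_derivative a b (fun s => sdist (g s) x) t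
    (laplacian (sdist (g t)) x - q ^+ 2).
Proof. by move=> tab xb; have [q ? ?] := mcnd_velocity G tab xb; exists q. Qed.

Let g_in_bounded t : a <= t <= b -> exists2 r : R, 0 < r & forall x, g t x -> enorm x <= r.
Proof. by move=> /gpot P; apply: bounded_enormP; exact: pot_bounded P. Qed.

Let g_sdist x t : a <= t <= b -> g t x <-> sdist (g t) x <= 0.
Proof. exact: (flow_sdist_le0 Din_neq0 G). Qed.

(** Pointwise continuity of the signed distance alone would allow a part of the
    flow to come in from infinity at time t0.  By continuity such a part is
    separated from Din by an empty annulus, so its potential vanishes and it
    moves by mean curvature; then it cannot approach the origin at a speed
    greater than the inverse radius of an exterior ball, and it must already
    have been at a finite distance at time t0. *)
Lemma flow_right_bounded t0 : a <= t0 -> t0 < b -> exists2 r : R, 0 < r &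
  exists m : R, forall s x, t0 <= s -> s <= b -> s < t0 + r -> g s x -> enorm x <= m.
Proof.
move=> at0 t0b; have t0ab : a <= t0 <= b by rewrite at0 ltW.
have [R0 R00 gR0] := g_in_bounded t0ab.
pose Ann := [set x : 'rV[R]_n | enorm x <= R0 + 5 /\ R0 + 1 <= enorm x].
have cAnn : compact Ann.
  apply: (@compact_enorm _ _ _ (R0 + 5)); last by move=> x [].
  apply: closedI; first exact: closed_enorm_ball.
  move=> x /closureP cx; apply/ler_addgt0Pr => e e0.
  have [y /= yR xy] := cx e e0.
  by have := enorm_lip y x; rewrite (enormB y x); lra.
have [r1 r10 Hann] : exists2 r1 : R, 0 < r1 & forall s x, `|t0 - s| < r1 -> a <= s <= b ->
    R0 + 1 <= enorm x -> enorm x <= R0 + 5 -> ~ g s x.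
  have [r1 r10 H] : exists2 e : R, 0 < e & forall x, Ann x ->
      forall s, `|t0 - s| < e -> a <= s <= b -> ~ g s x.
    apply: (compact_uniform cAnn) => x [xR5 xR1].
    have xg : 0 < sdist (g t0) x.
      rewrite ltNge; apply/negP => /(g_sdist _ t0ab) /gR0; lra.
    have [r r0 H] := flow_sdist_near n_gt0 Din_neq0 G x t0ab xg.
    exists r => //; apply/nbhs_enormP; exists r => // y xy e e0 er s ts sab.
    move=> /(g_sdist _ sab) ys.
    by have := H s y sab (lt_le_trans ts er) xy; rewrite ltr_norml; lra.
  by exists r1 => // s x ts sab x1 x2; exact: (H x).
exists r1 => //; exists (R0 + 1) => s1 x1 ts1 s1b s1r gx1.
rewrite leNgt; apply/negP => x1R.
(* greater than n / r for the exterior ball of radius r = 1 used below *)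
pose K : R := n%:R + 1.
have K0 : 0 < K by rewrite /K ltr_wpDl.
pose fK (p : 'rV[R]_n * R^o) : R := enorm p.1 + K * p.2.
pose Z := [set p : 'rV[R]_n * R^o |
  [/\ t0 <= p.2 <= s1, g p.2 p.1, R0 + 1 <= enorm p.1 & fK p <= fK (x1, s1)]].
have fKc : continuous fK.
  move=> [x s]; apply/(@cvgrPdist_lt _ _ _ (nbhs (x, s : R^o))) => e e0.
  have K1 : 0 < K + 1 by rewrite addr_gt0.
  have [d d0 eE] : exists2 d, 0 < d & e = d + K * d.
    by exists (e / (K + 1)); [rewrite divr_gt0|field; rewrite gt_eqF].
  apply/nbhs_space_time; exists d => //.
  move=> y s' xy ss'; rewrite /fK /=.
  have -> : enorm x + K * s - (enorm y + K * s') = (enorm x - enorm y) + K * (s - s').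
    by ring.
  apply: le_lt_trans (ler_normD _ _) _; rewrite normrM (gtr0_norm K0).
  have : `|enorm x - enorm y| <= enorm (x - y).
    rewrite ler_norml; have := enorm_lip x y; have := enorm_lip y x.
    by rewrite (enormB y x); lra.
  have : K * `|s - s'| < K * d by rewrite ltr_pM2l.
  by rewrite eE; lra.
have ZK : Z `<=` ([set x | enorm x <= fK (x1, s1) - K * t0]
                  `*` (`[t0, s1]%classic : set R^o)).
  move=> [x s] [/= /andP[ts ss] _ _ fxs]; split => /=; last by rewrite in_itv /= ts.
  have : K * t0 <= K * s by rewrite ler_pM2l.
  by move: fxs; rewrite {1}/fK /=; lra.
have cZ : compact Z.
  apply: (subclosed_compact _ _ ZK).
    move=> [x s] cl.
    have {}cl r : 0 < r -> exists y s', [/\ Z (y, s'), enorm (x - y) < r & `|s - s'| < r].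
      move=> r0; have : nbhs (x, s : R^o) [set p | enorm (x - p.1) < r /\ `|s - p.2| < r].
        by apply/nbhs_space_time; exists r.
      by move=> /cl[[y s'] [Zy [/= ? ?]]]; exists y, s'.
    have ts : t0 <= s <= s1.
      apply/andP; split; apply/ler_addgt0Pr => e e0;
      have [y [s' [[/= /andP[A1 A2] _ _ _] _]]] := cl e e0;
      by rewrite ltr_norml => /andP[]; lra.
    have sab : a <= s <= b.
      by case/andP: ts => A1 A2; rewrite (le_trans at0 A1) (le_trans A2 s1b).
    split => //=.
    - apply/(g_sdist _ sab); rewrite leNgt; apply/negP => xs0.
      have [r r0 H] := flow_sdist_near n_gt0 Din_neq0 G x sab xs0.
      have [y [s' [[/= /andP[A1 A2] gy _ _] xy ss']]] := cl r r0.
      have s'ab : a <= s' <= b by rewrite (le_trans at0 A1) (le_trans A2 s1b).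
      have := H s' y s'ab ss' xy; have := sdist_in_le0 gy.
      by rewrite ltr_norml; lra.
    - apply/ler_addgt0Pr => e e0; have [y [s' [[/= _ _ A1 _] xy _]]] := cl e e0.
      by have := enorm_lip y x; rewrite (enormB y x); lra.
    - apply/ler_addgt0Pr => e e0.
      have /nbhs_space_time[r r0 H] : nbhs (x, s : R^o) [set p | `|fK (x, s) - fK p| < e].
        by have /(@cvgrPdist_lt _ _ _ (nbhs (x, s : R^o))) := fKc (x, s); apply.
      have [y [s' [[/= _ _ _ A1] xy ss']]] := cl r r0.
      by have := H y s' xy ss'; rewrite /= ltr_norml; lra.
  apply: compact_setX; last exact: segment_compact.
  apply: compact_enorm; last by move=> x; exact.
  exact: closed_enorm_ball.
have Z0 : Z !=set0 by exists (x1, s1); split => //=; rewrite ?ts1 ?lexx// ltW.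
(* at the minimum of |x| + K s, the far part stays, before t, outside the ball
   of radius |x| + K (t - s), and touches it at time t *)
have [[x t] /set_mem[/= /andP[tt0 ts1'] gx xR _] fmin] :=
  compact_EVT_min Z0 cZ (continuous_subspaceT fKc).
have tab : a <= t <= b by rewrite (le_trans at0 tt0) (le_trans ts1' s1b).
have near_t0 s : t0 <= s -> s <= s1 -> `|t0 - s| < r1.
  by move=> A1 A2; rewrite distrC ger0_norm ?subr_ge0//; lra.
have gfar s z : t0 <= s -> s <= s1 -> g s z -> enorm z < R0 + 1 \/ R0 + 5 < enorm z.
  move=> A1 A2 gz; have sab : a <= s <= b by rewrite (le_trans at0 A1) (le_trans A2 s1b).
  have [zR|zR] := ltP (enorm z) (R0 + 1); first by left.
  right; rewrite ltNge; apply/negP => zR5.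
  exact: (Hann s z (near_t0 s A1 A2) sab zR zR5 gz).
have t0t : t0 < t.
  rewrite lt_def tt0 andbT; apply/eqP => E; move: gx; rewrite E => /gR0.
  by lra.
have xR5 : R0 + 5 < enorm x by case: (gfar t x tt0 ts1' gx) => //; lra.
have minP s z : t0 <= s -> s <= t -> g s z -> R0 + 1 <= enorm z ->
    enorm x + K * (t - s) <= enorm z.
  move=> A1 A2 gz zR; have [zf|zf] := leP (fK (z, s)) (fK (x1, s1)).
    have : fK (x, t) <= fK (z, s).
      apply: fmin; apply/mem_set; split => //=.
      by rewrite A1 (le_trans A2).
    by rewrite /fK /=; lra.
  have : fK (x, t) <= fK (x1, s1).
    by apply: fmin; apply/mem_set; split => //=; rewrite ?ts1 ?lexx// ltW.
  by move: zf; rewrite /fK /=; lra.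
have x0 : 0 < enorm x by lra.
(* centre of the ball of radius 1 that touches that ball from inside at x *)
pose p := (1 - (enorm x)^-1) *: x.
have xp : x - p = (enorm x)^-1 *: x.
  by rewrite /p scalerBl scale1r opprB addrC subrK.
have xp1 : enorm (x - p) = 1.
  by rewrite xp enormZ gtr0_norm ?invr_gt0// mulVf// gt_eqF.
have p1 : enorm p = enorm x - 1.
  rewrite /p enormZ ger0_norm; last by rewrite subr_ge0 invf_le1//; lra.
  by rewrite mulrBl mul1r mulVf// gt_eqF.
have xb : bnd (g t) x.
  apply/bndP; split; first exact: subset_closure.
  apply/closureP => e e0.
  pose c := Num.min (e / 2) 1.
  have c0 : 0 < c by rewrite lt_min divr_gt0/=.
  have c1 : c <= 1 by rewrite ge_min lexx orbT.
  have ce : c < e by rewrite gt_min; apply/orP; left; lra.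
  exists (x - c *: (x - p)); last by rewrite subKr enormZ xp1 mulr1 gtr0_norm.
  have N : enorm (x - c *: (x - p)) = enorm x - c.
    have -> : x - c *: (x - p) = (1 - c * (enorm x)^-1) *: x.
      by rewrite xp scalerA scalerBl scale1r.
    rewrite enormZ ger0_norm; first by rewrite mulrBl mul1r divfK ?gt_eqF.
    by rewrite subr_ge0 ler_pdivrMr//; lra.
  move=> gz; have := minP t _ tt0 (lexx t) gz; rewrite N subrr mulr0 addr0.
  by lra.
have [q nq tq] := flow_touch_data tab xb.
pose r' := Num.min (t - t0) K^-1.
have r'0 : 0 < r' by rewrite lt_min subr_gt0 t0t invr_gt0.
have ta : a < t by exact: le_lt_trans t0t.
have tb : t <= b by case/andP: tab.
have ball_out s : a <= s -> t - r' < s -> s <= t ->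
     forall z, g s z -> 1 + K * (t - s) <= enorm (p - z).
  move=> sa sr st z gz.
  have : t - s < r' by lra.
  rewrite lt_min => /andP[A1 A2].
  have A3 : K * (t - s) <= 1.
    by rewrite mulrC -ler_pdivlMr// div1r ltW.
  have ts0 : t0 <= s by lra.
  case: (gfar s z ts0 (le_trans st ts1') gz) => [zR|zR].
    by have := enorm_lip p z; lra.
  have := minP s z ts0 st gz ltac:(lra).
  by have := enorm_lip z p; rewrite (enormB z p); lra.
have [_] := touching_ball ta tb ltr01 (ltW K0) r'0 xb xp1 ball_out tq.
suff -> : q = 0 by rewrite expr0n addr0 divr1 /K; lra.
(* u is zero on the sphere of radius R0 + 1, which g(t) does not meet, so the
   maximum principle on its exterior gives u = 0 there *)
have u0 z : R0 + 1 < enorm z -> u t z = 0.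
  move=> zR; apply/eqP; rewrite eq_le (pot_ge0 n_gt0 phi_gt0 z (gpot tab)) andbT.
  pose U := [set z : 'rV[R]_n | R0 + 1 < enorm z].
  apply: (@pot_le_super _ _ n_gt0 _ _ _ U _ (fun=> 0) (gpot tab)) => //.
  - rewrite openE => y yR; apply/interiorP; exists (enorm y - (R0 + 1)).
      by rewrite subr_gt0.
    by move=> y' yy'; rewrite /U /=; have := enorm_lip y y'; lra.
  - move=> y yR /(pot_Din (gpot t0ab)) /interior_subset /gR0.
    by move: yR; rewrite /U /=; lra.
  - exact: rV_continuous_cst.
  - move=> y _ _; exists 0 => //.
    have := lap_atZ 0 (lap_at_radial 0 0 1 y); rewrite mul0r.
    by apply: lap_at_ext; apply: filterE => y'; rewrite mul0r.
  - move=> y /closureP cy nUy.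
    have yR : enorm y = R0 + 1.
      apply/eqP; rewrite eq_le; apply/andP; split.
        by rewrite leNgt; apply/negP => ?; exact: nUy.
      apply/ler_addgt0Pr => e e0; have [y' /= y'R yy'] := cy e e0.
      by have := enorm_lip y' y; rewrite (enormB y' y) /U /= in y'R *; lra.
    rewrite (pot_out (gpot tab))// => gy.
    by case: (gfar t y tt0 ts1' gy); lra.
apply/eqP; rewrite -normr_le0; apply/ler_addgt0Pr => e e0; rewrite add0r.
have [r r0 H] := normal_derivative_in nq e0.
pose N := outward_normal (g t) x.
pose d := Num.min (r / 2) (enorm N + 1)^-1.
have N1 : 0 < enorm N + 1 by rewrite ltr_wpDl.
have d0 : 0 < d by rewrite lt_min divr_gt0//= invr_gt0.
have dr : d < r by rewrite gt_min; apply/orP; left; lra.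
have dN : d * enorm N <= 1.
  apply: (@le_trans _ _ ((enorm N + 1)^-1 * (enorm N + 1))); last by rewrite mulVf ?gt_eqF.
  apply: ler_pM => //; [exact: ltW| |by rewrite lerDl].
  by rewrite ge_min lexx orbT.
have := H d d0 dr; rewrite -/N (u0 x); last by lra.
rewrite u0; last first.
  have := enorm_lip x (x - d *: N); rewrite subKr enormZ (gtr0_norm d0).
  by lra.
by rewrite subr0 add0r normrM (gtr0_norm d0) ler_pM2r.
Qed.

End Bounded.

(** * Continuous induction along a flow *)

Section Growth.
Context {R : realType} {n : nat}.
Hypothesis n_gt0 : (0 < n)%N.
Context (Din : set 'rV[R]_n) (phi : 'rV[R]_n -> R).
Hypothesis phi_gt0 : forall x, closure Din x -> 0 < phi x.
Hypothesis Din_neq0 : Din !=set0.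
Context (a b : R) (u : R -> 'rV[R]_n -> R) (g : R -> set 'rV[R]_n).
Hypothesis G : smooth_MCND_flow Din setT phi a b u g.
Implicit Types (s t e : R) (x y z p : 'rV[R]_n).

(** Consider the supremum T of the times up to which the inclusion holds.  It
    holds at T because the signed distance is continuous in time, so that each
    point of g(T) is a limit of points of g(s), s < T.  If T < b, it is strict at
    T, as contact is excluded; it then persists for a short time after T, by
    compactness, since the flow is bounded just after T. *)
Lemma flow_inclusion (Phi : R -> 'rV[R]_n -> R) :
  (forall t x y, a <= t <= b -> Phi t x <= Phi t y + enorm (x - y)) ->
  (forall t x e, a <= t <= b -> 0 < e -> exists2 r : R, 0 < r &
     forall s y, a <= s <= b -> `|t - s| < r -> enorm (x - y) < r ->
       `|Phi t x - Phi s y| < e) ->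
  (forall x, g a x -> Phi a x < 0) ->
  (forall t, a < t -> t <= b ->
     (forall s x, a <= s -> s <= t -> g s x -> Phi s x <= 0) ->
     forall x, g t x -> Phi t x != 0) ->
  forall t x, a <= t <= b -> g t x -> Phi t x <= 0.
Proof.
move=> Plip Pnear Pa Pt.
have ab := flow_lt G.
have aab : a <= a <= b by rewrite lexx ltW.
pose S := [set t | a <= t <= b /\ forall s x, a <= s -> s <= t -> g s x -> Phi s x <= 0].
have Sa : S a.
  split => // s x sa1 sa2 gx; have sE : s = a by apply/eqP; rewrite eq_le sa1 sa2.
  by rewrite sE in gx *; exact: ltW (Pa _ gx).
have hS : has_sup S by split; [exists a|exists b => t [/andP[]]].
pose T := sup S.
have aT : a <= T by apply: (ub_le_sup (proj2 hS)).
have Tb : T <= b by apply: ge_sup; [exists a|move=> t [/andP[]]].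
have Tab : a <= T <= b by rewrite aT.
have below s x : a <= s -> s < T -> g s x -> Phi s x <= 0.
  move=> sa sT gx; have d0 : 0 < T - s by rewrite subr_gt0.
  have [t [_ tS] st] := sup_adherent d0 hS.
  by apply: (tS s x sa _ gx); move: st; rewrite -/T; lra.
have atT x : g T x -> Phi T x <= 0.
  move=> gx; move: aT; rewrite le_eqVlt => /orP[/eqP E|aT'].
    by rewrite -E in gx *; exact: ltW (Pa _ gx).
  apply/ler_addgt0Pr => e e0; rewrite add0r.
  have e2 : 0 < e / 2 by rewrite divr_gt0.
  have [r1 r10 H1] := Pnear T x (e / 2) Tab e2.
  have [r2 r20 H2] := flow_sdist_near n_gt0 Din_neq0 G x Tab e2.
  pose m := Num.min (T - a) (Num.min r1 r2).
  have m0 : 0 < m by rewrite !lt_min subr_gt0 aT' r10 r20.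
  pose s := T - m / 2.
  have sm : T - s < m by rewrite /s; lra.
  have sT : s < T by rewrite /s; lra.
  move: (sm); rewrite !lt_min => /and3P[A1 A2 A3].
  have sab : a <= s <= b by apply/andP; split; lra.
  have nTs : `|T - s| = T - s by rewrite gtr0_norm// subr_gt0.
  have := H1 s x sab; rewrite nTs subrr enorm0 => /(_ A2 r10).
  have := H2 s x sab; rewrite nTs subrr enorm0 => /(_ A3 r20).
  have xT := sdist_in_le0 gx.
  rewrite !ltr_norml => /andP[B1 B2] /andP[B3 B4].
  have [gs|gs] := pselect (g s x).
    by have := below s x ltac:(lra) sT gs; lra.
  have : sdist (g s) x < e / 2 by lra.
  rewrite sdist_out// => /(dist_lt (flow_neq0 Din_neq0 G sab))[y gy xy].
  by have := below s y ltac:(lra) sT gy; have := Plip s x y sab; lra.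
have upT s x : a <= s -> s <= T -> g s x -> Phi s x <= 0.
  by move=> sa; rewrite le_eqVlt => /orP[/eqP ->|]; [exact: atT|exact: below].
have strictT x : g T x -> Phi T x < 0.
  move=> gx; rewrite lt_neqAle atT// andbT.
  move: aT; rewrite le_eqVlt => /orP[/eqP E|aT']; last exact: (Pt T aT' Tb upT).
  by rewrite -E in gx *; rewrite lt_eqF// Pa.
move: Tb; rewrite le_eqVlt => /orP[/eqP TE|Tb'].
  move=> t x /andP[ta tb] gx; apply: upT => //.
  by rewrite TE.
exfalso.
have [r0 r00 [m Hm]] := flow_right_bounded n_gt0 phi_gt0 Din_neq0 G aT Tb'.
pose B := [set x : 'rV[R]_n | enorm x <= m].
have cB : compact B by apply: (@compact_enorm _ _ _ m) => //; exact: closed_enorm_ball.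
have [r1 r10 H] : exists2 r1 : R, 0 < r1 & forall s x, `|T - s| < r1 -> a <= s <= b ->
    enorm x <= m -> g s x -> Phi s x <= 0.
  have [r1 r10 H] : exists2 e : R, 0 < e & forall x, B x ->
      forall s, `|T - s| < e -> a <= s <= b -> g s x -> Phi s x <= 0.
    apply: (compact_uniform cB) => x xm.
    suff [r r0' Hr] : exists2 r : R, 0 < r & forall s y, a <= s <= b -> `|T - s| < r ->
        enorm (x - y) < r -> g s y -> Phi s y <= 0.
      exists r => //; apply/nbhs_enormP; exists r => // y xy e e0 er s ts sab.
      by apply: Hr => //; exact: lt_le_trans er.
    have [gx|gx] := pselect (g T x).
      have P0 : 0 < - Phi T x by rewrite oppr_gt0; exact: strictT.
      have [r r0' Hr] := Pnear T x _ Tab P0.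
      exists r => // s y sab ts xy _; have := Hr s y sab ts xy.
      by rewrite ltr_norml; lra.
    have xg : 0 < sdist (g T) x.
      by rewrite ltNge; apply/negP => /(flow_sdist_le0 Din_neq0 G _ Tab).
    have [r r0' Hr] := flow_sdist_near n_gt0 Din_neq0 G x Tab xg.
    exists r => // s y sab ts xy /sdist_in_le0.
    by have := Hr s y sab ts xy; rewrite ltr_norml; lra.
  by exists r1 => // s x ts sab xm; exact: (H x).
pose d := Num.min (b - T) (Num.min r0 r1) / 2.
have d0 : 0 < Num.min (b - T) (Num.min r0 r1) by rewrite !lt_min subr_gt0 Tb' r00 r10.
have dm : d < Num.min (b - T) (Num.min r0 r1) by rewrite /d; lra.
have d00 : 0 < d by rewrite /d; lra.
move: dm; rewrite !lt_min => /and3P[D1 D2 D3].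
have : S (T + d).
  split; first by apply/andP; split; lra.
  move=> s x sa sT gx; have [sT'|sT'] := leP s T; first exact: upT gx.
  have sab : a <= s <= b by apply/andP; split; lra.
  apply: (H s x) => //; first by rewrite distrC gtr0_norm ?subr_gt0//; lra.
  by apply: (Hm s x) => //; lra.
by move=> /(ub_le_sup (proj2 hS)); rewrite -/T; lra.
Qed.

(** A ball whose radius grows linearly encloses the flow.  At a first contact
    point x, which is farthest from the origin, the potential lies below the
    superharmonic function A (|x|^2 - |z|^2); this bounds its normal derivative,
    hence the speed at x, by a constant that depends on phi only. *)
Lemma flow_bounded : exists2 m : R, 0 < m &
  forall t x, a <= t <= b -> g t x -> enorm x <= m.
Proof.
have ab := flow_lt G.
have aab : a <= a <= b by rewrite lexx ltW.
have P := flow_potential G aab.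
have [R0 R00 gR0] := bounded_enormP (pot_bounded P).
have DR0 x : closure Din x -> enorm x <= R0 by move=> /(pot_Din P) /interior_subset /gR0.
have [c [M [_ M0 phiM']]] := flow_phi_bounds phi_gt0 Din_neq0 G.
have phiM x : closure Din x -> phi x <= M by move=> Dx; case/andP: (phiM' _ Dx).
(* 16 M^2 bounds the square of the normal derivative and the exterior ball of
   radius n contributes n / n = 1 *)
pose L := 2 * R0 + 1; pose K := 16 * M ^+ 2 + 2.
have K0 : 0 < K by rewrite /K ltr_wpDl// mulr_ge0// sqr_ge0.
pose rho t := L + K * (t - a).
have rhoL t : a <= t -> L <= rho t by move=> ta; rewrite lerDl mulr_ge0 ?subr_ge0// ltW.
exists (rho b); first by rewrite (lt_le_trans _ (rhoL b (ltW ab)))// /L; lra.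
move=> t x tab gx; suff : enorm x - rho t <= 0.
  have : rho t <= rho b by rewrite lerD2l ler_pM2l// lerD2r; case/andP: tab.
  by lra.
move: t x tab gx; apply: flow_inclusion.
- by move=> t x y _; have := enorm_lip x y; lra.
- move=> t x e tab e0; have K1 : 0 < K + 1 by rewrite addr_gt0.
  have [d d0 eE] : exists2 d, 0 < d & e = d + K * d.
    by exists (e / (K + 1)); [rewrite divr_gt0|field; rewrite gt_eqF].
  exists d => // s y _ ts xy.
  have -> : enorm x - rho t - (enorm y - rho s) = (enorm x - enorm y) - K * (t - s).
    by rewrite /rho; ring.
  apply: le_lt_trans (ler_normB _ _) _; rewrite normrM (gtr0_norm K0).
  have : `|enorm x - enorm y| <= enorm (x - y).
    rewrite ler_norml; have := enorm_lip x y; have := enorm_lip y x.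
    by rewrite (enormB y x); lra.
  have : K * `|t - s| < K * d by rewrite ltr_pM2l.
  by rewrite eE; lra.
- by move=> x /gR0; rewrite /rho subrr mulr0 /L; lra.
- move=> t ta tb Hs x gx; apply/negP => /eqP /subr0_eq xrho.
  have tab : a <= t <= b by rewrite ltW.
  have Pt := flow_potential G tab.
  have xL : L <= enorm x by rewrite xrho rhoL// ltW.
  have x0 : 0 < enorm x by apply: lt_le_trans xL; rewrite /L; lra.
  have x1 : 1 <= enorm x by apply: le_trans xL; rewrite /L; lra.
  have gball z : g t z -> enorm z <= enorm x.
    by move=> gz; have := Hs t z (ltW ta) (lexx t) gz; rewrite xrho; lra.
  have n0 : 0 < n%:R :> R by rewrite ltr0n.
  pose N := (enorm x)^-1 *: x.
  have N1 : enorm N = 1 by rewrite enormZ gtr0_norm ?invr_gt0// mulVf// gt_eqF.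
  pose p := x + n%:R *: N.
  have xp : enorm (x - p) = n%:R.
    by rewrite /p opprD addrA subrr add0r enormN enormZ N1 mulr1 gtr0_norm.
  have pE : enorm p = enorm x + n%:R.
    have -> : p = (1 + n%:R / enorm x) *: x by rewrite /p /N scalerA scalerDl scale1r.
    by rewrite enormZ ger0_norm ?addr_ge0 ?divr_ge0//; field; rewrite gt_eqF.
  have xb : bnd (g t) x.
    apply/bndP; split; first exact: subset_closure.
    apply/closureP => e e0; exists (x + (e / 2) *: N).
      move=> /gball; have -> : x + (e / 2) *: N = (1 + (e / 2) / enorm x) *: x.
        by rewrite /N scalerA scalerDl scale1r.
      rewrite enormZ ger0_norm ?addr_ge0 ?divr_ge0 ?(ltW e0)// mulrDl mul1r.
      by rewrite divfK ?gt_eqF//; lra.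
    by rewrite opprD addrA subrr add0r enormN enormZ N1 mulr1 gtr0_norm; lra.
  have [q nq tq] := flow_touch_data G tab xb.
  have ball_out s : a <= s -> t - 1 < s -> s <= t ->
      forall z, g s z -> n%:R + K * (t - s) <= enorm (p - z).
    move=> sa _ st z gz; have := Hs s z sa st gz.
    have := enorm_lip p z; rewrite pE xrho /rho.
    by lra.
  have [nuE KE] := touching_ball n_gt0 Din_neq0 G ta tb n0 (ltW K0) ltr01 xb xp ball_out tq.
  have {}nuE : outward_normal (g t) x = N.
    by rewrite nuE /p addrC addKr scalerA mulVf ?gt_eqF// scale1r.
  (* at points of Din, of norm at most |x| / 2, the barrier is at least M *)
  pose A := 2 * M / enorm x ^+ 2.
  have A0 : 0 < A by rewrite divr_gt0 ?mulr_gt0// exprn_gt0.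
  have uA z : g t z -> u t z <= A * (enorm x ^+ 2 - enorm (z - 0) ^+ 2) ^+ 1.
    apply: (pot_le_out n_gt0 Pt
      (v := fun z => A * (enorm x ^+ 2 - enorm (z - 0) ^+ 2) ^+ 1)).
    - apply: rV_continuousM; first exact: rV_continuous_cst.
      exact: rV_continuous_radial.
    - move=> y _ _; eexists; last by apply: lap_atZ; exact: lap_at_radial.
      rewrite mulr_ge0_le0 ?(ltW A0)//= mulr0 !mul0r expr0 !mulr1 sub0r oppr_le0.
      by rewrite mulr_ge0.
    - move=> y Dy; rewrite (pot_in Pt Dy) expr1 subr0; apply: le_trans (phiM _ Dy) _.
      have : enorm y ^+ 2 <= enorm x ^+ 2 / 2.
        have yR := DR0 _ Dy.
        have : enorm y ^+ 2 <= (enorm x / 2) ^+ 2.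
          by rewrite ler_pXn2r ?nnegrE ?divr_ge0// ler_pdivlMr//; move: xL; rewrite /L; lra.
        by rewrite exprMn; have := sqr_ge0 (enorm x); lra.
      move=> yx; rewrite /A mulrAC ler_pdivlMr ?exprn_gt0//.
      by have := ler_wpM2l (ltW M0) yx; lra.
    - move=> y gy _; rewrite mulr_ge0 ?(ltW A0)// expr1 subr0 subr_ge0.
      by rewrite ler_pXn2r ?nnegrE// gball.
  have ux : u t x = 0.
    apply: (pot_out_interior Pt) => /interiorP[e e0 eg].
    have /eg /gball : enorm (x - (x + (e / 2) *: N)) < e.
      by rewrite opprD addrA subrr add0r enormN enormZ N1 mulr1 gtr0_norm; lra.
    have -> : x + (e / 2) *: N = (1 + (e / 2) / enorm x) *: x.
      by rewrite /N scalerA scalerDl scale1r.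
    rewrite enormZ ger0_norm ?addr_ge0 ?divr_ge0 ?(ltW e0)// mulrDl mul1r.
    by rewrite divfK ?gt_eqF//; lra.
  have Ax : A * enorm x <= 2 * M.
    have -> : A * enorm x = 2 * M / enorm x by rewrite /A; field; rewrite gt_eqF.
    by rewrite ler_pdivrMr// ler_peMr// mulr_ge0// ltW.
  have qbounds e : 0 < e -> - (4 * M) - e <= q /\ q <= e.
    move=> e0; have [r r0 H] := normal_derivative_in nq e0.
    pose d := r / 2; have d0 : 0 < d by rewrite divr_gt0.
    have := H d d0 ltac:(rewrite /d; lra); rewrite nuE ux subr0 ler_norml => /andP[B1 B2].
    have u0 := pot_ge0 n_gt0 phi_gt0 (x - d *: N) Pt.
    have uU : u t (x - d *: N) <= 4 * M * d.
      have [gz|/(pot_out Pt) ->] := pselect (g t (x - d *: N)); last first.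
        by rewrite !mulr_ge0// ltW.
      apply: le_trans (uA _ gz) _; rewrite expr1 subr0.
      have -> : x - d *: N = (1 - d / enorm x) *: x.
        by rewrite /N scalerA scalerBl scale1r.
      rewrite enormZ exprMn real_normK ?num_real//.
      have -> : A * (enorm x ^+ 2 - (1 - d / enorm x) ^+ 2 * enorm x ^+ 2) =
        2 * (A * enorm x) * d - A * d ^+ 2 by field; rewrite gt_eqF.
      have : 0 <= A * d ^+ 2 by rewrite mulr_ge0 ?sqr_ge0// ltW.
      have : A * enorm x * d <= 2 * M * d by rewrite ler_pM2r.
      by lra.
    split; rewrite -(ler_pM2r d0); lra.
  have q0 : q <= 0 by apply/ler_addgt0Pr => e e0; rewrite add0r; case: (qbounds e e0).
  have qM : - (4 * M) <= q.
    by apply/ler_addgt0Pr => e e0; have [] := qbounds e e0; lra.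
  have : q ^+ 2 <= (4 * M) ^+ 2.
    by rewrite -sqrrN ler_pXn2r ?nnegrE ?oppr_ge0//; lra.
  move: KE; rewrite divff ?gt_eqF// /K exprMn.
  by lra.
Qed.

End Growth.

(** * Uniform estimates for the potentials of a flow near Din *)

Section Comparison.
Context {R : realType} {n : nat}.
Hypothesis n_gt0 : (0 < n)%N.
Context (Din : set 'rV[R]_n) (phi : 'rV[R]_n -> R).
Hypothesis phi_gt0 : forall x, closure Din x -> 0 < phi x.
Hypothesis Din_neq0 : Din !=set0.
Hypothesis Din_open : open Din.
Implicit Types (s t e : R) (x y z p h : 'rV[R]_n).

Section OuterFlow.
Context (a' b' : R) (w : R -> 'rV[R]_n -> R) (f : R -> set 'rV[R]_n).
Hypothesis F : smooth_MCND_flow Din setT phi a' b' w f.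
Context (a b : R).
Hypothesis ab : a <= b.
Hypotheses (a'a : a' <= a) (bb' : b <= b').

Let sub t : a <= t <= b -> a' <= t <= b'.
Proof. by move=> /andP[at_ tb]; rewrite (le_trans a'a at_) (le_trans tb bb'). Qed.

Let fpot t : a <= t <= b -> potential Din phi (f t) (w t).
Proof. by move=> /sub; exact: (flow_potential F). Qed.

Let aab : a <= a <= b. Proof. by rewrite lexx. Qed.

Let Din_compact : compact (closure Din).
Proof.
have [r _ fr] := bounded_enormP (pot_bounded (fpot aab)).
apply: (@compact_enorm _ _ _ r); first exact: closed_closure.
by move=> x /(pot_Din (fpot aab)) /interior_subset /fr.
Qed.

Lemma flow_Din_depth : exists2 eta : R, 0 < eta & forall t x, a <= t <= b ->
  closure Din x -> sdist (f t) x <= - eta.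
Proof.
pose K := closure Din `*` (`[a, b]%classic : set R^o).
have cK : compact K by apply: compact_setX => //; exact: segment_compact.
have [e e0 He] : exists2 e : R, 0 < e & forall p : 'rV[R]_n * R^o, K p ->
    a <= p.2 <= b -> sdist (f p.2) p.1 <= - e.
  apply: (compact_uniform cK) => -[x0 t0] [/= Dx]; rewrite in_itv /= => t0ab.
  have x0f : 0 < - sdist (f t0) x0.
    rewrite oppr_gt0; apply/(flow_sdist_lt0 n_gt0 F _ (sub t0ab)).
    exact: (pot_Din (fpot t0ab)).
  have d0 : 0 < - sdist (f t0) x0 / 2 by rewrite divr_gt0.
  have [r r0 H] := flow_sdist_near n_gt0 Din_neq0 F x0 (sub t0ab) d0.
  exists (- sdist (f t0) x0 / 2) => //.
  apply/nbhs_space_time; exists r => // x t xr tr e e0 ed tab.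
  by have := H t x (sub tab) tr xr; rewrite ltr_norml => /andP[B1 B2] /=; lra.
by exists e => // t x tab Dx; apply: (He (x, t)) => //; split => //=; rewrite in_itv.
Qed.

Section Depth.
Context (eta : R).
Hypothesis eta_gt0 : 0 < eta.
Hypothesis eta_depth : forall t x, a <= t <= b -> closure Din x -> sdist (f t) x <= - eta.

Lemma near_Din_interior t x p : a <= t <= b -> closure Din p -> enorm (x - p) < eta ->
  interior (f t) x.
Proof.
move=> tab Dp xp; apply/(flow_sdist_lt0 n_gt0 F _ (sub tab)).
have := flow_sdist_lip n_gt0 Din_neq0 F x p (sub tab); have := eta_depth tab Dp.
by lra.
Qed.

(** Each point of the closure of Din is close to a ball contained in Din, where
    the potentials are at least the minimum of phi; around it the flow contains
    a ball of radius eta at all times, so the barrier of harmonic_lower_bound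
    gives a bound that does not depend on time. *)
Lemma flow_potential_lower_bound : exists2 c : R, 0 < c &
  forall t x p, a <= t <= b -> closure Din p -> enorm (x - p) <= eta / 4 -> c <= w t x.
Proof.
have [c0 [M [c00 _ phic]]] := flow_phi_bounds phi_gt0 Din_neq0 F.
have [c cgt0 Hc] : exists2 c : R, 0 < c & forall p, closure Din p ->
    forall t x, a <= t <= b -> enorm (x - p) <= eta / 4 -> c <= w t x.
  apply: (compact_uniform Din_compact) => p0 /closureP Dp0.
  have eta8 : 0 < eta / 8 by rewrite divr_gt0.
  have [p Dp p0p] := Dp0 _ eta8.
  have [r r0 rD] : exists2 r : R, 0 < r & forall y, enorm (p - y) < r -> Din y.
    by apply/nbhs_enormP; exact: open_nbhs_nbhs.
  have r20 : 0 < r / 2 by rewrite divr_gt0.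
  have [c cgt0 Hc] := harmonic_lower_bound n_gt0 r20 eta_gt0 c00.
  exists c => //; apply/nbhs_enormP; exists (eta / 8) => // p' p0p' e e0 ec t x tab xp'.
  apply: (le_trans ec); have P := fpot tab.
  apply: (Hc (w t) (closure Din) p).
  - exact: pot_continuous P.
  - exact: closed_closure.
  - by move=> y; exact: pot_ge0 P.
  - by move=> y Dy; rewrite (pot_in P Dy); case/andP: (phic _ Dy).
  - by move=> y yp; apply: subset_closure; apply: rD; rewrite enormB; lra.
  - move=> y yp Dy; apply: (pot_harmonic P) => //.
    by apply: near_Din_interior yp => //; exact: subset_closure.
  - have := enorm_triangle x p' p; have := enorm_triangle p' p0 p.
    by rewrite (enormB p' p0); lra.
by exists c => // t x p tab Dp; exact: Hc.
Qed.

(** At distance eta / 8 of Din the potentials are harmonic in cubes of a fixed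
    size, and they are bounded by the maximum of phi. *)
Lemma flow_potential_lipschitz : exists d L : R, [/\ 0 < d, 0 <= L &
  forall t x h, a <= t <= b -> dist x Din = eta / 8 -> enorm h < d ->
    w t (x + h) - w t x <= L * enorm h].
Proof.
have [c [M [_ M0 phiM']]] := flow_phi_bounds phi_gt0 Din_neq0 F.
have phiM y : closure Din y -> phi y <= M by move=> Dy; case/andP: (phiM' _ Dy).
have n0 : 0 < n%:R :> R by rewrite ltr0n.
(* a cube of half-width 2 d is contained in a Euclidean ball of radius eta / 8 *)
pose d := eta / 8 / (2 * n%:R).
have d0 : 0 < d by rewrite !divr_gt0// mulr_gt0.
have L0 : 0 <= n%:R ^+ 2 * M / d by rewrite divr_ge0 ?mulr_ge0 ?sqr_ge0// ltW.
exists d, (n%:R ^+ 2 * M / d); split => // t x h tab xD hd.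
have P := fpot tab.
have hd' : `|h| < d by apply: le_lt_trans (norm_le_enorm h) hd.
apply: (@le_trans _ _ (n%:R ^+ 2 * M / d * `|h|)); last first.
  by rewrite ler_wpM2l// norm_le_enorm.
apply: harmonic_diff_le => //.
- exact: pot_continuous P.
- exact: ltW.
- by move=> y; rewrite (pot_ge0 n_gt0 phi_gt0 y P) (pot_le_cst n_gt0 y P (ltW M0) phiM).
- move=> y yx.
  have yxe : enorm (y - x) < eta / 8.
    apply: le_lt_trans (enorm_le_norm _) _.
    have -> : eta / 8 = n%:R * (2 * d) by rewrite /d; field; rewrite gt_eqF.
    by rewrite ltr_pM2l.
  have yD : 0 < dist y Din by have := dist_lip Din x y; rewrite (enormB x y); lra.
  apply: (pot_harmonic P); last first.
    by move=> /(dist_le_closure _ Din_neq0); rewrite leNgt yD.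
  have [p Dp yp] : exists2 p, Din p & enorm (y - p) < eta.
    by apply: dist_lt => //; have := dist_lip Din y x; lra.
  by apply: near_Din_interior yp => //; exact: subset_closure.
Qed.

End Depth.
End OuterFlow.
End Comparison.

(** * Strict comparison of smooth flows *)

Section StrictComparison.
Context {R : realType} {n : nat}.
Hypothesis n_gt0 : (0 < n)%N.
Context (Din : set 'rV[R]_n) (phi : 'rV[R]_n -> R).
Hypothesis phi_gt0 : forall x, closure Din x -> 0 < phi x.
Hypothesis Din_neq0 : Din !=set0.
Implicit Types (s t e : R) (x y z p h : 'rV[R]_n).

(** The maximum principle on the part of E + h at distance more than rho of Din.
    On the surface at distance rho, u <= v by monotonicity, and the Lipschitz
    bound and the lower bound for v absorb the translation into the factor
    1 + (L / c) |h|; on the boundary of E the left-hand side vanishes.  Working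
    away from Din avoids estimates up to the boundary of Din. *)
Lemma shifted_potential_le (E F : set 'rV[R]_n) (u v : 'rV[R]_n -> R) h (rho c L : R) :
  potential Din phi E u -> potential Din phi F v -> E `<=` F ->
  (forall z, interior E z -> interior F (z + h)) ->
  enorm h < rho -> 0 < c -> 0 <= L ->
  (forall z, dist z Din = rho -> c <= v z) ->
  (forall z, dist z Din = rho -> v (z - h) - v z <= L * enorm h) ->
  forall z, rho < dist (z + h) Din -> u z <= (1 + L / c * enorm h) * v (z + h).
Proof.
move=> PE PF EF EFh hrho c0 L0 vc vL z zrho.
pose gam := 1 + L / c * enorm h.
have gam0 : 0 <= L / c * enorm h by rewrite mulr_ge0// divr_ge0// ltW.
pose U := [set z : 'rV[R]_n | rho < dist (z + h) Din].
have dlip (x y : 'rV[R]_n) : dist (x + h) Din <= dist (y + h) Din + enorm (x - y).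
  by have := dist_lip Din (x + h) (y + h); rewrite opprD addrACA subrr addr0.
have notin x : rho < dist (x + h) Din -> ~ closure Din x.
  move=> xr /(dist_le_closure _ Din_neq0) xD.
  by have := dist_lip Din (x + h) x; rewrite addrAC subrr add0r; lra.
apply: (@pot_le_super _ _ n_gt0 _ _ E U u (fun z => gam * v (z + h)) PE) => //.
- rewrite openE => x xU; apply/interiorP; exists (dist (x + h) Din - rho).
    by rewrite subr_gt0.
  by move=> y xy; rewrite /U /=; have := dlip x y; lra.
- apply: rV_continuousM; first exact: rV_continuous_cst.
  by apply: rV_continuous_shift; exact: pot_continuous PF.
- move=> x Ex xU; exists (gam * 0); first by rewrite mulr0.
  apply: lap_atZ; apply: lap_at_shift; apply: (pot_harmonic PF); first exact: EFh.
  move=> /(dist_le_closure _ Din_neq0); move: xU; rewrite /U /=.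
  by have := enorm_ge0 h; lra.
- move=> x /closureP cx nxU.
  have xr : dist (x + h) Din = rho.
    apply/eqP; rewrite eq_le; apply/andP; split.
      by rewrite leNgt; apply/negP.
    apply/ler_addgt0Pr => e e0; have [y /= yU xy] := cx e e0.
    by have := dlip y x; rewrite (enormB y x); move: yU; rewrite /U /=; lra.
  have := pot_mono n_gt0 phi_gt0 x PE PF EF => /le_trans; apply.
  have := vL _ xr; rewrite addrK => H1.
  have : L * enorm h <= L / c * enorm h * v (x + h).
    have -> : L * enorm h = L / c * enorm h * c by field; rewrite gt_eqF.
    by rewrite ler_wpM2l// vc.
  by rewrite /gam mulrDl mul1r; lra.
- by move=> x; rewrite mulr_ge0 ?(pot_ge0 n_gt0 phi_gt0 _ PF)// /gam; lra.
Qed.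

Lemma normal_derivative_compare (E F : set 'rV[R]_n) (u v : 'rV[R]_n -> R)
    x y q q' (k r : R) :
  outward_normal E x = outward_normal F y -> 0 < r -> 0 <= k ->
  u x = 0 -> v y = 0 -> (forall z, 0 <= u z) ->
  (forall z, enorm z < r -> u (x + z) <= k * v (y + z)) ->
  is_normal_derivative E u x q -> is_normal_derivative F v y q' ->
  q ^+ 2 <= k ^+ 2 * q' ^+ 2.
Proof.
move=> nuE r0 k0 ux vy + + /normal_derivative_in hq /normal_derivative_in hq'.
rewrite -nuE in hq'; move: (outward_normal E x) hq hq' {nuE} => N hq hq'.
have small e : 0 < e -> exists d, [/\ 0 < d, enorm (- (d *: N)) < r,
    `|u (x - d *: N) + q * d| <= e * d & `|v (y - d *: N) + q' * d| <= e * d].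
  move=> e0.
  have [r1 r10 H1] := hq _ e0.
  have [r2 r20 H2] := hq' _ e0.
  have N1 : 0 < enorm N + 1 by rewrite ltr_wpDl.
  pose m := Num.min r1 (Num.min r2 (r / (enorm N + 1))).
  have m0 : 0 < m by rewrite !lt_min r10 r20 divr_gt0.
  pose d := m / 2; have d0 : 0 < d by rewrite divr_gt0.
  have : d < m by rewrite /d; lra.
  rewrite !lt_min => /and3P[d1 d2 d3].
  have := H1 d d0 d1; have := H2 d d0 d2.
  rewrite ux vy !subr0 => A1 A2; exists d; split => //.
  rewrite enormN enormZ gtr0_norm//; move: d3; rewrite ltr_pdivlMr//.
  by apply: le_lt_trans; rewrite ler_pM2l// lerDl.
clear hq hq'; move=> u0 uv.
have H e : 0 < e -> - q <= k * (- q') + e * (1 + k) /\ 0 <= - q + e.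
  move=> e0; have [d [d0 dN A1 A2]] := small e e0.
  have B2 := uv _ dN; have B1 := u0 (x - d *: N); clear uv u0 small.
  move: A1 A2; rewrite !ler_norml => /andP[A1 A2] /andP[A3 A4].
  have B3 : k * v (y - d *: N) <= k * (e * d - q' * d) by rewrite ler_wpM2l//; lra.
  by split; rewrite -(ler_pM2r d0); lra.
clear u0 uv small.
have q0 : 0 <= - q.
  by apply/ler_addgt0Pr => e e0; have [] := H e e0.
have qq' : - q <= k * (- q').
  apply/ler_addgt0Pr => e e0; have k1 : 0 < 1 + k by rewrite ltr_pwDl.
  have [+ _] := H (e / (1 + k)) (divr_gt0 e0 k1).
  by rewrite divfK ?gt_eqF.
clear H; rewrite -sqrrN -[q' ^+ 2]sqrrN -exprMn ler_pXn2r ?nnegrE//.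
exact: le_trans qq'.
Qed.

Lemma gap_contradiction (A B d m Q C : R) : 0 < d -> d <= 1 -> 0 <= m -> 0 <= B -> B <= Q ->
  (2 * m + m ^+ 2) * Q < C -> A <= (1 + m * d) ^+ 2 * B -> A < B + d * C.
Proof.
move=> d0 d1 m0 B0 BQ mQ /le_lt_trans; apply.
have -> : (1 + m * d) ^+ 2 * B = B + d * ((2 * m + m ^+ 2 * d) * B) by ring.
rewrite ltrD2l ltr_pM2l//; apply: le_lt_trans mQ.
have m2 : 0 <= m ^+ 2 by exact: sqr_ge0.
apply: ler_pM => //; first by rewrite addr_ge0// mulr_ge0// ltW.
by rewrite lerD2l ler_piMr.
Qed.

Context (a' b' : R) (w : R -> 'rV[R]_n -> R) (f : R -> set 'rV[R]_n).
Hypothesis F : smooth_MCND_flow Din setT phi a' b' w f.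
Context (a b : R) (u : R -> 'rV[R]_n -> R) (g : R -> set 'rV[R]_n).
Hypothesis G : smooth_MCND_flow Din setT phi a b u g.
Hypotheses (a'a : a' <= a) (bb' : b <= b').
Hypothesis Din_open : open Din.

Let sub t : a <= t <= b -> a' <= t <= b'.
Proof. by move=> /andP[at_ tb]; rewrite (le_trans a'a at_) (le_trans tb bb'). Qed.

(** Suppose that g first meets the inner parallel set of f of depth delta at time
    t, at the point x, and let y be a point nearest to x on the boundary of f.
    After the translation by h = y - x, of length delta t, the signed distances
    touch, so that the normals at x and y agree and the Laplacians are ordered.
    As the depth decreases at relative rate at least C, the velocity laws force
    the squared normal derivative at x to exceed the one at y by C (delta t).
    But g + h lies in f, so the comparison of the potentials bounds this excess
    by a fixed multiple of delta t. *)
Lemma no_first_contact (rho c L Q C : R) (delta : R -> R) t x :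
  a < t -> t <= b -> 0 < rho -> 0 < c -> 0 <= L ->
  (forall s, 0 < delta s) -> delta t <= 1 -> delta t < rho ->
  (forall s, s <= t -> delta t * (1 + C * (t - s)) <= delta s) ->
  (2 * (L / c) + (L / c) ^+ 2) * Q < C ->
  (forall z, dist z Din <= rho -> sdist (f t) z < 0) ->
  (forall z, dist z Din = rho -> c <= w t z) ->
  (forall z h, dist z Din = rho -> enorm h <= delta t ->
     w t (z + h) - w t z <= L * enorm h) ->
  (forall y q, bnd (f t) y -> enorm y <= enorm x + 1 ->
     is_time_derivative a' b' (fun s => sdist (f s) y) t
       (laplacian (sdist (f t)) y - q ^+ 2) -> q ^+ 2 <= Q) ->
  (forall s z, a <= s -> s <= t -> g s z -> sdist (f s) z <= - delta s) ->
  g t x -> sdist (f t) x <> - delta t.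
Proof.
move=> ta tb rho0 c0 L0 d0 d1 drho dE CQ rhof wc wL fQ gf gx xd.
have tab : a <= t <= b by rewrite ltW.
have tab' := sub tab.
have PG := flow_potential G tab; have PF := flow_potential F tab'.
have deep s z : a <= s -> s <= t -> sdist (f s) z <= sdist (g s) z - delta s.
  move=> sa st; have sab : a <= s <= b by rewrite sa (le_trans st).
  apply: sdist_deep => //.
  - exact: (flow_neq0 Din_neq0 G).
  - exact: (flow_setC_neq0 n_gt0 F (sub sab)).
  - by move=> z' gz; exact: gf.
have fx : f t x by apply: sdist_lt0; rewrite xd oppr_lt0.
have [y cy xy] := nearest_point x (flow_setC_neq0 n_gt0 F tab').
have {}xy : enorm (x - y) = delta t by move: xd; rewrite (sdist_in fx) xy; lra.
have yf0 : sdist (f t) y = 0.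
  apply/eqP; rewrite eq_le; apply/andP; split.
    have := flow_sdist_lip n_gt0 Din_neq0 F y x tab'.
    by rewrite (enormB y x) xd xy; lra.
  rewrite leNgt; apply/negP.
  by move=> /(flow_sdist_lt0 n_gt0 F _ tab'); apply/closure_setCP.
have yb : bnd (f t) y by apply/(flow_bnd n_gt0 Din_neq0 F).
have xg0 : sdist (g t) x = 0.
  apply/eqP; rewrite eq_le sdist_in_le0//=.
  have := deep t y (ltW ta) (lexx t); have := flow_sdist_lip n_gt0 Din_neq0 G y x tab.
  by rewrite (enormB y x) xy yf0; lra.
have xb : bnd (g t) x by apply/(flow_bnd n_gt0 Din_neq0 G).
pose h := y - x.
have xh : x + h = y by rewrite /h addrC subrK.
have hd : enorm h = delta t by rewrite /h enormB.
have shift z : sdist (f t) (z + h) <= sdist (g t) z.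
  have := deep t (z + h) (ltW ta) (lexx t).
  have := flow_sdist_lip n_gt0 Din_neq0 G (z + h) z tab.
  have -> : z + h - z = h by rewrite addrAC subrr add0r.
  by rewrite hd; lra.
have gm0 : 0 <= L / c by rewrite divr_ge0// ltW.
have k0 : 0 <= 1 + L / c * enorm h by rewrite addr_ge0// mulr_ge0.
have wLh z : dist z Din = rho -> w t (z - h) - w t z <= L * enorm h.
  by move=> zr; rewrite -(enormN h); apply: wL; rewrite // enormN hd lexx.
have hrho : enorm h < rho by rewrite hd; exact: drho.
have [q nq tq] := flow_touch_data G tab xb.
have [q' nq' tq'] := flow_touch_data F tab' yb.
have gL := flow_lap_at G tab xb.
have fL : lap_at (fun z => sdist (f t) (z + h)) x (laplacian (sdist (f t)) y).
  by apply: lap_at_shift; rewrite xh; exact: (flow_lap_at F tab' yb).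
have touch : \forall z \near x, sdist (f t) (z + h) - sdist (f t) (x + h) <=
    sdist (g t) z - sdist (g t) x.
  by apply: filterE => z; rewrite xh yf0 xg0 !subr0.
have nuE : outward_normal (g t) x = outward_normal (f t) y.
  by rewrite /outward_normal -(touching_grad gL fL touch) grad_shift xh.
have ta' : a' < t by exact: le_lt_trans ta.
have tb' : t <= b' by exact: le_trans bb'.
have timeP s : a <= s -> a' <= s -> t - 1 < s -> s < t ->
    sdist (f s) y - sdist (f t) y + delta t * C * (t - s) <= sdist (g s) x - sdist (g t) x.
  move=> sa _ _ st; rewrite yf0 xg0 !subr0.
  have sab : a <= s <= b by rewrite sa (le_trans (ltW st)).
  have H1 := deep s y sa (ltW st).
  have H2 := flow_sdist_lip n_gt0 Din_neq0 G y x sab.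
  have H3 : delta t + delta t * C * (t - s) <= delta s.
    by have := dE s (ltW st); rewrite mulrDr mulr1 mulrA.
  by move: H1 H2 H3; rewrite (enormB y x) xy; lra.
have vel := time_derivative_le ta tb ta' tb' ltr01 tq tq' timeP.
have gap : q' ^+ 2 + delta t * C <= q ^+ 2.
  move: vel (touching_laplacian gL fL touch).
  by set l := laplacian _ x; set l' := laplacian _ y; clearbody l l'; lra.
clear vel.
have gft : g t `<=` f t.
  move=> z gz; apply: sdist_lt0; apply: le_lt_trans (gf t z (ltW ta) (lexx t) gz) _.
  by rewrite oppr_lt0; exact: d0.
have intgf z : interior (g t) z -> interior (f t) (z + h).
  move=> gz; apply/(flow_sdist_lt0 n_gt0 F _ tab').
  apply: le_lt_trans (shift z) _.
  exact/(flow_sdist_lt0 n_gt0 G _ tab).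
have uw := shifted_potential_le PG PF gft intgf hrho c0 L0 wc wLh.
have yrho : rho < dist y Din.
  by rewrite ltNge; apply/negP => /rhof; rewrite yf0 ltxx.
have ux : u t x = 0.
  apply: (pot_out_interior PG) => /(flow_sdist_lt0 n_gt0 G _ tab).
  by rewrite xg0 ltxx.
have wy : w t y = 0.
  apply: (pot_out_interior PF) => /(flow_sdist_lt0 n_gt0 F _ tab').
  by rewrite yf0 ltxx.
have qQ : q' ^+ 2 <= Q.
  apply: (fQ y q' yb _ tq').
  by have := enorm_lip y x; rewrite (enormB y x) xy; lra.
have uwz z : enorm z < dist y Din - rho ->
    u t (x + z) <= (1 + L / c * enorm h) * w t (y + z).
  move=> zr; have := uw (x + z); rewrite addrAC xh; apply.
  have := dist_lip Din y (y + z); rewrite opprD addrA subrr add0r enormN.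
  by lra.
have d0t := d0 t.
clear uw wLh intgf gft timeP touch shift deep gf fQ wL wc rhof dE d0 gL fL.
have r0 : 0 < dist y Din - rho by rewrite subr_gt0.
have qq : q ^+ 2 <= (1 + L / c * enorm h) ^+ 2 * q' ^+ 2.
  apply: (normal_derivative_compare nuE r0 k0 ux wy _ uwz nq nq') => z.
  exact: pot_ge0 PG.
rewrite hd in qq.
have := gap_contradiction d0t d1 gm0 (sqr_ge0 q') qQ CQ qq.
by rewrite ltNge gap.
Qed.

(** The inner parallel sets of f of depth delta0 exp (- C (t - a)) are a strict
    supersolution once C is large, by no_first_contact, and delta0 is small
    enough for the first of them to contain g(a). *)
Lemma strict_comparison : g a `<=` interior (f a) -> g b `<=` interior (f b).
Proof.
move=> gfa; have ab := ltW (flow_lt G).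
have aab : a <= a <= b by rewrite lexx.
have bab : a <= b <= b by rewrite lexx andbT.
have [m m0 gm] := flow_bounded n_gt0 phi_gt0 Din_neq0 G.
have [eta eta0 etaP] := flow_Din_depth n_gt0 Din_neq0 F ab a'a bb'.
have [c c0 wc] := flow_potential_lower_bound n_gt0 phi_gt0 Din_neq0 Din_open F
  ab a'a bb' eta0 etaP.
have [d [L [d0 L0 wL]]] := flow_potential_lipschitz n_gt0 phi_gt0 Din_neq0 F
  a'a bb' eta0 etaP.
have [Q Q0 fQ] := flow_normal_bound n_gt0 Din_neq0 F (m + 1).
have [gap gap0 gapP] : exists2 gap : R, 0 < gap & forall x, g a x -> sdist (f a) x <= - gap.
  have P := flow_potential G aab.
  have [r _ gr] := bounded_enormP (pot_bounded P).
  have cg : compact (g a) by apply: (@compact_enorm _ _ _ r) => //; exact: pot_closed P.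
  have fa0 := flow_neq0 Din_neq0 F (sub aab).
  have fC0 := flow_setC_neq0 n_gt0 F (sub aab).
  have [x /set_mem gx xmax] := compact_EVT_max (flow_neq0 Din_neq0 G aab) cg
    (continuous_subspaceT (sdist_continuous fa0 fC0)).
  exists (- sdist (f a) x).
    by rewrite oppr_gt0; apply/(sdist_interior _ fC0); exact: gfa.
  by move=> y gy; rewrite opprK; apply: xmax; exact/mem_set.
pose rho := eta / 8.
have rho0 : 0 < rho by rewrite divr_gt0.
have [C C0 CQ] : exists2 C : R, 0 < C & (2 * (L / c) + (L / c) ^+ 2) * Q < C.
  exists ((2 * (L / c) + (L / c) ^+ 2) * Q + 1); last by rewrite ltrDl.
  rewrite ltr_wpDl// mulr_ge0 ?(ltW Q0)// addr_ge0 ?sqr_ge0// mulr_ge0// divr_ge0//.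
  exact: ltW.
have [delta0 [[delta00 D1 D2 D3] D4]] : exists delta0 : R,
    [/\ 0 < delta0, delta0 <= 1, delta0 < rho & delta0 < d] /\ delta0 < gap.
  have min0 : 0 < Num.min 1 (Num.min rho (Num.min d gap)).
    by rewrite !lt_min ltr01 rho0 d0.
  exists (Num.min 1 (Num.min rho (Num.min d gap)) / 2).
  have : Num.min 1 (Num.min rho (Num.min d gap)) / 2 <
         Num.min 1 (Num.min rho (Num.min d gap)) by lra.
  rewrite !lt_min => /and4P[D1 D2 D3 D4]; split => //; split => //; last exact: ltW.
  by rewrite divr_gt0.
pose delta s := delta0 * expR (- C * (s - a)).
have delta_gt0 s : 0 < delta s by rewrite mulr_gt0// expR_gt0.
have delta_le s : a <= s -> delta s <= delta0.
  move=> sa; rewrite /delta ler_piMr ?(ltW delta00)// -expR0 ler_expR.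
  by rewrite mulNr oppr_le0; apply: mulr_ge0; [exact: ltW|rewrite subr_ge0].
have deltaE s t : s <= t -> delta t * (1 + C * (t - s)) <= delta s.
  move=> st; have -> : delta s = delta t * expR (C * (t - s)).
    by rewrite /delta -mulrA -expRD; congr (_ * expR _); ring.
  by rewrite ler_pM2l// expR_ge1Dx.
have delta_cont : continuous delta.
  move=> s; apply: cvgM; first exact: cvg_cst.
  apply: (continuous_comp (f := fun s => - C * (s - a)) (g := expR));
    last exact: continuous_expR.
  apply: cvgM; first exact: cvg_cst.
  by apply: cvgB; [exact: cvg_id|exact: cvg_cst].
suff incl t x : a <= t <= b -> g t x -> sdist (f t) x + delta t <= 0.
  move=> x gx; apply/(flow_sdist_lt0 n_gt0 F _ (sub bab)).
  by have := incl b x bab gx; have := delta_gt0 b; lra.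
apply: (flow_inclusion n_gt0 phi_gt0 Din_neq0 G
  (Phi := fun t x => sdist (f t) x + delta t)).
- move=> s y z sab; have := flow_sdist_lip n_gt0 Din_neq0 F y z (sub sab).
  by lra.
- move=> s y e sab e0; have e2 : 0 < e / 2 by rewrite divr_gt0.
  have [r1 r10 H1] := flow_sdist_near n_gt0 Din_neq0 F y (sub sab) e2.
  have [r2 r20 H2] : exists2 r : R, 0 < r &
      forall s', `|s - s'| < r -> `|delta s - delta s'| < e / 2.
    have : \forall s' \near s, `|delta s - delta s'| < e / 2.
      by have /(@cvgrPdist_lt _ _ _ (nbhs s)) := delta_cont s; apply.
    by move=> /(@nbhs_ballP R R)[r /= r0 H]; exists r.
  exists (Num.min r1 r2); first by rewrite lt_min r10.
  move=> s' z s'ab; rewrite !lt_min => /andP[A1 A2] /andP[A3 _].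
  have := H1 s' z (sub s'ab) A1 A3; have := H2 s' A2.
  by rewrite !ltr_norml => /andP[B1 B2] /andP[B3 B4]; apply/andP; split; lra.
- move=> y gy; have := gapP y gy; have := delta_le a (lexx a); lra.
- move=> s sa sb Hs y gy; apply/negP => /eqP /eqP; rewrite addr_eq0 => /eqP.
  have sab : a <= s <= b by rewrite ltW.
  have dls := delta_le s (ltW sa).
  have ym := gm s y sab gy.
  apply: (@no_first_contact rho c L Q C delta s y) => //.
  - by lra.
  - by lra.
  - by move=> s' s's; exact: deltaE.
  - move=> z zrho; have [p Dp zp] : exists2 p, Din p & enorm (z - p) < eta.
      by apply: dist_lt => //; rewrite /rho in zrho; lra.
    apply/(flow_sdist_lt0 n_gt0 F _ (sub sab)).
    apply: (near_Din_interior n_gt0 Din_neq0 F a'a bb' etaP sab _ zp).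
    exact: subset_closure.
  - move=> z zrho; have [p Dp zp] : exists2 p, Din p & enorm (z - p) < eta / 4.
      by apply: dist_lt => //; rewrite zrho /rho; lra.
    by apply: (wc s z p sab _ (ltW zp)); exact: subset_closure.
  - by move=> z h zrho hs; apply: wL => //; lra.
  - move=> z q zb zy tq; apply: (fQ s z q) => //.
    + exact: le_lt_trans sa.
    + exact: le_trans bb'.
    + by lra.
  - by move=> s' z sa' ss' gz; have := Hs s' z sa' ss' gz; lra.
Qed.

End StrictComparison.

(** * Barriers and the minimal barrier *)

Section HausdorffSandwich.
Context {R : realType} {n : nat}.
Implicit Types (A B C : set 'rV[R]_n).

Lemma hausdorff_ge0 A B : (0 <= hausdorff A B)%E.
Proof. by apply/ereal_infP => _ [e [e0 _ _] <-]; rewrite lee_fin. Qed.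

Lemma thickenS A B (e e' : R) : A `<=` B -> e <= e' -> thicken A e `<=` thicken B e'.
Proof. by move=> AB ee' x [y Ay xy]; exists y; [exact: AB|exact: le_trans ee']. Qed.

Lemma hausdorff_sandwich A1 A2 B C : A1 `<=` B -> B `<=` A2 ->
  (hausdorff B C <= hausdorff A1 C + hausdorff A2 C)%E.
Proof.
move=> A1B BA2; apply: (@le_trans _ _ (maxe (hausdorff A1 C) (hausdorff A2 C))).
  rewrite leNgt; apply/negP; rewrite gt_max => /andP[].
  move=> /ereal_inf_lt[_ [e1 [e10 _ CA1] <-] h1] /ereal_inf_lt[_ [e2 [e20 A2C _] <-] h2].
  have : (hausdorff B C <= (Num.max e1 e2)%:E)%E.
    apply: ereal_inf_lbound; exists (Num.max e1 e2) => //; split.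
    - by rewrite le_max e10.
    - by move=> x /BA2 /A2C; apply: thickenS => //; rewrite le_max lexx orbT.
    - by move=> x /CA1; apply: thickenS => //; rewrite le_max lexx.
  by rewrite EFin_max leNgt gt_max h1 h2.
rewrite ge_max leeDl ?leeDr ?hausdorff_ge0//.
Qed.

End HausdorffSandwich.

Section Barriers.
Context {R : realType} {n : nat}.
Hypothesis n_gt0 : (0 < n)%N.
Context (Din : set 'rV[R]_n) (phi : 'rV[R]_n -> R).
Hypothesis phi_gt0 : forall x, closure Din x -> 0 < phi x.
Implicit Types (E : set 'rV[R]_n) (f : R -> set 'rV[R]_n).

Lemma global_flow_inside_minimal_barrier E f t : global_MCND_flow Din setT phi f (f 0) ->
  f 0 `<=` E -> 0 < t -> f t `<=` minimal_barrier Din setT phi `[0, +oo[ 0 E t.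
Proof.
move=> [_ Gf] fE t0 x fx psi [_ bpsi] Epsi; apply: (bpsi 0 t f) => //.
- by move=> s /=; rewrite !in_itv /= andbT => /andP[].
- exact: Gf.
- by move=> y /fE; exact: Epsi.
Qed.

(** The comparison principle needs a strict inclusion at the initial time, which
    for the interiors of f is no restriction: g(a) is compact, so its inclusion
    in the interior of f(a) has a positive depth. *)
Lemma interior_global_flow_barrier f : Din !=set0 -> open Din ->
  global_MCND_flow Din setT phi f (f 0) ->
  barrier Din setT phi `[0, +oo[ (fun t => interior (f t)).
Proof.
move=> Din0 oDin [_ Gf]; split=> [t|a b g Iab [u G] gfa].
  rewrite /= in_itv /= andbT => t0.
  have [w F] := Gf (t + 1) (ltr_wpDl t0 ltr01).
  have tab : 0 <= t <= t + 1 by rewrite t0 lerDl ler01.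
  have [[cD _] _] := mcnd_between F tab.
  have P := flow_potential F tab.
  have [r _ fr] := bounded_enormP (pot_bounded P).
  split; split => //.
  - by move=> x /(pot_Din P) /nbhs_interior.
  - apply: (@compact_enorm _ _ _ r); first exact: closed_closure.
    move=> x cx; apply: fr; apply: (pot_closed P).
    by apply: closureS cx; exact: interior_subset.
  - by move=> x _; rewrite interiorT.
have ab := flow_lt G.
have a0 : 0 <= a.
  have /Iab : `[a, b]%classic a by rewrite /= in_itv /= lexx ltW.
  by rewrite /= in_itv /= andbT.
have [w F] := Gf b (le_lt_trans a0 ab).
exact: (strict_comparison n_gt0 phi_gt0 Din0 F G a0 (lexx b) oDin gfa).
Qed.

Lemma minimal_barrier_inside_global_flow E f t : Din !=set0 -> open Din ->
  global_MCND_flow Din setT phi f (f 0) -> E `<=` interior (f 0) ->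
  minimal_barrier Din setT phi `[0, +oo[ 0 E t `<=` f t.
Proof.
move=> Din0 oDin Gf Ef x Mx; apply: interior_subset.
by apply: (Mx (fun t => interior (f t))) => //; exact: interior_global_flow_barrier.
Qed.

Lemma compactly_contained_thickening E : Din !=set0 -> contained_compactly Din E ->
  exists2 r : R, 0 < r & [set x | dist x Din <= r] `<=` E.
Proof.
move=> Din0 [cD DE].
have [r r0 rE] : exists2 r : R, 0 < r & forall p, closure Din p ->
    forall x, enorm (x - p) < r -> E x.
  apply: (compact_uniform cD) => p Dp; have /interiorP[e e0 eE] := DE _ Dp.
  have e2 : 0 < e / 2 by rewrite divr_gt0.
  exists (e / 2) => //; apply/nbhs_enormP; exists (e / 2) => // p' pp' r r0 re x xp'.
  by apply: eE; have := enorm_triangle p p' x; rewrite (enormB p' x); lra.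
exists (r / 2) => [|x /= xr]; first by rewrite divr_gt0.
have [p Dp xp] : exists2 p, Din p & enorm (x - p) < r by apply: dist_lt => //; lra.
by apply: (rE p) => //; exact: subset_closure.
Qed.

Lemma bounded_inside_thickening E : Din !=set0 -> bounded_set E ->
  exists2 r : R, 0 < r & E `<=` interior [set x | dist x Din <= r].
Proof.
move=> [p Dp] /bounded_enormP[m m0 Em]; exists (m + enorm p + 1).
  by have := enorm_ge0 p; lra.
move=> x /Em xm; apply/interiorP; exists 1 => // y xy /=.
have := dist_lip Din y x; have := dist_le x Dp; have := enormD x (- p).
by rewrite enormN (enormB y x); lra.
Qed.

End Barriers.

(** * Convergence of the minimal barrier *)

Theorem theorem1p5 (R : realType) (n : nat) (n_gt0 : (0 < n)%N)
  (Din : set 'rV[R]_n) (phi : 'rV[R]_n -> R)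
  (Din_smooth : smooth_open_set Din)
  (Din_Rn : contained_compactly Din setT)
  (phi_smooth : smooth_on (closure Din) phi)
  (phi_gt0 : forall x, closure Din x -> 0 < phi x)
  (Omega : set 'rV[R]_n)
  (Omega_opt : optimal_configuration Din setT phi Omega)
  (global_flows : forall r : R, 0 < r ->
    exists2 f : R -> set 'rV[R]_n,
      global_MCND_flow Din setT phi f [set x | dist x Din <= r] &
      hausdorff (f t) Omega @[t --> +oo] --> 0%E)
  (E0 : set 'rV[R]_n) (E0_bounded : bounded_set E0)
  (E0_Din : contained_compactly Din E0) :
  hausdorff (minimal_barrier Din setT phi `[0, +oo[ 0 E0 t) Omega
    @[t --> +oo] --> 0%E.
Proof.
have oDin : open Din by case: Din_smooth.
(* the distance to the empty set is 0, so D_1 would be the whole space, which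
   is not bounded *)
have Din0 : Din !=set0.
  apply/set0P/eqP => D0; have [f [f0 Gf] _] := global_flows 1 ltr01.
  have [u F] := Gf 1 ltr01.
  have [_ [cf _]] := mcnd_between F (t := 0) ltac:(by rewrite lexx ler01).
  have [r _ fr] := bounded_enormP (compact_bounded cf).
  have bf : bounded_set (f 0).
    by apply: (@bounded_enorm _ _ _ r) => x /subset_closure /fr.
  have [x fx] := bounded_setC_neq0 n_gt0 bf.
  by apply: fx; rewrite f0 /= /dist D0 image_set0 inf0 ler01.
have [r r0 rE] := compactly_contained_thickening Din0 E0_Din.
have [s s0 Es] := bounded_inside_thickening Din0 E0_bounded.
have [f [f0 Gf] hf] := global_flows r r0.
have [g [g0 Gg] hg] := global_flows s s0.
apply: (@squeeze_cvge _ _ _ _ (fun=> 0%E) _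
  (fun t => hausdorff (f t) Omega + hausdorff (g t) Omega)%E).
- exists 0; split; first exact: num_real.
  move=> t t0; rewrite hausdorff_ge0 /=; apply: hausdorff_sandwich.
    by apply: global_flow_inside_minimal_barrier => //; rewrite f0.
  by apply: (minimal_barrier_inside_global_flow n_gt0 phi_gt0) => //; rewrite g0.
- exact: cvg_cst.
- by rewrite -[X in _ --> X]adde0; apply: cvgeD.
Qed.
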